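(* Let $n\geq3$ be an odd integer and $m=\frac n2$. As $SU_{-1}(2)$-covariant systems, $C(D_n\setminus SU_{-1}(2))$ and $C^*(\eta^m)$ are isomorphic; that is, there is a $*$-isomorphism $\theta:C(D_n\setminus SU_{-1}(2))\to C^*(\eta^m)$ with $\delta\circ\theta=(\theta\otimes\mathrm{id})\circ\delta$.
   Context: All $C^*$-tensor products are minimal. $C(SU_{-1}(2))$ is the universal $C^*$-algebra generated by $x,u,v,y$ with $ux=-xu$, $vx=-xv$, $uy=-yu$, $vy=-yv$, $uv=vu$, $xy+uv=yx+uv=1$, $x^*=y$, $u^*=v$, with coproduct $\delta(x)=x\otimes x+u\otimes v$, $\delta(u)=x\otimes u+u\otimes y$, $\delta(v)=v\otimes x+y\otimes v$, $\delta(y)=v\otimes u+y\otimes y$. For $m\in\frac12\mathbb{Z}_{\ge0}$ the irreducible unitary representation $w(\pi_m)$ is indexed by $I_m=\{-m,-m+1,\dots,m\}$ with $w(\pi_m)_{t,-m}=\binom{2m}{m-t}^{1/2}x^{m-t}v^{m+t}$; the remaining entries are determined by $\delta(w(\pi_m)_{t,-m})=\sum_{s\in I_m} w(\pi_m)_{t,s}\otimes w(\pi_m)_{s,-m}$. Characters $\chi$ of $C(SU_{-1}(2))$ are identified with the matrices $\begin{pmatrix}\chi(x)&\chi(u)\\ \chi(v)&\chi(y)\end{pmatrix}$, which are $\begin{pmatrix}z&0\\ 0&\bar z\end{pmatrix}$ or $\begin{pmatrix}0&\bar z\\ z&0\end{pmatrix}$ with $|z|=1$, forming a group under matrix multiplication.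 For odd $n$, $D_n=\{\begin{pmatrix}z&0\\ 0&\bar z\end{pmatrix},\begin{pmatrix}0&\bar z\\ z&0\end{pmatrix}:z^n=1\}$, and $C(D_n\setminus SU_{-1}(2))=\{a\in C(SU_{-1}(2)):(\chi\otimes\mathrm{id})\delta(a)=a\ \forall\chi\in D_n\}$. For $s\in I_m$ put $\eta^m_s=\sum_{t\in I_m}\binom{2m}{m-t}^{1/2}w(\pi_m)_{t,s}$. $C^*(\eta^m)$ is the unital $C^*$-subalgebra generated by $\{\eta^m_s\}_{s\in I_m}$ (equivalently the smallest unital $C^*$-subalgebra $B$ containing $\eta^m_{-m}$ with $\delta(B)\subset B\otimes C(SU_{-1}(2))$). Both algebras are acted on by $SU_{-1}(2)$ via the restriction of $\delta$. *)

(* Defs.v *)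
From HB Require Import structures.
From mathcomp Require Import all_boot all_order all_algebra.
From mathcomp Require Import complex.
From mathcomp Require Import all_classical all_reals all_analysis.
Set Implicit Arguments.
Unset Strict Implicit.
Unset Printing Implicit Defensive.
Import Order.TTheory GRing.Theory Num.Theory.
Import numFieldNormedType.Exports.
Local Open Scope classical_set_scope.
Local Open Scope ring_scope.
Local Open Scope complex_scope.

(* Unital C*-algebras; [algType] makes them nonzero (1 != 0).  The norm is part
   of the mixin because [normedModType] cannot be joined with [algType]: there is
   no common structure of rings and normed Z-modules below [numDomainType]. *)
HB.mixin Record isCStar (R : realType) A of GRing.Algebra R[i] A := {
  star : A -> A ;
  starD : forall a b : A, star (a + b) = star a + star b ;
  starZ : forall (c : R[i]) (a : A), star (c *: a) = Num.conj c *: star a ;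
  starM : forall a b : A, star (a * b) = star b * star a ;
  starK : forall a : A, star (star a) = a ;
  cnorm : A -> R ;
  cnorm_ge0 : forall a : A, 0 <= cnorm a ;
  cnorm_eq0 : forall a : A, cnorm a = 0 -> a = 0 ;
  cnormD : forall a b : A, cnorm (a + b) <= cnorm a + cnorm b ;
  cnormZ : forall (c : R[i]) (a : A), cnorm (c *: a) = Normc.normc c * cnorm a ;
  cnormM : forall a b : A, cnorm (a * b) <= cnorm a * cnorm b ;
  cnorm_starM : forall a : A, cnorm (star a * a) = cnorm a ^+ 2 ;
  cnorm_complete : forall s : nat -> A,
    (forall e : R, 0 < e -> exists N, forall i j, (N <= i)%N -> (N <= j)%N ->
       cnorm (s i - s j) < e) ->
    exists a : A, cnorm (s k - a) @[k --> \oo] --> (0 : R)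
}.

#[short(type="cstarType")]
HB.structure Definition CStar (R : realType) :=
  {A of GRing.Algebra R[i] A & isCStar R A}.

Section CStarAlgebras.
Context {R : realType}.
Implicit Types A B T : cstarType R.

Definition star_preserving A B (f : A -> B) : Prop :=
  forall a, f (star a) = star (f a).

Definition subspace A (V : set A) : Prop :=
  V 0 /\ forall (c : R[i]) a b, V a -> V b -> V (c *: a + b).

Definition cvg_cnorm A (s : nat -> A) (a : A) : Prop :=
  cnorm (s k - a) @[k --> \oo] --> (0 : R).

Definition norm_closed A (V : set A) : Prop :=
  forall (s : nat -> A) a, (forall k, V (s k)) -> cvg_cnorm s a -> V a.

Definition closed_span A (E : set A) : set A :=
  smallest (fun V => subspace V /\ norm_closed V) E.

Definition cstar_subalg A (B : set A) : Prop :=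
  [/\ subspace B, B 1, (forall a b, B a -> B b -> B (a * b)),
      (forall a, B a -> B (star a)) & norm_closed B].

Definition gen_cstar A (E : set A) : set A := smallest (@cstar_subalg A) E.

(* The values of [f] outside [B1] are irrelevant. *)
Definition star_iso_on A B (B1 : set A) (B2 : set B) (f : A -> B) : Prop :=
  [/\ set_bij B1 B2 f,
      (forall (c : R[i]) a b, B1 a -> B1 b -> f (c *: a + b) = c *: f a + f b),
      (forall a b, B1 a -> B1 b -> f (a * b) = f a * f b) &
      (forall a, B1 a -> f (star a) = star (f a))].

Definition lin_indep A k (b : 'I_k -> A) : Prop :=
  forall c : 'I_k -> R[i], \sum_i c i *: b i = 0 -> forall i, c i = 0.

(* [tens a b] is the elementary tensor: [tens] induces a unital
   *-homomorphism from the algebraic tensor product of A and B to T, and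
   [tens_inj] says that this homomorphism is injective.  So such a [tens] is
   the same as a C*-norm on the algebraic tensor product, the one pulled back
   from T. *)
Record cstar_tensor A B T (tens : A -> B -> T) : Prop := {
  tens_linl : forall (c : R[i]) a a' b,
    tens (c *: a + a') b = c *: tens a b + tens a' b ;
  tens_linr : forall (c : R[i]) a b b',
    tens a (c *: b + b') = c *: tens a b + tens a b' ;
  tens_mul : forall a a' b b', tens a b * tens a' b' = tens (a * a') (b * b') ;
  tens_one : tens 1 1 = 1 ;
  tens_star : forall a b, star (tens a b) = tens (star a) (star b) ;
  tens_inj : forall k (a : 'I_k -> A) (b : 'I_k -> B), lin_indep b ->
    \sum_i tens (a i) (b i) = 0 -> forall i, a i = 0
}.

(* T is the completion of the algebraic tensor product for the smallest
   C*-norm. *)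
Definition min_tensor A B T (tens : A -> B -> T) : Prop :=
  [/\ cstar_tensor tens,
      closed_span [set tens a b | a in setT & b in setT] = setT &
      forall (T' : cstarType R) (tens' : A -> B -> T'), cstar_tensor tens' ->
      forall k (a : 'I_k -> A) (b : 'I_k -> B),
        cnorm (\sum_i tens (a i) (b i)) <= cnorm (\sum_i tens' (a i) (b i))].

(* The closed subspace generated by the a (x) b with a in B1; for a
   C*-subalgebra B1 of A this is the minimal tensor product of B1 and B,
   as a subalgebra of that of A and B. *)
Definition tens_sub A B T (tens : A -> B -> T) (B1 : set A) : set T :=
  closed_span [set tens a b | a in B1 & b in setT].

Definition cont_linear_on A B (D : set A) (S : A -> B) : Prop :=
  (forall (c : R[i]) a b, D a -> D b -> S (c *: a + b) = c *: S a + S b) /\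
  (forall (s : nat -> A) a, (forall k, D (s k)) -> D a ->
     cvg_cnorm s a -> cvg_cnorm (S \o s) (S a)).

(* F = f (x) id, on the tensor product of B1 with B. *)
Definition is_tens_id A B T (tens : A -> B -> T) (B1 : set A) (f : A -> A)
    (F : T -> T) : Prop :=
  cont_linear_on (tens_sub tens B1) F /\
  forall a b, B1 a -> F (tens a b) = tens (f a) b.

Definition character A (chi : A -> R[i]) : Prop :=
  [/\ (forall (c : R[i]) a b, chi (c *: a + b) = c * chi a + chi b),
      (forall a b, chi (a * b) = chi a * chi b),
      chi 1 = 1 &
      forall a, chi (star a) = Num.conj (chi a)].

(* S = chi (x) id, the complex numbers tensor B being identified with B. *)
Definition is_slice A B T (tens : A -> B -> T) (chi : A -> R[i]) (S : T -> B) :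
    Prop :=
  cont_linear_on setT S /\ forall a b, S (tens a b) = chi a *: b.

End CStarAlgebras.

Section SUminus1.
Context {R : realType}.
Implicit Types A T : cstarType R.

Record su_rel A (x u v y : A) : Prop := {
  su_ux : u * x = - (x * u) ;
  su_vx : v * x = - (x * v) ;
  su_uy : u * y = - (y * u) ;
  su_vy : v * y = - (y * v) ;
  su_uv : u * v = v * u ;
  su_xy : x * y + u * v = 1 ;
  su_yx : y * x + u * v = 1 ;
  su_starx : star x = y ;
  su_staru : star u = v
}.

(* A is C(SU_{-1}(2)), with generators x, u, v, y. *)
Definition su_universal A (x u v y : A) : Prop :=
  su_rel x u v y /\
  forall (B : cstarType R) (x' u' v' y' : B), su_rel x' u' v' y' ->
  exists2 phi : {lrmorphism A -> B},
    star_preserving phi /\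
      [/\ phi x = x', phi u = u', phi v = v' & phi y = y'] &
    forall psi : {lrmorphism A -> B}, star_preserving psi ->
      [/\ psi x = x', psi u = u', psi v = v' & psi y = y'] -> psi =1 phi.

Definition su_coproduct A T (tens : A -> A -> T) (x u v y : A)
    (delta : {lrmorphism A -> T}) : Prop :=
  star_preserving delta /\
  [/\ delta x = tens x x + tens u v,
      delta u = tens x u + tens u y,
      delta v = tens v x + tens y v &
      delta y = tens v u + tens y y].

Definition mx22 (a b c d : R[i]) : 'M[R[i]]_2 :=
  \matrix_(i, j) if i == 0 then (if j == 0 then a else b)
                 else (if j == 0 then c else d).

Definition Dn (n : nat) : set 'M[R[i]]_2 :=
  [set M | exists2 z : R[i], z ^+ n = 1 &
     M = mx22 z 0 0 (Num.conj z) \/ M = mx22 0 (Num.conj z) z 0].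

Definition Dn_quotient A T (tens : A -> A -> T) (x u v y : A)
    (delta : A -> T) (n : nat) : set A :=
  [set a | forall chi : A -> R[i], character chi ->
     Dn n (mx22 (chi x) (chi u) (chi v) (chi y)) ->
     exists2 S : T -> A, is_slice tens chi S & S (delta a) = a].

(* In what follows N stands for 2m, and i : 'I_N.+1 stands for the index
   i - m of I_m; in particular ord0 stands for -m, and if i stands for t then
   m + t = i and m - t = N - i. *)
Definition sqrt_bin (N i : nat) : R[i] :=
  (Num.sqrt ('C(N, N - i)%:R : R))%:C.

Definition spin_rep A T (tens : A -> A -> T) (x v : A) (delta : A -> T)
    (N : nat) (w : 'M[A]_(N.+1)) : Prop :=
  (forall i : 'I_N.+1,
     w i ord0 = sqrt_bin N i *: (x ^+ (N - i) * v ^+ i)) /\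
  (forall i : 'I_N.+1,
     delta (w i ord0) = \sum_(j < N.+1) tens (w i j) (w j ord0)).

Definition eta_vec A (N : nat) (w : 'M[A]_(N.+1)) (j : 'I_N.+1) : A :=
  \sum_(i < N.+1) sqrt_bin N i *: w i j.

Definition coinvariant A T (tens : A -> A -> T) (delta : A -> T) (B : set A) :
    Prop :=
  forall b, B b -> tens_sub tens B (delta b).

Definition covariant_iso A T (tens : A -> A -> T) (delta : A -> T)
    (B1 B2 : set A) : Prop :=
  [/\ coinvariant tens delta B1, coinvariant tens delta B2 &
      exists2 theta : A -> A, star_iso_on B1 B2 theta &
      exists2 theta_id : T -> T, is_tens_id tens B1 theta theta_id &
        forall b, B1 b -> delta (theta b) = theta_id (delta b)].

End SUminus1.

(* Main.v *)
From Pilot Require Import Defs.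
From HB Require Import structures.
From mathcomp Require Import all_boot all_order all_algebra.
From mathcomp Require Import complex.
From mathcomp Require Import all_classical all_reals all_analysis.
From mathcomp Require Import ring lra zify.
From mathcomp Require Import cyclic separable cyclotomic.
Set Implicit Arguments.
Unset Strict Implicit.
Unset Printing Implicit Defensive.
Import Order.TTheory GRing.Theory Num.Theory.
Import numFieldNormedType.Exports.
Import Pilot.Defs.
Local Open Scope classical_set_scope.
Local Open Scope ring_scope.
Local Open Scope complex_scope.

(** The isomorphism is a matrix coefficient.  Let rho be the irreducible
    representation of A of dimension 2 of psi_mx, and Psi = (rho (x) id) delta,
    a homomorphism from A to the 2 x 2 matrices over A.  The invariants of D_n
    are the elements fixed by the flip s, which exchanges x with v and u with
    y, and by the rotations x |-> z x, u |-> z u for z ^+ n = 1.  On elements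
    fixed by s, Psi is diagonal, so that theta = Psi 0 0 is multiplicative
    there; theta is involutive because the tensor square of rho contains the
    counit.  As a (x) b |-> Psi a (x) b comes from another C*-tensor product,
    minimality bounds theta (x) id, and theta is covariant because Psi is.

    Finally theta (x ^+ n + v ^+ n) is a multiple of eta_(-m).  Applying delta
    to both and using that the x ^+ (n - j) * v ^+ j are linearly independent,
    one sees that theta maps x ^+ (n - j) * u ^+ j + v ^+ (n - j) * y ^+ j to a
    nonzero multiple of the j-th eta vector; these elements generate the
    invariants of D_n, since a product of two of them can be used to shorten
    words in the generators. *)

(** * Identities in noncommutative algebras *)

(** Two features of the statement shape the proof. Only the tensor square of A is at hand, so
    coassociativity cannot be written down: covariance is checked on generators and carried to
    polynomials by one finite list of elementary tensors that serves all covariant maps at once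
    ([coproduct_sum]). Averaging over D_n then carries it to a dense set of invariants. Moreover
    theta is not a homomorphism on A, so theta (x) id must be bounded directly: for b fixed by s,
    psi (theta b) is diagonal with entries b and par b, where par changes the sign of the
    generators, and minimality is used both for a (x) b |-> psi a (x) b and for a (x) b |-> par a
    (x) b.

    Oddness of n enters through exponents: rho x and rho u square to 1/2 and exactly one of n - i
    and i is odd, so that the i-th binomial terms of psi (x ^+ n) and psi (v ^+ n) add up to a
    multiple of one fixed diagonal matrix. The bound n >= 3 enters when products of two elements of
    degree 1 in x, u and degree 1 in v, y are to be reached by words of length n - 1. *)

Section NoncommutativeNormalization.
Context {K : comNzRingType} {A : algType K}.

Inductive ncexpr :=
  | NCatom of nat
  | NC0
  | NC1
  | NCadd of ncexpr & ncexpr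
  | NCopp of ncexpr
  | NCmul of ncexpr & ncexpr
  | NCscale of K & ncexpr
  | NCmuln of ncexpr & nat
  | NCexp of ncexpr & nat.

Definition ncpoly := seq (seq nat * K).

Fixpoint nc_eval (env : seq A) (e : ncexpr) : A :=
  match e with
  | NCatom i => nth 0 env i
  | NC0 => 0
  | NC1 => 1
  | NCadd a b => nc_eval env a + nc_eval env b
  | NCopp a => - nc_eval env a
  | NCmul a b => nc_eval env a * nc_eval env b
  | NCscale c a => c *: nc_eval env a
  | NCmuln a k => nc_eval env a *+ k
  | NCexp a k => nc_eval env a ^+ k
  end.

Definition nc_monom (env : seq A) (w : seq nat) : A :=
  foldr (fun i a => nth 0 env i * a) 1 w.

Fixpoint nc_peval (env : seq A) (p : ncpoly) : A :=
  if p is (w, c) :: p' then c *: nc_monom env w + nc_peval env p' else 0.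

Fixpoint nc_scale (c : K) (w : seq nat) (p : ncpoly) : ncpoly :=
  if p is (w', c') :: p' then (w ++ w', c * c') :: nc_scale c w p' else [::].

Fixpoint nc_mul (p q : ncpoly) : ncpoly :=
  if p is (w, c) :: p' then nc_scale c w q ++ nc_mul p' q else [::].

Fixpoint nc_exp (p : ncpoly) k : ncpoly :=
  if k is k'.+1 then nc_mul p (nc_exp p k') else [:: ([::], 1)].

Fixpoint nc_norm (e : ncexpr) : ncpoly :=
  match e with
  | NCatom i => [:: ([:: i], 1)]
  | NC0 => [::]
  | NC1 => [:: ([::], 1)]
  | NCadd a b => nc_norm a ++ nc_norm b
  | NCopp a => nc_scale (-1) [::] (nc_norm a)
  | NCmul a b => nc_mul (nc_norm a) (nc_norm b)
  | NCscale c a => nc_scale c [::] (nc_norm a)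
  | NCmuln a k => nc_scale k%:R [::] (nc_norm a)
  | NCexp a k => nc_exp (nc_norm a) k
  end.

Lemma nc_monom_cat env w w' :
  nc_monom env (w ++ w') = nc_monom env w * nc_monom env w'.
Proof. by elim: w => [|i w IH] /=; rewrite ?mul1r // IH mulrA. Qed.

Lemma nc_peval_cat env p q :
  nc_peval env (p ++ q) = nc_peval env p + nc_peval env q.
Proof. by elim: p => [|[w c] p IH] /=; rewrite ?add0r // IH addrA. Qed.

Lemma nc_peval_scale env c w p :
  nc_peval env (nc_scale c w p) = c *: (nc_monom env w * nc_peval env p).
Proof.
elim: p => [|[w' c'] p IH] /=; first by rewrite mulr0 scaler0.
by rewrite IH nc_monom_cat mulrDr scalerDr -scalerAr scalerA.
Qed.

Lemma nc_peval_mul env p q :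
  nc_peval env (nc_mul p q) = nc_peval env p * nc_peval env q.
Proof.
elim: p => [|[w c] p IH] /=; first by rewrite mul0r.
by rewrite nc_peval_cat IH nc_peval_scale mulrDl scalerAl.
Qed.

Lemma nc_normP env e : nc_eval env e = nc_peval env (nc_norm e).
Proof.
elim: e => [i|||a IHa b IHb|a IHa|a IHa b IHb|c a IHa|a IHa k|a IHa k] /=.
- by rewrite addr0 mulr1 scale1r.
- by [].
- by rewrite addr0 scale1r.
- by rewrite nc_peval_cat IHa IHb.
- by rewrite nc_peval_scale IHa mul1r scaleN1r.
- by rewrite nc_peval_mul IHa IHb.
- by rewrite nc_peval_scale IHa mul1r.
- by rewrite nc_peval_scale IHa mul1r scaler_nat.
- rewrite IHa; elim: k => [|k IH] /=; first by rewrite addr0 scale1r.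
  by rewrite exprS nc_peval_mul IH.
Qed.

(** Written with plain matches and [Nat.eqb], so that the restricted [cbn] call of [ncring_over]
    evaluates it without unfolding any equality structure. *)
Fixpoint nat_seq_eqb (s t : seq nat) : bool :=
  match s, t with
  | [::], [::] => true
  | i :: s', j :: t' => if Nat.eqb i j then nat_seq_eqb s' t' else false
  | _, _ => false
  end.

Lemma nat_seq_eqbP s t : nat_seq_eqb s t -> s = t.
Proof.
elim: s t => [|i s IH] [|j t] //=.
by case: (PeanoNat.Nat.eqb_spec i j) => // -> /IH->.
Qed.

Fixpoint nc_insert (w : seq nat) (c : K) (p : ncpoly) : ncpoly :=
  if p is (w', c') :: p' then
    if nat_seq_eqb w w' then (w', c + c') :: p' else (w', c') :: nc_insert w c p'
  else [:: (w, c)].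

Fixpoint nc_collect (p : ncpoly) : ncpoly :=
  if p is (w, c) :: p' then nc_insert w c (nc_collect p') else [::].

Lemma nc_collectP env p : nc_peval env (nc_collect p) = nc_peval env p.
Proof.
elim: p => [|[w c] p IH] //=; rewrite -IH; elim: {IH p}(nc_collect p) => //=.
move=> [w' c'] p IH; case: ifP => [/nat_seq_eqbP <-|_] /=.
  by rewrite scalerDl addrA.
by rewrite IH addrCA.
Qed.

Fixpoint nc_all0 (p : ncpoly) : Prop :=
  if p is (w, c) :: p' then c = 0 /\ nc_all0 p' else True.

Lemma ncring_correct env e e' :
  nc_all0 (nc_collect (nc_norm (NCadd e (NCopp e')))) ->
  nc_eval env e = nc_eval env e'.
Proof.
move=> h; apply/eqP; rewrite -subr_eq0; apply/eqP.
rewrite -[LHS]/(nc_eval env (NCadd e (NCopp e'))) nc_normP -nc_collectP.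
by elim: (nc_collect _) h => [|[w c] p IH] //= [-> /IH->]; rewrite scale0r addr0.
Qed.

End NoncommutativeNormalization.

Ltac nc_index a env :=
  lazymatch env with
  | a :: _ => constr:(O)
  | _ :: ?env' => let i := nc_index a env' in constr:(S i)
  end.

Ltac nc_mem a env :=
  lazymatch env with
  | [::] => constr:(false)
  | a :: _ => constr:(true)
  | _ :: ?env' => nc_mem a env'
  end.

Ltac nc_atoms env e :=
  lazymatch e with
  | (?a + ?b)%R => let env := nc_atoms env a in nc_atoms env b
  | (- ?a)%R => nc_atoms env a
  | (?a * ?b)%R => let env := nc_atoms env a in nc_atoms env b
  | (?c *: ?a)%R => nc_atoms env a
  | (?a ^+ ?k)%R => nc_atoms env a
  | (?a *+ ?k)%R => nc_atoms env a
  | 0%R => env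
  | 1%R => env
  | ?a => let b := nc_mem a env in
          lazymatch b with true => env | false => constr:(a :: env) end
  end.

Ltac nc_reify K env e :=
  lazymatch e with
  | (?a + ?b)%R => let a := nc_reify K env a in let b := nc_reify K env b in
                   constr:(@NCadd K a b)
  | (- ?a)%R => let a := nc_reify K env a in constr:(@NCopp K a)
  | (?a * ?b)%R => let a := nc_reify K env a in let b := nc_reify K env b in
                   constr:(@NCmul K a b)
  | (?c *: ?a)%R => let a := nc_reify K env a in constr:(@NCscale K c a)
  | (?a ^+ ?k)%R => let a := nc_reify K env a in constr:(@NCexp K a k)
  | (?a *+ ?k)%R => let a := nc_reify K env a in constr:(@NCmuln K a k)
  | 0%R => constr:(@NC0 K)
  | 1%R => constr:(@NC1 K)
  | ?a => let i := nc_index a env in constr:(@NCatom K i)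
  end.

(* Decides identities between noncommutative polynomials up to identities
   between their scalar coefficients, which are left to [ring] and [field]. *)
Ltac ncring_over K :=
  match goal with |- @eq ?T ?a ?b =>
    let env := nc_atoms (@nil T) a in let env := nc_atoms env b in
    let ea := nc_reify K env a in let eb := nc_reify K env b in
    apply: (@ncring_correct K _ env ea eb);
    cbn [nc_all0 nc_collect nc_insert nc_norm nc_exp nc_mul nc_scale
         nat_seq_eqb cat Nat.eqb];
    repeat split; try first [by ring | by field]
  end.
Ltac ncring :=
  match goal with R : realType |- _ => ncring_over (R[i]) end.
(** * C*-algebras *)

Section ComplexScalars.
Context {R : realType}.
Implicit Types (r : R) (c z : R[i]).

Lemma normc_real r : Normc.normc r%:C = `|r|.
Proof. by rewrite /= expr0n addr0 sqrtr_sqr. Qed.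

Lemma conjC_real r : Num.conj r%:C = r%:C :> R[i].
Proof. by apply: conj_Creal; apply/complex_realP; exists r. Qed.

Lemma normc_conj c : Normc.normc (Num.conj c) = Normc.normc c.
Proof. by case: c => a b /=; rewrite sqrrN. Qed.

(* An opaque imaginary unit: [ring] would otherwise compute with 0 +i* 1. *)
Fact imag_subproof : {j : R[i] | j ^+ 2 = - 1 /\ Num.conj j = - j}.
Proof.
exists (Complex 0 1); split; first exact: sqr_i.
by apply/eqP; rewrite eq_complex /= oppr0 !eqxx.
Qed.

Definition imag : R[i] := sval imag_subproof.

Lemma imag_sqr : imag ^+ 2 = - 1. Proof. by case: (svalP imag_subproof). Qed.

Lemma conj_imag : Num.conj imag = - imag.
Proof. by case: (svalP imag_subproof). Qed.

Lemma normc_ge0 c : 0 <= Normc.normc c.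
Proof. by case: c => a b /=; rewrite sqrtr_ge0. Qed.

End ComplexScalars.

Section CStarBasics.
Context {R : realType}.
Implicit Types A B : cstarType R.

Lemma star0 A : star (0 : A) = 0.
Proof. by rewrite -(scale0r (0 : A)) starZ rmorph0 !scale0r. Qed.

Lemma starN A (a : A) : star (- a) = - star a.
Proof. by rewrite -scaleN1r starZ rmorphN1 scaleN1r. Qed.

Lemma starB A (a b : A) : star (a - b) = star a - star b.
Proof. by rewrite starD starN. Qed.

Lemma star1 A : star (1 : A) = 1.
Proof. by rewrite -[LHS]mulr1 -{2}(starK (1 : A)) -starM mulr1 starK. Qed.

Lemma star_sum A (I : Type) (r : seq I) (P : pred I) (F : I -> A) :
  star (\sum_(i <- r | P i) F i) = \sum_(i <- r | P i) star (F i).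
Proof. exact: (big_morph _ (@starD R A) (star0 A)). Qed.

Lemma starX A (a : A) k : star (a ^+ k) = star a ^+ k.
Proof. by elim: k => [|k IH]; rewrite ?star1 // exprS exprSr starM IH. Qed.

Lemma cnorm0 A : cnorm (0 : A) = 0.
Proof. by rewrite -(scale0r (0 : A)) cnormZ Normc.normc0 mul0r. Qed.

Lemma cnormN A (a : A) : cnorm (- a) = cnorm a.
Proof. by rewrite -scaleN1r cnormZ normcN Normc.normc1 mul1r. Qed.

Lemma cnormBC A (a b : A) : cnorm (a - b) = cnorm (b - a).
Proof. by rewrite -cnormN opprB. Qed.

Lemma cnormB A (a b : A) : cnorm (a - b) <= cnorm a + cnorm b.
Proof. by rewrite -(cnormN b) cnormD. Qed.

Lemma cnorm_triangle A (a b c : A) :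
  cnorm (a - c) <= cnorm (a - b) + cnorm (b - c).
Proof. by rewrite -[a - c](subrKA b) cnormD. Qed.

Lemma cnorm_sum A (I : Type) (r : seq I) (P : pred I) (F : I -> A) :
  cnorm (\sum_(i <- r | P i) F i) <= \sum_(i <- r | P i) cnorm (F i).
Proof.
elim/big_rec2: _ => [|i a b _ le_ab]; first by rewrite cnorm0.
by rewrite (le_trans (cnormD _ _)) // lerD2l.
Qed.

Lemma cnormZr A (r : R) (a : A) : cnorm (r%:C *: a) = `|r| * cnorm a.
Proof. by rewrite cnormZ normc_real. Qed.

Lemma cnorm_gt0 A (a : A) : (0 < cnorm a) = (a != 0).
Proof.
rewrite lt_def cnorm_ge0 andbT; congr negb.
by apply/eqP/eqP => [/cnorm_eq0|->] //; rewrite cnorm0.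
Qed.

(** Dividing the C*-identity |b|^2 = |b^* b| <= |b^*| |b| by |b| gives one inequality, and the
    involution gives the other. *)
Lemma cnorm_star A (a : A) : cnorm (star a) = cnorm a.
Proof.
have half (b : A) : cnorm b <= cnorm (star b).
  have [->|b0] := eqVneq b 0; first by rewrite star0.
  have := cnormM (star b) b; rewrite cnorm_starM expr2 ler_pM2r //.
  by rewrite cnorm_gt0.
by apply/eqP; rewrite eq_le half -{2}(starK a) half.
Qed.

Lemma cnorm_starMr A (a : A) : cnorm (a * star a) = cnorm a ^+ 2.
Proof. by rewrite -{1}(starK a) cnorm_starM cnorm_star. Qed.

Lemma cnorm1 A : cnorm (1 : A) = 1.
Proof.
have := cnorm_starM (1 : A); rewrite mulr1 star1 expr2 => h.
have n0 : cnorm (1 : A) != 0 by rewrite gt_eqF // cnorm_gt0 oner_neq0.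
by apply: (mulfI n0); rewrite -h mulr1.
Qed.

Lemma cnorm_sa_sqr A (a : A) : star a = a -> cnorm (a ^+ 2) = cnorm a ^+ 2.
Proof. by move=> sa; rewrite -cnorm_starM sa expr2. Qed.

Lemma cnorm_small A (a : A) : (forall e : R, 0 < e -> cnorm a <= e) -> a = 0.
Proof.
move=> h; apply: cnorm_eq0; apply/eqP; rewrite eq_le cnorm_ge0 andbT.
by apply/ler_addgt0Pr => e e0; rewrite add0r h.
Qed.

Lemma cvg_cnormP A (s : nat -> A) (a : A) : cvg_cnorm s a <->
  forall e : R, 0 < e -> exists N, forall k, (N <= k)%N -> cnorm (s k - a) < e.
Proof.
split=> [/cvgrPdist_lt h e e0|h].
  have [N _ hN] := h e e0; exists N => k Nk.
  by have := hN k Nk; rewrite /= sub0r normrN ger0_norm // cnorm_ge0.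
apply/cvgrPdist_lt => e e0; have [N hN] := h e e0.
by exists N => // k /hN; rewrite sub0r normrN ger0_norm // cnorm_ge0.
Qed.

Definition cauchy_cnorm A (s : nat -> A) := forall e : R, 0 < e ->
  exists N, forall i j, (N <= i)%N -> (N <= j)%N -> cnorm (s i - s j) < e.

Lemma cauchy_limit A (s : nat -> A) : cauchy_cnorm s ->
  exists a, forall e : R, 0 < e ->
    exists N, forall k, (N <= k)%N -> cnorm (s k - a) < e.
Proof. by move=> /cnorm_complete[a sa]; exists a; apply/cvg_cnormP. Qed.

(** Closure without sequences: closures of closures and images under Lipschitz maps then need no
    choice. [norm_closedP] links it to sequential closedness. *)
Definition adherent A (V : set A) (a : A) := forall e : R, 0 < e ->
  exists2 b, V b & cnorm (a - b) < e.

Lemma adherent_mem A (V : set A) a : V a -> adherent V a.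
Proof. by move=> Va e e0; exists a; rewrite // subrr cnorm0. Qed.

Lemma adherent_seq A (V : set A) a : adherent V a ->
  exists2 s : nat -> A, (forall k, V (s k)) &
    forall k, cnorm (a - s k) < k.+1%:R^-1.
Proof.
move=> h; have hk k : exists b, V b /\ cnorm (a - b) < k.+1%:R^-1.
  by have [|b] := h k.+1%:R^-1; [rewrite invr_gt0|exists b].
have [s hs] := choice hk.
by exists s => k; case: (hs k).
Qed.

Lemma inv_nat_small (e : R) : 0 < e ->
  exists N, forall k, (N <= k)%N -> k.+1%:R^-1 < e.
Proof.
move=> e0; have [N _ hN] := @near_infty_natSinv_lt R (PosNum e0).
by exists N => k /hN.
Qed.

Lemma norm_closedP A (V : set A) : norm_closed V <->
  forall a, adherent V a -> V a.
Proof.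
split=> [Vc a /adherent_seq[s Vs sa]|h s a Vs /cvg_cnormP sa].
  apply: (Vc s) => //; apply/cvg_cnormP => e /inv_nat_small[N hN].
  by exists N => k /hN; apply: lt_trans; rewrite cnormBC.
apply: h => e e0; have [N hN] := sa e e0; exists (s N) => //.
by rewrite cnormBC hN.
Qed.

Definition cnorm_lip A B (f : A -> B) := exists2 C : R, 0 < C &
  forall a b, cnorm (f a - f b) <= C * cnorm (a - b).

Lemma adherent_map A B (f : A -> B) (V : set A) (W : set B) a :
  cnorm_lip f -> (forall b, V b -> W (f b)) -> adherent V a ->
  adherent W (f a).
Proof.
move=> [C C0 fC] VW Va e e0.
have [|b Vb ab] := Va (C^-1 * e); first by rewrite mulr_gt0 ?invr_gt0.
exists (f b); first exact: VW.
by rewrite (le_lt_trans (fC _ _)) // -ltr_pdivlMl.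
Qed.

Lemma adherent_adherent A (V : set A) a : adherent (adherent V) a ->
  adherent V a.
Proof.
move=> h e e0; have e20 : 0 < e / 2 by rewrite divr_gt0.
have [b hb ab] := h _ e20; have [c Vc bc] := hb _ e20.
by exists c => //; rewrite (le_lt_trans (cnorm_triangle a b c)) // [e]splitr ltrD.
Qed.

Lemma adherentD A (V : set A) (c : R[i]) a b : subspace V ->
  adherent V a -> adherent V b -> adherent V (c *: a + b).
Proof.
move=> [_ VD] Va Vb e e0.
pose M := Normc.normc c + 1; have M0 : 0 < M by rewrite ltr_wpDl ?normc_ge0.
have e20 : 0 < e / 2 by rewrite divr_gt0.
have [|a' Va' aa'] := Va (M^-1 * (e / 2)); first by rewrite mulr_gt0 ?invr_gt0.
have [b' Vb' bb'] := Vb _ e20.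
exists (c *: a' + b'); first exact: VD.
rewrite opprD addrACA -scalerBr (le_lt_trans (cnormD _ _)) // [e]splitr ltr_leD //.
  rewrite cnormZ; apply: le_lt_trans (_ : M * cnorm (a - a') < _).
    by rewrite ler_wpM2r ?cnorm_ge0 // lerDl.
  by rewrite -ltr_pdivlMl.
exact: ltW.
Qed.

Lemma adherent_subspace A (V : set A) : subspace V -> subspace (adherent V).
Proof.
move=> Vs; split; first by apply: adherent_mem; case: Vs.
by move=> c a b; apply: adherentD.
Qed.

Lemma cnorm_lip_comp A B (D : cstarType R) (f : A -> B) (g : B -> D) :
  cnorm_lip f -> cnorm_lip g -> cnorm_lip (g \o f).
Proof.
move=> [C C0 hf] [D' D0 hg]; exists (D' * C); first by rewrite mulr_gt0.
by move=> a b; rewrite (le_trans (hg _ _)) // -mulrA ler_pM2l.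
Qed.

Lemma cnorm_lip_mul2 A (d e : A) : cnorm_lip (fun a : A => d * a * e).
Proof.
exists (cnorm d * cnorm e + 1).
  by rewrite ltr_wpDl // mulr_ge0 ?cnorm_ge0.
move=> a b; rewrite -mulrBl -mulrBr mulrDl mul1r.
rewrite (le_trans (cnormM _ _)) // mulrAC.
rewrite (le_trans (ler_wpM2r (cnorm_ge0 _) (cnormM _ _))) //.
by rewrite mulrAC lerDl cnorm_ge0.
Qed.

Lemma cnorm_lip_star A : cnorm_lip (@star R A).
Proof. by exists 1 => // a b; rewrite -starB cnorm_star mul1r. Qed.

Lemma adherent_eq A B (f g : A -> B) (V : set A) a :
  cnorm_lip f -> cnorm_lip g -> (forall b, V b -> f b = g b) ->
  adherent V a -> f a = g a.
Proof.
move=> [C C0 fC] [D D0 gD] fg Va; apply/eqP; rewrite -subr_eq0; apply/eqP.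
apply: cnorm_small => e e0.
have [|b Vb ab] := Va ((C + D)^-1 * e).
  by rewrite mulr_gt0 // invr_gt0 addr_gt0.
rewrite (le_trans (cnorm_triangle _ (f b) _)) // {2}(fg b Vb).
have -> : e = (C + D) * ((C + D)^-1 * e).
  by rewrite mulVKf // gt_eqF // addr_gt0.
rewrite mulrDl lerD //.
  by rewrite (le_trans (fC _ _)) // ler_pM2l // ltW.
by rewrite (le_trans (gD _ _)) // ler_pM2l // cnormBC ltW.
Qed.

End CStarBasics.

(** * Square roots by successive approximation *)

Section SquareRoot.
Context {R : realType} {A : cstarType R}.
Implicit Types (a b c p q z : A).

Variable b : A.

(* Fixed points of d |-> (b + d ^+ 2) / 2 satisfy (1 - d) ^+ 2 = 1 - b.  The
   iterates are polynomials in b with nonnegative coefficients, so for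
   cnorm b <= 1 they converge at least as fast as those for b = 1. *)
Fixpoint sqrt_iter k : A :=
  if k is k'.+1 then (2^-1)%:C *: (b + sqrt_iter k' ^+ 2) else 0.

Fixpoint sqrt_iter1 k : R :=
  if k is k'.+1 then 2^-1 * (1 + sqrt_iter1 k' ^+ 2) else 0.

Lemma sqrt_iter_comm z k : GRing.comm z b -> GRing.comm z (sqrt_iter k).
Proof.
move=> zb; elim: k => [|k IH] /=; first exact: commr0.
by rewrite /GRing.comm -scalerAr -scalerAl (commrD zb (commrX 2 IH)).
Qed.

Lemma sqrt_iter_sa k : star b = b -> star (sqrt_iter k) = sqrt_iter k.
Proof.
move=> sb; elim: k => [|k IH] /=; first exact: star0.
by rewrite starZ conjC_real starD starX IH sb.
Qed.

(** With e = 1 - [sqrt_iter1 k] the recursion becomes e' = e - e^2 / 2, so that e decays like 2 / k;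
    this rate yields the Cauchy property. *)
Lemma sqrt_iter1_bound k :
  0 <= sqrt_iter1 k <= 1 /\ 1 - sqrt_iter1 k <= 2 / k.+2%:R.
Proof.
elim: k => [|k [/andP[IH0 IH1] IH2]] /=; first by split; lra.
split; first by apply/andP; split; nra.
set s := sqrt_iter1 k in IH0 IH1 IH2 *.
have -> : k.+3%:R = k.+2%:R + 1 :> R by rewrite natr1.
have K2 : 2 <= k.+2%:R :> R by rewrite ler_nat.
set K : R := k.+2%:R in IH2 K2 *.
have {IH2} : (1 - s) * K <= 2 by rewrite -ler_pdivlMr //; lra.
rewrite ler_pdivlMr; last by lra.
set e := 1 - s => eK.
have -> : 1 - 2^-1 * (1 + s ^+ 2) = e - e ^+ 2 / 2 by rewrite /e; field.
have e0 : 0 <= e by rewrite /e; lra.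
have e1 : e <= 1 by rewrite /e; lra.
nra.
Qed.

Hypothesis b1 : cnorm b <= 1.

(** The iterates commute, so d^2 - d'^2 = (d - d') (d + d'), and both factors are dominated by the
    corresponding real numbers. *)
Lemma sqrt_iter_diff k j :
  cnorm (sqrt_iter (k + j) - sqrt_iter k) <= sqrt_iter1 (k + j) - sqrt_iter1 k.
Proof.
have nb i : cnorm (sqrt_iter i) <= sqrt_iter1 i.
  elim: i => [|i IH] /=; first by rewrite cnorm0.
  rewrite cnormZr gtr0_norm ?invr_gt0 // ler_pM2l ?invr_gt0 //.
  rewrite (le_trans (cnormD _ _)) // lerD // expr2 (le_trans (cnormM _ _)) //.
  by rewrite expr2 ler_pM ?cnorm_ge0.
elim: k j => [|k IH] j.
  by rewrite !add0n /= !subr0.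
rewrite addSn /= -scalerBr -mulrBr cnormZr gtr0_norm ?invr_gt0 //.
rewrite ler_pM2l ?invr_gt0 //.
set d := sqrt_iter (k + j) in IH *; set d' := sqrt_iter k in IH *.
have -> : b + d ^+ 2 - (b + d' ^+ 2) = (d - d') * (d + d').
  have dd' : d' * d = d * d'.
    apply: commr_sym; apply: sqrt_iter_comm; apply: commr_sym.
    exact: sqrt_iter_comm.
  by rewrite mulrDr !mulrBl dd'; ncring.
rewrite (le_trans (cnormM _ _)) //.
have -> : 1 + sqrt_iter1 (k + j) ^+ 2 - (1 + sqrt_iter1 k ^+ 2) =
  (sqrt_iter1 (k + j) - sqrt_iter1 k) * (sqrt_iter1 (k + j) + sqrt_iter1 k).
  by ring.
rewrite ler_pM ?cnorm_ge0 ?IH // (le_trans (cnormD _ _)) // lerD //; exact: nb.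
Qed.

(** The commutation clause stands in for functional calculus: the root commutes with whatever
    commutes with [b]. *)
Lemma sqrt_exists : star b = b -> exists d : A,
  [/\ star d = d, cnorm d <= 1, (1 - d) ^+ 2 = 1 - b &
      forall z, GRing.comm z b -> GRing.comm z d].
Proof.
move=> sb.
have small e : 0 < e -> exists N, forall j, (N <= j)%N -> 1 - sqrt_iter1 j < e.
  move=> e0; have [|N hN] := @inv_nat_small R (e / 2); first by rewrite divr_gt0.
  exists N => j Nj; have [_ /le_lt_trans->//] := sqrt_iter1_bound j.
  rewrite mulrC -ltr_pdivlMr //; apply: le_lt_trans (hN j Nj).
  by rewrite lef_pV2 ?posrE ?ltr0n // ler_nat.
have [|d hd] := @cauchy_limit R A sqrt_iter.
  move=> e /small[N hN]; exists N => i j.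
  wlog le_ij : i j / (i <= j)%N => [wl Ni Nj|Ni Nj].
    by case/orP: (leq_total i j) => ij; [|rewrite cnormBC]; apply: wl.
  rewrite cnormBC -(subnKC le_ij); apply: le_lt_trans (hN i Ni).
  rewrite (le_trans (sqrt_iter_diff _ _)) // lerD2r.
  by have [/andP[]] := sqrt_iter1_bound (i + (j - i)).
have ad : adherent (range sqrt_iter) d.
  move=> e /hd[N hN]; exists (sqrt_iter N); first by exists N.
  by rewrite cnormBC hN.
have nb i : cnorm (sqrt_iter i) <= 1.
  have := sqrt_iter_diff 0 i; rewrite /= !subr0 add0n => /le_trans->//.
  by have [/andP[]] := sqrt_iter1_bound i.
have d1 : cnorm d <= 1.
  apply/ler_addgt0Pr => e e0; have [_ [i _ <-] /ltW h] := ad e e0.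
  by rewrite -[d](subrK (sqrt_iter i)) addrC (le_trans (cnormD _ _)) // lerD.
exists d; split=> //.
- apply: (@adherent_eq R A A star id (range sqrt_iter)) => //; first exact: cnorm_lip_star.
    by exists 1 => // x y; rewrite mul1r.
  by move=> _ [k _ <-]; rewrite sqrt_iter_sa.
- have h : b + d ^+ 2 - 2 *: d = 0.
    apply: cnorm_small => e e0.
    have [|N hN] := hd (e / 4); first by rewrite divr_gt0.
    have h0 := hN N (leqnn _); have h1 := hN N.+1 (leqnSn _).
    (* The recursion says 2 [sqrt_iter N.+1] = b + [sqrt_iter N]^2, so the defect is a sum of three
       small terms. *)
    have -> : b + d ^+ 2 - 2 *: d = d * (d - sqrt_iter N)
       + (d - sqrt_iter N) * sqrt_iter N + 2 *: (sqrt_iter N.+1 - d).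
      rewrite /= rmorphV ?unitfE // rmorph_nat; ncring.
    apply: le_trans (_ : e / 4 + e / 4 + 2 * (e / 4) <= _); last by lra.
    rewrite (le_trans (cnormD _ _)) // lerD //.
      rewrite (le_trans (cnormD _ _)) // lerD // (le_trans (cnormM _ _)) //.
        rewrite -[leRHS]mul1r ler_pM ?cnorm_ge0 // cnormBC; exact: ltW.
      rewrite -[leRHS]mulr1 ler_pM ?cnorm_ge0 // cnormBC; exact: ltW.
    have -> : 2 = (2 : R)%:C :> R[i] by rewrite rmorph_nat.
    by rewrite cnormZr ger0_norm // ler_pM2l // ltW.
  by apply/eqP; rewrite -subr_eq0 -h; apply/eqP; ncring.
- move=> z zb.
  apply: (@adherent_eq R A A (fun d => z * d) (fun d => d * z) (range sqrt_iter)) => //.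
  + exists (cnorm z + 1); first by rewrite ltr_wpDl ?cnorm_ge0.
    move=> x y; rewrite -mulrBr (le_trans (cnormM _ _)) //.
    by rewrite ler_wpM2r ?cnorm_ge0 // lerDl.
  + exists (cnorm z + 1); first by rewrite ltr_wpDl ?cnorm_ge0.
    move=> x y; rewrite -mulrBl (le_trans (cnormM _ _)) // mulrC.
    by rewrite ler_wpM2r ?cnorm_ge0 // lerDl.
  + by move=> _ [k _ <-]; apply: sqrt_iter_comm.
Qed.

End SquareRoot.

(** * Positive elements *)

Section Positivity.
Context {R : realType} {A : cstarType R}.
Implicit Types (a b c d h p q z : A) (r t : R).

(** Positivity without spectra: a self-adjoint p has nonnegative spectrum as soon as |t - p| <= t
    for one t. In this form sums of positive elements are positive by the triangle inequality. *)
Definition cpos p := star p = p /\ exists2 t, 0 <= t & cnorm (t%:C%:A - p) <= t.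

Lemma star_real r : star (r%:C%:A : A) = r%:C%:A.
Proof. by rewrite starZ conjC_real star1. Qed.

Lemma cnorm_real r : 0 <= r -> cnorm (r%:C%:A : A) = r.
Proof. by move=> r0; rewrite cnormZr cnorm1 mulr1 ger0_norm. Qed.

Lemma commr_real z r : GRing.comm z r%:C%:A.
Proof. by rewrite /GRing.comm mulr_algr mulr_algl. Qed.

Lemma commrZ z (k : R[i]) a : GRing.comm z a -> GRing.comm z (k *: a).
Proof. by rewrite /GRing.comm -scalerAr -scalerAl => ->. Qed.

(** For commuting self-adjoint p and q the cross terms of (p + i q)^* (p + i q) cancel, and the
    C*-identity computes the norm. *)
Lemma cnorm_le1_unitary p q : star p = p -> star q = q -> GRing.comm p q ->
  forall t, 0 <= t -> p ^+ 2 + q ^+ 2 = t%:C%:A ->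
  cnorm (p + imag *: q) ^+ 2 = t.
Proof.
move=> sp sq pq t t0 h; rewrite -cnorm_starM -(cnorm_real t0) -h; congr cnorm.
rewrite starD starZ conj_imag sp sq.
have -> : (p + - imag *: q) * (p + imag *: q) =
  p ^+ 2 + (- (imag ^+ 2)) *: q ^+ 2 + imag *: (p * q - q * p).
  by ncring.
by rewrite pq subrr scaler0 addr0 imag_sqr opprK scale1r.
Qed.

Lemma cnorm_le1 p q : star p = p -> star q = q -> GRing.comm p q ->
  p ^+ 2 + q ^+ 2 = 1 -> cnorm p <= 1.
Proof.
move=> sp sq pq h.
have u1 : cnorm (p + imag *: q) = 1.
  have := @cnorm_le1_unitary _ _ sp sq pq 1 ler01.
  rewrite scale1r => /(_ h) /eqP; rewrite sqrf_eq1 => /orP[/eqP//|/eqP u].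
  by have := cnorm_ge0 (p + imag *: q); rewrite u oppr_ge0 ler10.
have -> : p = (2^-1)%:C *: ((p + imag *: q) + star (p + imag *: q)).
  rewrite starD starZ conj_imag sp sq rmorphV ?unitfE // rmorph_nat.
  by ncring.
rewrite cnormZr gtr0_norm ?invr_gt0 // ler_pdivrMl // mulr1.
by rewrite (le_trans (cnormD _ _)) // cnorm_star u1 -[2]/(1 + 1).
Qed.

Lemma cpos_sa p : cpos p -> star p = p. Proof. by case. Qed.

Lemma cposD p q : cpos p -> cpos q -> cpos (p + q).
Proof.
move=> [sp [t t0 tp]] [sq [r r0 rq]]; split; first by rewrite starD sp sq.
exists (t + r); first exact: addr_ge0.
by rewrite rmorphD scalerDl opprD addrACA (le_trans (cnormD _ _)) // lerD.
Qed.

Lemma cposZ p r : 0 <= r -> cpos p -> cpos (r%:C *: p).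
Proof.
move=> r0 [sp [t t0 tp]]; split; first by rewrite starZ conjC_real sp.
exists (r * t); first exact: mulr_ge0.
rewrite rmorphM -scalerA -scalerBr cnormZr ger0_norm // ler_wpM2l //.
Qed.

Lemma cpos0 : cpos 0.
Proof. by split; rewrite ?star0 //; exists 0; rewrite // scale0r subr0 cnorm0. Qed.

Lemma cpos_real r : 0 <= r -> cpos r%:C%:A.
Proof.
move=> r0; split; first exact: star_real.
by exists r; rewrite // subrr cnorm0.
Qed.

Lemma cpos_subr h r : star h = h -> cnorm h <= r -> cpos (r%:C%:A - h).
Proof.
move=> sh hr; split; first by rewrite starB star_real sh.
by exists r; [apply: le_trans hr; apply: cnorm_ge0|rewrite opprB addrC subrK].
Qed.

(** After scaling c to norm 1, 1 - c^2 has a self-adjoint square root commuting with c. This root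
    and c are the real and imaginary parts of a unitary, so the root has norm at most 1, and with it
    1 - c^2. *)
Lemma cpos_sqr c : star c = c -> cpos (c * c).
Proof.
move=> sc; split; first by rewrite starM sc.
have [->|c0] := eqVneq c 0.
  by exists 0; rewrite // mulr0 scale0r subrr cnorm0.
pose M := cnorm c; have M0 : 0 < M by rewrite cnorm_gt0.
exists (M ^+ 2); first exact: sqr_ge0.
pose c' := (M^-1)%:C *: c.
have sc' : star c' = c' by rewrite starZ conjC_real sc.
have c'1 : cnorm (c' ^+ 2) = 1.
  rewrite cnorm_sa_sqr // cnormZr ger0_norm ?invr_ge0 ?cnorm_ge0 //.
  by rewrite mulVf ?expr1n // gt_eqF.
have [| |d [sd _ d2 dc]] := @sqrt_exists R A (c' ^+ 2); rewrite ?c'1 //.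
  by rewrite starX sc'.
have -> : (M ^+ 2)%:C%:A - c * c = (M ^+ 2)%:C *: (1 - d) ^+ 2.
  rewrite d2 scalerBr [c' ^+ 2]expr2.
  rewrite /c' -scalerAr -scalerAl !scalerA -!rmorphM.
  have -> : M ^+ 2 / M / M = 1 by field; rewrite gt_eqF.
  by rewrite rmorph1 scale1r.
rewrite cnormZr ger0_norm ?sqr_ge0 // ler_piMr ?sqr_ge0 //.
have sd1 : star (1 - d) = 1 - d by rewrite starB star1 sd.
rewrite cnorm_sa_sqr // expr_le1 ?cnorm_ge0 //.
apply: (@cnorm_le1 _ c') => //; last by rewrite d2 subrK.
apply: commr_sym; apply: commrB; first exact: commr1.
by apply: dc; apply: commrX; apply: commr_refl.
Qed.

Lemma cpos_sqrt p : cpos p -> exists c : A,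
  [/\ cpos c, c * c = p & forall z, GRing.comm z p -> GRing.comm z c].
Proof.
move=> [sp [t t0 tp]].
(* The radius t may be 0; t + 1 is a radius by which one can divide. *)
pose r := t + 1; have r0 : 0 < r by rewrite ltr_wpDl.
have rp : cnorm (r%:C%:A - p) <= r.
  rewrite rmorphD scalerDl addrAC (le_trans (cnormD _ _)) // lerD //.
  by rewrite rmorph1 scale1r cnorm1.
pose b := (r^-1)%:C *: (r%:C%:A - p).
have b1 : cnorm b <= 1.
  by rewrite cnormZr ger0_norm ?invr_ge0 ?(ltW r0) // ler_pdivrMl // mulr1.
have sb : star b = b by rewrite starZ conjC_real starB star_real sp.
have b1E : 1 - b = (r^-1)%:C *: p.
  rewrite /b scalerBr scalerA -rmorphM mulVf ?gt_eqF // rmorph1 scale1r.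
  by rewrite opprB addrC subrK.
have [d [sd d1 d2 dc]] := sqrt_exists b1 sb.
pose u := Num.sqrt r; have u0 : 0 <= u := sqrtr_ge0 r.
have uu : u * u = r by rewrite -expr2 sqr_sqrtr // ltW.
exists (u%:C *: (1 - d)); split.
- apply: cposZ => //; split; first by rewrite starB star1 sd.
  by exists 1; rewrite // rmorph1 scale1r opprB addrC subrK.
- rewrite -scalerAl -scalerAr scalerA -[(1 - d) * _]expr2 d2 b1E scalerA -!rmorphM uu.
  by rewrite divff ?gt_eqF // rmorph1 scale1r.
- move=> z zp; apply: commrZ; apply: commrB; first exact: commr1.
  apply: dc; apply: commrZ; apply: commrB => //; exact: commr_real.
Qed.

Lemma cnorm_le_pos h r : star h = h -> 0 <= r ->
  cpos (r%:C%:A - h) -> cpos (r%:C%:A + h) -> cnorm h <= r.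
Proof.
move=> sh r0 /cpos_sqrt[c [cc c2 cC]] /cpos_sqrt[d [dd d2 dC]].
have ch : GRing.comm c h.
  have -> : h = r%:C%:A - c * c by rewrite c2 opprB addrC subrK.
  by apply: commrB; [exact: commr_real|apply: commrM].
have dc : GRing.comm d c.
  by apply: commr_sym; apply: dC; apply: commrD => //; exact: commr_real.
have := @cnorm_le1_unitary d c (cpos_sa dd) (cpos_sa cc) dc (r + r).
rewrite !expr2 c2 d2 addrACA addrN addr0 -scalerDl -rmorphD => /(_ (addr_ge0 r0 r0) erefl) hu.
set U := d + imag *: c in hu.
have -> : h = (4^-1)%:C *: (U * U + star U * star U).
  rewrite /U starD starZ conj_imag (cpos_sa dd) (cpos_sa cc).
  have -> : h = (2^-1)%:C *: (d * d - c * c).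
    by rewrite c2 d2 rmorphV ?unitfE // rmorph_nat; ncring.
  have -> : (d + imag *: c) * (d + imag *: c) + (d + - imag *: c) * (d + - imag *: c)
    = 2 *: (d * d + imag ^+ 2 *: (c * c)) by ncring.
  by rewrite imag_sqr !rmorphV ?unitfE // !rmorph_nat; ncring.
rewrite cnormZr gtr0_norm ?invr_gt0 // ler_pdivrMl //.
rewrite (le_trans (cnormD _ _)) //.
have -> : 4 * r = (r + r) + (r + r) by ring.
rewrite -hu.
by rewrite lerD // (le_trans (cnormM _ _)) // ?cnorm_star -expr2.
Qed.

Lemma cpos_mono p q : cpos p -> cpos (q - p) -> cnorm p <= cnorm q.
Proof.
move=> pp pq; have sq : star q = q.
  by rewrite -[q](subrK p) starD (cpos_sa pp) (cpos_sa pq).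
apply: cnorm_le_pos; rewrite ?cnorm_ge0 ?(cpos_sa pp) //; last first.
  by apply: cposD => //; apply: cpos_real; apply: cnorm_ge0.
rewrite -[X in cpos X](subrKA q); apply: cposD => //.
exact: cpos_subr.
Qed.

Lemma cpos_ball p t : cpos p -> cnorm p <= t -> cnorm (t%:C%:A - p) <= t.
Proof.
move=> pp pt; have t0 : 0 <= t := le_trans (cnorm_ge0 p) pt.
apply: cnorm_le_pos => //.
- by rewrite starB star_real (cpos_sa pp).
- by rewrite opprB addrC subrK.
- by apply: cposD; [exact: cpos_real|apply: cpos_subr => //; apply: cpos_sa].
Qed.

Lemma cposM p q : cpos p -> cpos q -> GRing.comm p q -> cpos (p * q).
Proof.
move=> /cpos_sqrt[c [cc c2 cC]] /cpos_sqrt[d [dd d2 dC]] pq.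
have cd : GRing.comm c d by apply: dC; apply: commr_sym; apply: cC; apply: commr_sym.
rewrite -c2 -d2.
have -> : c * c * (d * d) = (c * d) * (c * d).
  by rewrite -!mulrA; congr (_ * _); rewrite !mulrA cd.
by apply: cpos_sqr; rewrite starM (cpos_sa cc) (cpos_sa dd) cd.
Qed.

(** Bernoulli's inequality, the source of unbounded growth in [cpos_opp_star]. *)
Lemma cpos_exp_bound q k : cpos q ->
  cpos ((1 + q) ^+ k - k%:R *: q - 1).
Proof.
move=> qq; have pq k' : cpos (k'%:R *: q).
  by rewrite -(rmorph_nat (real_complex R)); apply: cposZ.
elim: k => [|k IH]; first by rewrite expr0 scale0r subr0 subrr; apply: cpos0.
have -> : (1 + q) ^+ k.+1 - k.+1%:R *: q - 1 =
   (1 + q) * ((1 + q) ^+ k - k%:R *: q - 1) + q * (k%:R *: q).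
  rewrite exprS -natr1; set w := (1 + q) ^+ k; ncring.
have c1 : GRing.comm q (1 + q) by apply: commrD; [exact: commr1|].
apply: cposD; apply: cposM => //.
- by apply: cposD => //; rewrite -(scale1r 1) -(rmorph1 (real_complex R)); apply: cpos_real.
- apply: commrB; last exact: commr1.
  apply: commrB; first exact: commrX.
  by apply: commrZ; apply: commr_sym.
- exact: commrZ.
Qed.

(** This replaces the comparison of the spectra of c c^* and c^* c. With s = - c^* c / t and y = 1 -
    c c^* / t one has c (1 + s)^k = y^k c and |y| <= 1, so s (1 + s)^k stays bounded, whereas it
    dominates k s^2. *)
Lemma cpos_opp_star c : cpos (c * star c) -> cpos (- (star c * c)) -> c = 0.
Proof.
set p := c * star c => pp qq.
pose t := cnorm p + 1; have t0 : 0 < t by rewrite ltr_wpDl ?cnorm_ge0.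
pose s : A := (t^-1)%:C *: - (star c * c).
have ss : cpos s by apply: cposZ; rewrite // invr_ge0 ltW.
pose y : A := 1 - (t^-1)%:C *: p.
have y1 : cnorm y <= 1.
  have -> : y = (t^-1)%:C *: (t%:C%:A - p).
    by rewrite scalerBr scalerA -rmorphM mulVf ?gt_eqF // rmorph1 scale1r.
  rewrite cnormZr ger0_norm ?invr_ge0 ?(ltW t0) // ler_pdivrMl // mulr1.
  by apply: cpos_ball => //; rewrite lerDl.
have cs k : c * (1 + s) ^+ k = y ^+ k * c.
  elim: k => [|k IH]; first by rewrite !expr0 mulr1 mul1r.
  rewrite exprS mulrA.
  have -> : c * (1 + s) = y * c by rewrite /s /y /p; ncring.
  by rewrite -mulrA IH mulrA exprS.
have bound k : cnorm (s * (1 + s) ^+ k) <= t^-1 * cnorm c ^+ 2.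
  have -> : s * (1 + s) ^+ k = (t^-1)%:C *: - (star c * (y ^+ k * c)).
    by rewrite -cs {1}/s -scalerAl mulNr mulrA.
  rewrite cnormZr cnormN ger0_norm ?invr_ge0 ?(ltW t0) //.
  rewrite ler_wpM2l ?invr_ge0 ?(ltW t0) // (le_trans (cnormM _ _)) // cnorm_star.
  rewrite expr2 ler_wpM2l ?cnorm_ge0 // (le_trans (cnormM _ _)) //.
  rewrite ler_piMl ?cnorm_ge0 //.
  elim: k => [|k IH]; first by rewrite expr0 cnorm1.
  by rewrite exprS (le_trans (cnormM _ _)) // mulr_ile1 ?cnorm_ge0.
have small k : k%:R * cnorm (s * s) <= t^-1 * cnorm c ^+ 2.
  apply: le_trans (bound k).
  have -> : k%:R * cnorm (s * s) = cnorm (k%:R%:C *: (s * s)).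
    by rewrite cnormZr ger0_norm.
  have c1 : GRing.comm s (1 + s) by apply: commrD; [exact: commr1|].
  apply: cpos_mono.
    by apply: cposZ => //; apply: cpos_sqr; apply: cpos_sa.
  rewrite rmorph_nat.
  have -> : s * (1 + s) ^+ k - k%:R *: (s * s) =
     s * ((1 + s) ^+ k - k%:R *: s - 1) + s.
    by set w := (1 + s) ^+ k; ncring.
  apply: cposD => //; apply: cposM => //; first exact: cpos_exp_bound.
  apply: commrB; last exact: commr1.
  by apply: commrB; [exact: commrX|exact: commrZ].
have s20 : cnorm (s * s) <= 0.
  rewrite leNgt; apply/negP => s0.
  have := archi_boundP (_ : 0 <= t^-1 * cnorm c ^+ 2 / cnorm (s * s)).
  rewrite ltNge => /(_ _)/negP h; apply: h; last first.
    by rewrite ler_pdivlMr // small.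
  by rewrite divr_ge0 ?(ltW s0) // mulr_ge0 ?sqr_ge0 // invr_ge0 ltW.
have s0 : s = 0.
  apply: cnorm_eq0; apply/eqP; rewrite -sqrf_eq0 -cnorm_sa_sqr ?(cpos_sa ss) //.
  by rewrite eq_le expr2 s20 cnorm_ge0.
apply: cnorm_eq0; apply/eqP; rewrite -sqrf_eq0 -cnorm_starM -[star c * c]opprK.
have -> : - (star c * c) = t%:C *: s.
  by rewrite scalerA -rmorphM divff ?gt_eqF // rmorph1 scale1r.
by rewrite s0 scaler0 oppr0 cnorm0.
Qed.

(* Kelley and Vaught: for b = star a * a with negative part n one has
   n b n = - n ^+ 3, so that c = a n satisfies star c * c <= 0. *)
Lemma cpos_starM a : cpos (star a * a).
Proof.
set b := star a * a.
have sb : star b = b by rewrite starM starK.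
have [k [kk k2 kC]] := cpos_sqrt (cpos_sqr sb).
have bk : GRing.comm b k by apply: kC; apply: commrM; apply: commr_refl.
(* [k] is the absolute value of [b], so this is the negative part. *)
pose n := (2^-1)%:C *: (k - b).
have sn : star n = n by rewrite starZ conjC_real starB sb (cpos_sa kk).
have kn : GRing.comm n k.
  apply/commr_sym/commrZ/commrB; first exact: commr_refl.
  exact: commr_sym.
have bn : b * n = - (n * n).
  have : b * n + n * n = (4^-1)%:C *: (k * k - b * b + (b * k - k * b)).
    by rewrite /n !rmorphV ?unitfE // !rmorph_nat; ncring.
  rewrite k2 bk !subrr addr0 scaler0 => /eqP; rewrite addr_eq0 => /eqP //.
have nk : n * n = k * n.
  apply/eqP; rewrite -subr_eq0; apply/eqP.
  have -> : n * n - k * n = (4^-1)%:C *: (b * b - k * k + (k * b - b * k)).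
    by rewrite /n !rmorphV ?unitfE // !rmorph_nat; ncring.
  by rewrite k2 bk !subrr addr0 scaler0.
have n3 : cpos (n * n * n).
  have [r [rr r2 rC]] := cpos_sqrt kk.
  have rn := rC n kn.
  rewrite nk -r2; have -> : r * r * n * n = (r * n) * (r * n).
    by rewrite -[in RHS]mulrA (mulrA n) rn !mulrA.
  by apply: cpos_sqr; rewrite starM sn (cpos_sa rr) rn.
pose c := a * n.
have cc : star c * c = - (n * n * n).
  rewrite starM sn -[LHS]mulrA [star a * _]mulrA -/b bn.
  by rewrite mulrN mulrA.
have c0 : c = 0.
  apply: cpos_opp_star; last by rewrite cc opprK.
  (* As p^2 + q^2 = 2 (c c^* + c^* c) and c^* c = - n^3, the element c c^* is a sum of positive
     elements. *)
  pose p := c + star c; pose q := imag *: (c - star c).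
  have sp : star p = p by rewrite starD starK addrC.
  have sq : star q = q by rewrite starZ conj_imag starB starK scaleNr -scalerN opprB.
  have -> : c * star c = (2^-1)%:C *: (p * p + q * q) + n * n * n.
    have -> : n * n * n = - (star c * c) by rewrite cc opprK.
    have -> : q * q = (imag ^+ 2) *: ((c - star c) * (c - star c)).
      by rewrite -scalerAl -scalerAr scalerA.
    by rewrite imag_sqr /p !rmorphV ?unitfE // !rmorph_nat; ncring.
  apply: cposD => //; apply: cposZ; first by rewrite invr_ge0.
  by apply: cposD; apply: cpos_sqr.
have n0 : n = 0.
  have h : n * n * n = 0 by apply: oppr_inj; rewrite -cc c0 mulr0 oppr0.
  have h2 : n * n = 0.
    apply: cnorm_eq0; apply/eqP; rewrite -sqrf_eq0 -cnorm_sa_sqr ?starM ?sn //.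
    by rewrite expr2 mulrA h mul0r cnorm0.
  apply: cnorm_eq0; apply/eqP; rewrite -sqrf_eq0 -cnorm_sa_sqr ?sn //.
  by rewrite expr2 h2 cnorm0.
suff -> : b = k by [].
apply/eqP; rewrite eq_sym -subr_eq0.
have -> : k - b = 2%:C *: n.
  by rewrite scalerA -rmorphM divff // rmorph1 scale1r.
by rewrite n0 scaler0.
Qed.

Lemma cpos_Mstar a : cpos (a * star a).
Proof. by rewrite -{1}(starK a); apply: cpos_starM. Qed.

Lemma cpos_conj p c : cpos p -> cpos (star c * p * c).
Proof.
move=> /cpos_sqrt[d [dd <- _]].
have -> : star c * (d * d) * c = star (d * c) * (d * c).
  by rewrite starM (cpos_sa dd) !mulrA.
exact: cpos_starM.
Qed.

End Positivity.

(** * Contractivity of star homomorphisms *)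

Section StarHomomorphisms.
Context {R : realType} {A B : cstarType R} (f : {lrmorphism A -> B}).
Hypothesis fs : star_preserving f.

(** A self-adjoint c of norm at most 1 satisfies c^2 + (1 - d)^2 = 1 for a self-adjoint 1 - d
    commuting with it; this relation passes to the images and bounds |f c| by 1. *)
Lemma star_hom_contractive a : cnorm (f a) <= cnorm a.
Proof.
have unit_ball c : star c = c -> cnorm c <= 1 -> cnorm (f c) <= 1.
  move=> sc c1.
  have [| |d [sd _ d2 dC]] := @sqrt_exists R A (c ^+ 2).
  - by rewrite cnorm_sa_sqr // expr_le1 ?cnorm_ge0.
  - by rewrite starX sc.
  apply: (@cnorm_le1 R B _ (f (1 - d))).
  - by rewrite -fs sc.
  - by rewrite -fs starB star1 sd.
  - rewrite /GRing.comm -!rmorphM; congr (f _).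
    apply: commrB; first exact: commr1.
    by apply: dC; apply: commrX; apply: commr_refl.
  - by rewrite -!rmorphXn -rmorphD d2 addrC subrK rmorph1.
have sa c : star c = c -> cnorm (f c) <= cnorm c.
  move=> sc; have [->|c0] := eqVneq c 0; first by rewrite raddf0 !cnorm0.
  have M0 : 0 < cnorm c by rewrite cnorm_gt0.
  have := unit_ball ((cnorm c)^-1%:C *: c).
  rewrite starZ conjC_real sc linearZ /= !cnormZr ger0_norm ?invr_ge0 ?cnorm_ge0 //.
  by rewrite mulVf ?gt_eqF // lexx ler_pdivrMl // mulr1; apply.
rewrite -(@ler_pXn2r _ 2) ?nnegrE ?cnorm_ge0 // -!cnorm_starM -fs -rmorphM.
by apply: sa; rewrite starM starK.
Qed.

Lemma star_hom_lip : cnorm_lip f.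
Proof.
by exists 1 => // a b; rewrite mul1r -raddfB star_hom_contractive.
Qed.

End StarHomomorphisms.

(** * Closed unital star subalgebras as C*-algebras in their own right *)

Section SubAlgebraType.
Context {R : realType} {A : cstarType R} (B : set A) (hB : cstar_subalg B).

(** Indexed by the proof of closedness, so that the algebra structures on [subcstar] can be inferred
    from its type. *)
Definition subcstar_pred of cstar_subalg B : {pred A} := fun a => a \in B.

Lemma subcstar_predP a : a \in subcstar_pred hB <-> B a.
Proof. by split => [/set_mem//|/mem_set]. Qed.

Lemma subcstar_closed : subalg_closed (subcstar_pred hB).
Proof.
have [[B0 BD] B1 BM _ _] := hB; split=> [|c a b|a b]; first exact/subcstar_predP.
- by move=> /subcstar_predP ha /subcstar_predP hb; apply/subcstar_predP/BD.
- by move=> /subcstar_predP ha /subcstar_predP hb; apply/subcstar_predP/BM.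
Qed.

HB.instance Definition _ :=
  GRing.isSubalgClosed.Build R[i] A (subcstar_pred hB) subcstar_closed.

Record subcstar := SubCstar { subcstar_val : A ; _ : subcstar_val \in subcstar_pred hB }.

HB.instance Definition _ := [isSub for subcstar_val].
HB.instance Definition _ := [Choice of subcstar by <:].
HB.instance Definition _ := [SubChoice_isSubAlgebra of subcstar by <:].

Lemma subcstar_star_subproof (s : subcstar) :
  star (subcstar_val s) \in subcstar_pred hB.
Proof.
have [_ _ _ Bs _] := hB.
by apply/subcstar_predP/Bs/subcstar_predP; apply: (valP s).
Qed.

Definition subcstar_star s := SubCstar (subcstar_star_subproof s).

Lemma subcstar_complete (s : nat -> subcstar) :
  (forall e : R, 0 < e -> exists N, forall i j, (N <= i)%N -> (N <= j)%N ->
     cnorm (val (s i - s j)) < e) ->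
  exists a : subcstar, cnorm (val (s k - a)) @[k --> \oo] --> (0 : R).
Proof.
have [_ _ _ _ Bc] := hB.
move=> /(@cnorm_complete R A (val \o s))[a sa].
have Ba : B a.
  by apply: Bc sa => k; apply/subcstar_predP; apply: (valP (s k)).
by exists (SubCstar (proj2 (subcstar_predP a) Ba)).
Qed.

Fact subcstar_starD s t :
  subcstar_star (s + t) = subcstar_star s + subcstar_star t.
Proof. exact/val_inj/starD. Qed.

Fact subcstar_starZ (c : R[i]) s :
  subcstar_star (c *: s) = Num.conj c *: subcstar_star s.
Proof. exact/val_inj/starZ. Qed.

Fact subcstar_starM s t :
  subcstar_star (s * t) = subcstar_star t * subcstar_star s.
Proof. exact/val_inj/starM. Qed.

Fact subcstar_starK s : subcstar_star (subcstar_star s) = s.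
Proof. exact/val_inj/starK. Qed.

Fact subcstar_norm_eq0 (s : subcstar) : cnorm (val s) = 0 -> s = 0.
Proof. by move=> /cnorm_eq0 h; apply: val_inj. Qed.

HB.instance Definition _ := @isCStar.Build R subcstar subcstar_star
  subcstar_starD subcstar_starZ subcstar_starM subcstar_starK
  (fun s => cnorm (val s)) (fun s => cnorm_ge0 (val s)) subcstar_norm_eq0
  (fun s t => cnormD (val s) (val t)) (fun c s => cnormZ c (val s))
  (fun s t => cnormM (val s) (val t)) (fun s => cnorm_starM (val s))
  subcstar_complete.

Definition subcstar_incl (s : subcstar) : A := val s.

Fact subcstar_incl_linear : linear subcstar_incl. Proof. by []. Qed.

Fact subcstar_incl_multiplicative : monoid_morphism subcstar_incl.
Proof. by []. Qed.

HB.instance Definition _ :=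
  GRing.isLinear.Build R[i] subcstar A *:%R subcstar_incl subcstar_incl_linear.
HB.instance Definition _ :=
  GRing.isMonoidMorphism.Build subcstar A subcstar_incl
    subcstar_incl_multiplicative.

End SubAlgebraType.

(** * The complex numbers as a C*-algebra, the target of characters *)

Section ComplexNumbers.
Context {R : realType}.
Local Notation C := (R[i]).

Lemma normc_starM (c : C) : Normc.normc (Num.conj c * c) = Normc.normc c ^+ 2.
Proof. by rewrite Normc.normcM normc_conj expr2. Qed.

Lemma normc_submul (c d : C) : Normc.normc (c * d) <= Normc.normc c * Normc.normc d.
Proof. by rewrite Normc.normcM. Qed.

Lemma normc_Re (c : C) : `|complex.Re c| <= Normc.normc c.
Proof.
case: c => a b /=; rewrite -sqrtr_sqr ler_wsqrtr // lerDl sqr_ge0 //.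
Qed.

Lemma normc_Im (c : C) : `|complex.Im c| <= Normc.normc c.
Proof.
case: c => a b /=; rewrite -sqrtr_sqr ler_wsqrtr // lerDr sqr_ge0 //.
Qed.

Lemma normc_le_ReIm (c : C) : Normc.normc c <= `|complex.Re c| + `|complex.Im c|.
Proof.
case: c => a b /=; rewrite -[leRHS]ger0_norm ?addr_ge0 //.
rewrite -sqrtr_sqr ler_wsqrtr // sqrrD !real_normK ?num_real //.
by rewrite addrAC lerDl mulrn_wge0 // mulr_ge0.
Qed.

Lemma normc_complete (s : nat -> C) :
  (forall e : R, 0 < e -> exists N, forall i j, (N <= i)%N -> (N <= j)%N ->
     Normc.normc (s i - s j) < e) ->
  exists a : C, Normc.normc (s k - a) @[k --> \oo] --> (0 : R).
Proof.
move=> h.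
have cvgF (F : C -> R) : (forall c, `|F c| <= Normc.normc c) ->
    (forall c d, F (c - d) = F c - F d) ->
    exists l : R, F (s k) - l @[k --> \oo] --> (0 : R).
  move=> Fle FB.
  have cF : cvgn (F \o s).
    apply: cauchy_cvg; apply: cauchy_exP => e e0.
    have [N hN] := h e e0; exists (F (s N)); exists N => // k /= Nk.
    rewrite /ball /= -FB; apply: le_lt_trans (Fle _) _; exact: hN.
  exists (lim (F (s k) @[k --> \oo])).
  by rewrite -(subrr (lim (F (s k) @[k --> \oo]))); apply: cvgB => //; apply: cvg_cst.
have [p hp] := cvgF (@complex.Re R) normc_Re (fun c d => raddfB (@complex.Re R) c d).
have [q hq] := cvgF (@complex.Im R) normc_Im (fun c d => raddfB (@complex.Im R) c d).
exists (Complex p q).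
apply: (@squeeze_cvgr _ _ _ _ (fun=> 0) (fun k => `|complex.Re (s k) - p| + `|complex.Im (s k) - q|)).
- apply: nearW => k; rewrite normc_ge0 /=; apply: le_trans (normc_le_ReIm _) _.
  by case: (s k) => a b.
- exact: cvg_cst.
- rewrite -[0 in X in _ --> X]addr0; apply: cvgD.
    by rewrite -[0 in X in _ --> X](@normr0 _ R); apply: cvg_norm.
  by rewrite -[0 in X in _ --> X](@normr0 _ R); apply: cvg_norm.
Qed.

HB.instance Definition _ := @isCStar.Build R (C^o) (@Num.conj C)
  (@rmorphD _ _ (@Num.conj C)) (@rmorphM _ _ (@Num.conj C))
  (fun a b => etrans (rmorphM _ a b) (mulrC _ _)) (@conjCK _)
  (@Normc.normc R) normc_ge0 (@Normc.eq0_normc R) (@le_normcD R)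
  (@Normc.normcM R) normc_submul
  normc_starM normc_complete.

End ComplexNumbers.

(** * Matrices over a C*-algebra *)

Section HilbertModule.
Context {R : realType} {A : cstarType R} {k : nat}.
Local Notation vec := 'cV[A]_k.+1.
Implicit Types (f g : vec) (a : A).

(** The A-valued inner product of the right Hilbert module of columns. Matrices act on it from the
    left by adjointable maps, and their operator norm will be the C*-norm. *)
Definition ip f g : A := \sum_i star (f i 0) * g i 0.

Lemma ipDl f f' g : ip (f + f') g = ip f g + ip f' g.
Proof.
by rewrite -big_split; apply: eq_bigr => i _ /=; rewrite mxE starD mulrDl.
Qed.

Lemma ipDr f g g' : ip f (g + g') = ip f g + ip f g'.
Proof. by rewrite -big_split; apply: eq_bigr => i _ /=; rewrite mxE mulrDr. Qed.

Lemma star_ip f g : star (ip f g) = ip g f.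
Proof. by rewrite star_sum; apply: eq_bigr => i _; rewrite starM starK. Qed.

Lemma ip_pos f : cpos (ip f f).
Proof.
by apply: big_ind => //; [exact: cpos0|exact: cposD|move=> i _; exact: cpos_starM].
Qed.

Lemma ip_mulr f g a : ip f (\col_i (g i 0 * a)) = ip f g * a.
Proof. by rewrite mulr_suml; apply: eq_bigr => i _; rewrite mxE mulrA. Qed.

Lemma ip_mull f g a : ip (\col_i (f i 0 * a)) g = star a * ip f g.
Proof. by rewrite -star_ip ip_mulr starM star_ip. Qed.

(** With a = [ip f g], expand the positive element [ip h h] for h = f a - t g and estimate a^* (ip f
    f) a by t a^* a. The bound holds for every t > 0 with t >= |ip f f|, which also covers the case
    where this norm is 0. *)
Lemma cauchy_schwarz f g : cnorm (ip f g) ^+ 2 <= cnorm (ip f f) * cnorm (ip g g).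
Proof.
set X := ip f f; set Y := ip g g; set a := ip f g.
have bound t : 0 < t -> cnorm X <= t -> cnorm a ^+ 2 <= t * cnorm Y.
  move=> t0 Xt.
  pose h : vec := \col_i (f i 0 * a) + \col_i (g i 0 * (- t)%:C%:A).
  have hE : ip h h = star a * X * a - (2 * t)%:C *: (star a * a) + (t * t)%:C *: Y.
    rewrite /h !ipDl !ipDr !ip_mull !ip_mulr -/a -/X -/Y -(star_ip f g) -/a star_real.
    rewrite !rmorphN !rmorphM rmorph_nat /=.
    by move: (star a) => b; ncring.
  have hp := ip_pos h.
  have Xp : cpos (star a * (t%:C%:A - X) * a).
    by apply: cpos_conj; apply: cpos_subr => //; apply: cpos_sa (ip_pos f).
  have := cposD hp Xp; rewrite hE.
  have -> : star a * X * a - (2 * t)%:C *: (star a * a) + (t * t)%:C *: Y +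
      star a * (t%:C%:A - X) * a = (t * t)%:C *: Y - t%:C *: (star a * a).
    by rewrite !rmorphM rmorph_nat /=; move: (star a) => b; ncring.
  move=> /(cpos_mono (cposZ (ltW t0) (cpos_starM a))).
  rewrite !cnormZr cnorm_starM normrM ger0_norm ?(ltW t0) // -mulrA.
  by rewrite ler_pM2l.
have [X0|X0] := ltP 0 (cnorm X); first exact: bound.
apply/ler_addgt0Pr => e e0.
have Y1 : 0 < cnorm Y + 1 by rewrite ltr_wpDl ?cnorm_ge0.
have t0 : 0 < e / (cnorm Y + 1) by rewrite divr_gt0.
apply: le_trans (bound _ t0 (le_trans X0 (ltW t0))) _.
apply: ler_wpDl; first by rewrite mulr_ge0 ?cnorm_ge0.
by rewrite -mulrA ler_piMr ?(ltW e0) // ler_pdivrMl // mulr1 lerDl.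
Qed.

Definition vnorm f : R := Num.sqrt (cnorm (ip f f)).

Lemma vnorm_ge0 f : 0 <= vnorm f. Proof. exact: sqrtr_ge0. Qed.

Lemma vnorm_sqr f : vnorm f ^+ 2 = cnorm (ip f f).
Proof. by rewrite sqr_sqrtr ?cnorm_ge0. Qed.

Lemma vnorm_le f (t : R) : 0 <= t -> (vnorm f <= t) = (cnorm (ip f f) <= t ^+ 2).
Proof. by move=> t0; rewrite -vnorm_sqr ler_pXn2r // nnegrE ?vnorm_ge0. Qed.

Lemma ip_le f g : cnorm (ip f g) <= vnorm f * vnorm g.
Proof.
rewrite -(@ler_pXn2r _ 2) ?nnegrE ?mulr_ge0 ?vnorm_ge0 ?cnorm_ge0 //.
by rewrite exprMn !vnorm_sqr cauchy_schwarz.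
Qed.

Lemma vnormD f g : vnorm (f + g) <= vnorm f + vnorm g.
Proof.
rewrite vnorm_le ?addr_ge0 ?vnorm_ge0 // ipDl !ipDr sqrrD mulr2n.
have h := ip_le f g; have h' := ip_le g f.
rewrite !vnorm_sqr.
have := cnormD (ip f f + ip f g) (ip g f + ip g g).
have := cnormD (ip f f) (ip f g); have := cnormD (ip g f) (ip g g).
by lra.
Qed.

Lemma vnormZ (c : R[i]) f :
  vnorm (map_mx ( *:%R c) f) = Normc.normc c * vnorm f.
Proof.
rewrite /vnorm; have -> : ip (map_mx ( *:%R c) f) (map_mx ( *:%R c) f) =
    (Num.conj c * c) *: ip f f.
  rewrite scaler_sumr; apply: eq_bigr => i _.
  by rewrite !mxE starZ -scalerAl -scalerAr scalerA.
by rewrite cnormZ normc_starM sqrtrM ?sqr_ge0 // sqrtr_sqr ger0_norm ?normc_ge0.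
Qed.

Lemma vnorm_entry f i : cnorm (f i 0) <= vnorm f.
Proof.
rewrite -(@ler_pXn2r _ 2) ?nnegrE ?vnorm_ge0 ?cnorm_ge0 // vnorm_sqr.
rewrite -cnorm_starM; apply: cpos_mono; first exact: cpos_starM.
rewrite /ip (bigD1 i) //= addrAC subrr add0r.
by apply: big_ind => //; [exact: cpos0|exact: cposD|move=> j _; exact: cpos_starM].
Qed.

Lemma vnorm_sum f : vnorm f <= \sum_i cnorm (f i 0).
Proof.
have s0 : 0 <= \sum_i cnorm (f i 0) by apply: sumr_ge0 => i _; apply: cnorm_ge0.
rewrite vnorm_le //; apply: le_trans (cnorm_sum _ _ _) _.
rewrite expr2 mulr_sumr; apply: ler_sum => i _.
apply: le_trans (cnormM _ _) _; rewrite cnorm_star ler_wpM2r ?cnorm_ge0 //.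
by rewrite (bigD1 i) //= lerDl sumr_ge0 // => j _; apply: cnorm_ge0.
Qed.

Lemma vnorm_delta i : vnorm (delta_mx i 0) = 1.
Proof.
rewrite /vnorm /ip (bigD1 i) //= big1 => [|j ji].
  by rewrite !mxE !eqxx star1 mulr1 addr0 cnorm1 sqrtr1.
by rewrite !mxE (negbTE ji) mulr0.
Qed.

End HilbertModule.

(** * The C*-algebra of square matrices *)

Section MatrixAlgebra.
Context {R : realType} (A : cstarType R) (k : nat).

(** A separate name, because the scalars are to be complex numbers, while matrices over [A] already
    carry a scaling by [A]. *)
Definition cmx := 'M[A]_k.+1.

HB.instance Definition _ := GRing.NzRing.on cmx.

Implicit Types (M N : cmx) (c : R[i]).
Definition cmx_scale c M : cmx := map_mx ( *:%R c) M.

Fact cmx_scaleA c d M : cmx_scale c (cmx_scale d M) = cmx_scale (c * d) M.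
Proof. by apply/matrixP => i j; rewrite !mxE scalerA. Qed.

Fact cmx_scale1 : left_id 1 cmx_scale.
Proof. by move=> M; apply/matrixP => i j; rewrite !mxE scale1r. Qed.

Fact cmx_scaleDr : right_distributive cmx_scale +%R.
Proof. by move=> c M N; apply/matrixP => i j; rewrite !mxE scalerDr. Qed.

Fact cmx_scaleDl M : {morph cmx_scale^~ M : a b / a + b}.
Proof. by move=> c d; apply/matrixP => i j; rewrite !mxE scalerDl. Qed.

HB.instance Definition _ := GRing.Zmodule_isLmodule.Build R[i] cmx
  cmx_scaleA cmx_scale1 cmx_scaleDr cmx_scaleDl.

Fact cmx_scaleAl c M N : c *: (M * N) = (c *: M) * N.
Proof.
apply/matrixP => i j; rewrite !mxE scaler_sumr; apply: eq_bigr => l _.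
by rewrite !mxE scalerAl.
Qed.

HB.instance Definition _ := GRing.Lmodule_isLalgebra.Build R[i] cmx cmx_scaleAl.

Fact cmx_scaleAr c M N : c *: (M * N) = M * (c *: N).
Proof.
apply/matrixP => i j; rewrite !mxE scaler_sumr; apply: eq_bigr => l _.
by rewrite !mxE scalerAr.
Qed.

HB.instance Definition _ := GRing.Lalgebra_isAlgebra.Build R[i] cmx cmx_scaleAr.

Lemma cmxD M N i j : (M + N) i j = M i j + N i j. Proof. exact: mxE. Qed.
Lemma cmxN M i j : (- M) i j = - M i j. Proof. exact: mxE. Qed.
Lemma cmxZ c M i j : (c *: M) i j = c *: M i j. Proof. exact: mxE. Qed.
Lemma cmxM M N i j : (M * N) i j = \sum_l M i l * N l j. Proof. exact: mxE. Qed.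
Lemma cmx1 i j : (1 : cmx) i j = (i == j)%:R. Proof. exact: mxE. Qed.

Definition cmx_star M : cmx := map_mx star (trmx M).

Fact cmx_starD M N : cmx_star (M + N) = cmx_star M + cmx_star N.
Proof. by apply/matrixP => i j; rewrite !mxE starD. Qed.

Fact cmx_starZ c M : cmx_star (c *: M) = Num.conj c *: cmx_star M.
Proof. by apply/matrixP => i j; rewrite !mxE starZ. Qed.

Fact cmx_starM M N : cmx_star (M * N) = cmx_star N * cmx_star M.
Proof.
apply/matrixP => i j; rewrite !mxE star_sum; apply: eq_bigr => l _.
by rewrite !mxE starM.
Qed.

Fact cmx_starK M : cmx_star (cmx_star M) = M.
Proof. by apply/matrixP => i j; rewrite !mxE starK. Qed.

Local Notation vec := 'cV[A]_k.+1.

Definition cmx_bounded M := [set C : R | 0 <= C /\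
  forall f : vec, vnorm (M *m f) <= C * vnorm f].

Definition cmx_norm M : R := inf (cmx_bounded M).

Lemma cmx_bounded_sum M : cmx_bounded M (\sum_i \sum_j cnorm (M i j)).
Proof.
split=> [|f]; first by do 2![apply: sumr_ge0 => ? _]; apply: cnorm_ge0.
apply: le_trans (vnorm_sum _) _; rewrite mulr_suml; apply: ler_sum => i _.
rewrite mxE mulr_suml; apply: le_trans (cnorm_sum _ _ _) _; apply: ler_sum => j _.
by apply: le_trans (cnormM _ _) _; rewrite ler_wpM2l ?cnorm_ge0 ?vnorm_entry.
Qed.

Lemma cmx_norm_le M C : cmx_bounded M C -> cmx_norm M <= C.
Proof. by move=> MC; apply: ge_inf => //; exists 0 => x []. Qed.

Lemma cmx_norm_ge0 M : 0 <= cmx_norm M.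
Proof.
apply: lb_le_inf; last by move=> x [].
by exists (\sum_i \sum_j cnorm (M i j)); apply: cmx_bounded_sum.
Qed.

Lemma cmx_normP M : cmx_bounded M (cmx_norm M).
Proof.
split=> [|f]; first exact: cmx_norm_ge0.
have [f0|f0] := ltP 0 (vnorm f).
  rewrite -ler_pdivrMr //; apply: lb_le_inf.
    by exists (\sum_i \sum_j cnorm (M i j)); apply: cmx_bounded_sum.
  by move=> C [_ hC]; rewrite ler_pdivrMr.
have -> : vnorm f = 0 by apply/eqP; rewrite eq_le f0 vnorm_ge0.
rewrite mulr0; have [_ /(_ f)] := cmx_bounded_sum M.
have -> : vnorm f = 0 by apply/eqP; rewrite eq_le f0 vnorm_ge0.
by rewrite mulr0.
Qed.

Lemma cmx_norm_entry M i j : cnorm (M i j) <= cmx_norm M.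
Proof.
have [_ /(_ (delta_mx j 0))] := cmx_normP M.
rewrite vnorm_delta mulr1; apply: le_trans.
apply: le_trans (vnorm_entry _ i); rewrite mxE (bigD1 j) //= big1 => [|l lj].
  by rewrite mxE !eqxx mulr1 addr0.
by rewrite mxE (negbTE lj) mulr0.
Qed.

Fact cmx_norm_eq0 M : cmx_norm M = 0 -> M = 0.
Proof.
move=> M0; apply/matrixP => i j; rewrite mxE; apply: cnorm_eq0; apply/eqP.
by rewrite eq_le cnorm_ge0 -M0 cmx_norm_entry.
Qed.

Fact cmx_normD M N : cmx_norm (M + N) <= cmx_norm M + cmx_norm N.
Proof.
apply: cmx_norm_le; split=> [|f]; first by rewrite addr_ge0 ?cmx_norm_ge0.
rewrite mulmxDl mulrDl (le_trans (vnormD _ _)) // lerD //.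
  by case: (cmx_normP M).
by case: (cmx_normP N).
Qed.

Fact cmx_normZ c M : cmx_norm (c *: M) = Normc.normc c * cmx_norm M.
Proof.
have half d N : cmx_norm (d *: N) <= Normc.normc d * cmx_norm N.
  apply: cmx_norm_le; split=> [|f].
    by rewrite mulr_ge0 ?normc_ge0 ?cmx_norm_ge0.
  have -> : (d *: N : cmx) *m f = map_mx ( *:%R d) (N *m f).
    apply/matrixP => i j; rewrite !mxE scaler_sumr; apply: eq_bigr => l _.
    by rewrite mxE scalerAl.
  rewrite vnormZ -mulrA ler_wpM2l ?normc_ge0 //.
  by case: (cmx_normP N).
apply/eqP; rewrite eq_le half /=.
have [->|c0] := eqVneq c 0; first by rewrite Normc.normc0 mul0r cmx_norm_ge0.
have nc0 : 0 < Normc.normc c.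
  rewrite lt_def normc_ge0 andbT; apply: contra c0 => /eqP/Normc.eq0_normc->.
  by [].
rewrite -ler_pdivlMl //; apply: le_trans (_ : cmx_norm (c^-1 *: (c *: M)) <= _).
  by rewrite scalerA mulVf // scale1r.
by rewrite -Normc.normcV; apply: half.
Qed.

Fact cmx_normM M N : cmx_norm (M * N) <= cmx_norm M * cmx_norm N.
Proof.
apply: cmx_norm_le; split=> [|f]; first by rewrite mulr_ge0 ?cmx_norm_ge0.
rewrite -[M * N]/(M *m N) -mulmxA; case: (cmx_normP M) => _ /(_ _)/le_trans->//.
by rewrite -mulrA ler_wpM2l ?cmx_norm_ge0 //; case: (cmx_normP N).
Qed.

Lemma ip_adjoint M (f g : vec) : ip (M *m f) g = ip f (cmx_star M *m g).
Proof.
rewrite /ip; under eq_bigr do rewrite mxE star_sum mulr_suml.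
rewrite exchange_big /=; apply: eq_bigr => j _; rewrite mxE mulr_sumr.
by apply: eq_bigr => i _; rewrite !mxE starM mulrA.
Qed.

(** Cauchy-Schwarz applied to <N f, N f> = <f, N^* N f> bounds |N|^2 by |N^* N|; this in turn shows
    |N| <= |N^*|, hence the other inequality. *)
Fact cmx_norm_starM M : cmx_norm (cmx_star M * M) = cmx_norm M ^+ 2.
Proof.
have half N : cmx_norm N ^+ 2 <= cmx_norm (cmx_star N * N).
  set C := cmx_norm (_ * _); have C0 : 0 <= C := cmx_norm_ge0 _.
  rewrite -(sqr_sqrtr C0) ler_pXn2r ?nnegrE ?cmx_norm_ge0 ?sqrtr_ge0 //.
  apply: cmx_norm_le; split=> [|f]; first exact: sqrtr_ge0.
  rewrite vnorm_le ?mulr_ge0 ?sqrtr_ge0 ?vnorm_ge0 // ip_adjoint.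
  apply: le_trans (ip_le _ _) _; rewrite exprMn sqr_sqrtr // expr2 mulrCA.
  rewrite ler_wpM2l ?vnorm_ge0 // mulmxA.
  by case: (cmx_normP (cmx_star N * N)).
have le_star N : cmx_norm N <= cmx_norm (cmx_star N).
  have [N0|N0] := ltP 0 (cmx_norm N); last by rewrite (le_trans N0) ?cmx_norm_ge0.
  by rewrite -(ler_pM2r N0) -expr2 (le_trans (half N)) // cmx_normM.
apply/eqP; rewrite eq_le half andbT (le_trans (cmx_normM _ _)) // expr2.
by rewrite ler_wpM2r ?cmx_norm_ge0 // -{2}(cmx_starK M).
Qed.

Fact cmx_complete (s : nat -> cmx) :
  (forall e : R, 0 < e -> exists n, forall i j, (n <= i)%N -> (n <= j)%N ->
     cmx_norm (s i - s j) < e) ->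
  exists a : cmx, cmx_norm (s l - a) @[l --> \oo] --> (0 : R).
Proof.
move=> h.
have entry (ij : 'I_k.+1 * 'I_k.+1) : exists b : A,
    cnorm (s l ij.1 ij.2 - b) @[l --> \oo] --> (0 : R).
  apply: (cnorm_complete (fun l => s l ij.1 ij.2)) => e /h[n hn]; exists n => p q np nq.
  apply: le_lt_trans (hn p q np nq).
  by have := cmx_norm_entry (s p - s q) ij.1 ij.2; rewrite !mxE.
have [b hb] := choice entry.
exists (\matrix_(i, j) b (i, j)).
apply: (@squeeze_cvgr _ _ _ _ (fun=> 0)
   (fun l => \sum_i \sum_j cnorm (s l i j - b (i, j)))).
- apply: nearW => l; rewrite cmx_norm_ge0 /=.
  apply: le_trans (cmx_norm_le (cmx_bounded_sum _)) _.
  by apply: ler_sum => i _; apply: ler_sum => j _; rewrite !mxE.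
- exact: cvg_cst.
- rewrite -[0 in X in _ --> X](_ : \sum_(i < k.+1) \sum_(j < k.+1) (0 : R) = 0).
    by apply: cvg_big => [|i _]; [exact: add_continuous|apply: cvg_big => [|j _]; [exact: add_continuous|apply: (hb (i, j))]].
  by rewrite big1 // => i _; rewrite big1.
Qed.

HB.instance Definition _ := @isCStar.Build R cmx cmx_star
  cmx_starD cmx_starZ cmx_starM cmx_starK cmx_norm cmx_norm_ge0 cmx_norm_eq0
  cmx_normD cmx_normZ cmx_normM cmx_norm_starM cmx_complete.

Lemma cmx_starE M i j : star M i j = star (M j i).
Proof. by rewrite !mxE. Qed.

Lemma cnorm_cmx_entry M i j : cnorm (M i j) <= cnorm M.
Proof. exact: cmx_norm_entry. Qed.

End MatrixAlgebra.

(** * C*-tensor products *)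

Section ContinuousExtension.
Context {R : realType} {A B : cstarType R} (G : A -> B -> Prop) (C : R).
Hypothesis GD : forall (c : R[i]) a b a' b',
  G a b -> G a' b' -> G (c *: a + a') (c *: b + b').
Hypotheses (C0 : 0 < C) (GC : forall a b, G a b -> cnorm b <= C * cnorm a).

(** A relation rather than a function is extended, since a tensor has many expressions as a sum. The
    bound [GC] makes the closed graph single-valued. *)
Definition graph_closure (a : A) (b : B) := forall e : R, 0 < e ->
  exists a' b', [/\ G a' b', cnorm (a - a') < e & cnorm (b - b') < e].

Lemma graph_closure_sub a b : G a b -> graph_closure a b.
Proof. by move=> ab e e0; exists a, b; rewrite !subrr !cnorm0. Qed.

Lemma graph_closureD (c : R[i]) a b a' b' : graph_closure a b ->
  graph_closure a' b' -> graph_closure (c *: a + a') (c *: b + b').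
Proof.
move=> h h' e e0.
pose M := Normc.normc c + 1; have M0 : 0 < M by rewrite ltr_wpDl ?normc_ge0.
have M1 : 0 < M + 1 by rewrite addr_gt0.
have d0 : 0 < e / (M + 1) by rewrite divr_gt0.
have [a1 [b1 [g1 na1 nb1]]] := h _ d0.
have [a2 [b2 [g2 na2 nb2]]] := h' _ d0.
have est (D : cstarType R) (x y z w : D) : cnorm (x - z) < e / (M + 1) ->
    cnorm (y - w) < e / (M + 1) -> cnorm (c *: x + y - (c *: z + w)) < e.
  move=> xz yw; rewrite opprD addrACA -scalerBr (le_lt_trans (cnormD _ _)) //.
  rewrite cnormZ; apply: lt_le_trans (_ : M * (e / (M + 1)) + e / (M + 1) <= _).
    apply: ler_ltD => //; apply: ler_pM; rewrite ?normc_ge0 ?cnorm_ge0 ?lerDl //.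
    exact: ltW.
  by rewrite -{2}[e / _]mul1r -mulrDl mulrCA divff ?mulr1 ?gt_eqF.
by exists (c *: a1 + a2), (c *: b1 + b2); split; [exact: GD|exact: est|exact: est].
Qed.

Lemma graph_closure_bound a b : graph_closure a b -> cnorm b <= C * cnorm a.
Proof.
move=> h; apply/ler_addgt0Pr => e e0.
have C1 : 0 < C + 1 by rewrite addr_gt0.
have d0 : 0 < e / (C + 1) by rewrite divr_gt0.
have [a' [b' [g na nb]]] := h _ d0.
rewrite -[b](subrK b') (le_trans (cnormD _ _)) //.
apply: le_trans (_ : e / (C + 1) + C * (cnorm a + e / (C + 1)) <= _).
  rewrite lerD // ?(ltW nb) // (le_trans (GC g)) // ler_pM2l //.
  rewrite -[a'](subrK a) addrC (le_trans (cnormD _ _)) // lerD2l cnormBC.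
  exact: ltW.
rewrite mulrDr addrCA lerD2l -{1}[e / _]mul1r -mulrDl mulrCA (addrC 1).
by rewrite divff ?mulr1 ?gt_eqF.
Qed.

Lemma graph_closure_inj a b b' :
  graph_closure a b -> graph_closure a b' -> b = b'.
Proof.
move=> h h'; apply/eqP; rewrite -subr_eq0; apply/eqP/cnorm_eq0/eqP.
rewrite eq_le cnorm_ge0 andbT.
have := graph_closure_bound (graph_closureD (-1) h' h).
by rewrite !scaleN1r addNr cnorm0 mulr0 addrC.
Qed.

Lemma graph_closure_ex a : adherent [set a | exists b, G a b] a ->
  exists b, graph_closure a b.
Proof.
move=> /adherent_seq[s sG sa].
have [z zG] := choice sG.
have [|b zb] := @cauchy_limit R B z.
  move=> e e0; have [|N hN] := @inv_nat_small R (e / (C * 2)).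
    by rewrite divr_gt0 // mulr_gt0.
  exists N => i j Ni Nj.
  have g : G (s i - s j) (z i - z j).
    by have := GD (-1) (zG j) (zG i); rewrite !scaleN1r ![- _ + _]addrC.
  apply: le_lt_trans (GC g) _.
  rewrite -ltr_pdivlMl //; apply: le_lt_trans (cnorm_triangle _ a _) _.
  have -> : C^-1 * e = e / (C * 2) + e / (C * 2).
    by rewrite invfM; field; rewrite gt_eqF.
  apply: ltrD; last by apply: lt_trans (sa j) (hN j Nj).
  by rewrite cnormBC; apply: lt_trans (sa i) (hN i Ni).
exists b => e e0; have [N1 h1] := inv_nat_small e0; have [N2 h2] := zb e e0.
exists (s (maxn N1 N2)), (z (maxn N1 N2)); split=> //.
  by apply: lt_trans (sa _) _; rewrite h1 ?leq_maxl.
by rewrite cnormBC h2 ?leq_maxr.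
Qed.

Lemma continuous_extension : exists F : A -> B,
  [/\ cont_linear_on (adherent [set a | exists b, G a b]) F,
      forall a b, G a b -> F a = b &
      forall a, adherent [set a | exists b, G a b] a -> graph_closure a (F a)].
Proof.
pose D := adherent [set a | exists b, G a b].
have /choice[F hF] (a : A) : exists b, D a -> graph_closure a b.
  have [/graph_closure_ex[b hb]|nD] := pselect (D a); first by exists b.
  by exists 0.
have FE a b : graph_closure a b -> F a = b.
  move=> ab; have Da : D a.
    by move=> e e0; have [a' [b' [g na _]]] := ab e e0; exists a' => //; exists b'.
  exact: (graph_closure_inj (hF a Da) ab).
exists F; split; last exact: hF.
- have Fl (c : R[i]) a b : D a -> D b -> F (c *: a + b) = c *: F a + F b.
    by move=> Da Db; apply: FE; apply: graph_closureD; apply: hF.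
  split=> // s a Ds Da /cvg_cnormP sa; apply/cvg_cnormP => e e0.
  have [|N hN] := sa (C^-1 * e); first by rewrite mulr_gt0 ?invr_gt0.
  exists N => k Nk; apply: le_lt_trans (_ : C * cnorm (s k - a) < _).
    apply: graph_closure_bound.
    have := graph_closureD (-1) (hF a Da) (hF _ (Ds k)).
    by rewrite !scaleN1r ![- _ + _]addrC.
  by rewrite -ltr_pdivlMl // hN.
- by move=> a b /graph_closure_sub; apply: FE.
Qed.

End ContinuousExtension.

(** * Linear spans and their closures *)

Section Spans.
Context {R : realType} {A : cstarType R}.
Implicit Types (E V : set A) (a b : A).

Definition lspan (E : set A) : set A := smallest (@Defs.subspace R A) E.

Lemma lspan_subspace E : Defs.subspace (lspan E).
Proof.
split=> [V [[V0 _] _]//|c a b ha hb V [[V0 VD] EV]].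
exact: (VD _ _ _ (ha V (conj (conj V0 VD) EV)) (hb V (conj (conj V0 VD) EV))).
Qed.

Lemma sub_lspan E : E `<=` lspan E. Proof. exact: sub_smallest. Qed.

Lemma lspan_sub E (V : set A) : Defs.subspace V -> E `<=` V -> lspan E `<=` V.
Proof. by move=> Vs EV; apply: smallest_sub. Qed.

Lemma closed_spanE E : closed_span E = adherent (lspan E).
Proof.
apply/seteqP; split.
  apply: smallest_sub.
    split; first exact/adherent_subspace/lspan_subspace.
    by apply/norm_closedP => a; apply: adherent_adherent.
  by move=> a Ea; apply: adherent_mem; apply: sub_lspan.
move=> a ha V [[Vs Vc] EV].
have Vc' := (norm_closedP V).1 Vc; apply: Vc' => e /ha[b hb ab].
by exists b => //; apply: lspan_sub hb.
Qed.

Lemma closed_span_closed E : norm_closed (closed_span E).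
Proof.
by rewrite closed_spanE; apply/norm_closedP => a; apply: adherent_adherent.
Qed.

Lemma subspace_sum (V : set A) (I : eqType) (r : seq I) (F : I -> A) :
  Defs.subspace V -> (forall i, i \in r -> V (F i)) -> V (\sum_(i <- r) F i).
Proof.
move=> [V0 VD]; elim: r => [|i r IH] VF; first by rewrite big_nil.
rewrite big_cons -[F i]scale1r; apply: VD; first by apply: VF; rewrite mem_head.
by apply: IH => j jr; apply: VF; rewrite inE jr orbT.
Qed.

Lemma subspaceZ (V : set A) (c : R[i]) a : Defs.subspace V -> V a -> V (c *: a).
Proof. by move=> [V0 VD] Va; rewrite -[_ *: _]addr0; apply: VD. Qed.

Lemma subspaceD (V : set A) a b : Defs.subspace V -> V a -> V b -> V (a + b).
Proof. by move=> [V0 VD] Va Vb; rewrite -[a]scale1r; apply: VD. Qed.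

End Spans.

(** [f] is (|h| + h) / 2, with |h| the square root of h^2. Positivity is stated for f^3 = |h| f^2,
    which is visibly a square once |h| is written as one. *)
Lemma positive_part (R : realType) (A : cstarType R) (h : A) : star h = h ->
  exists f : A, [/\ star f = f, h * f = f ^+ 2, cpos (f ^+ 3) &
    f = 0 -> cpos (- h)].
Proof.
move=> sh; have [k [kk k2 kC]] := cpos_sqrt (cpos_sqr sh).
have hk : GRing.comm h k by apply: kC; apply: commrM; apply: commr_refl.
pose f := (2^-1)%:C *: (k + h).
have sf : star f = f by rewrite starZ conjC_real starD sh (cpos_sa kk).
have fk : GRing.comm f k.
  by apply/commr_sym/commrZ/commrD; [apply: commr_refl|apply: commr_sym].
have hf : h * f = f ^+ 2.
  apply/eqP; rewrite -subr_eq0; apply/eqP.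
  have -> : h * f - f ^+ 2 = (4^-1)%:C *: (h * h - k * k + (h * k - k * h)).
    by rewrite /f !rmorphV ?unitfE // !rmorph_nat; ncring.
  by rewrite k2 hk !subrr addr0 scaler0.
have kf : k * f = f ^+ 2.
  apply/eqP; rewrite -subr_eq0; apply/eqP.
  have -> : k * f - f ^+ 2 = (4^-1)%:C *: (k * k - h * h + (k * h - h * k)).
    by rewrite /f !rmorphV ?unitfE // !rmorph_nat; ncring.
  by rewrite k2 hk !subrr addr0 scaler0.
exists f; split=> //.
- have [r [rr r2 rC]] := cpos_sqrt kk; have fr := rC _ fk.
  have -> : f ^+ 3 = (r * f) * (r * f).
    by rewrite exprSr -kf -r2 -[in RHS]mulrA (mulrA f) fr !mulrA.
  by apply: cpos_sqr; rewrite starM sf (cpos_sa rr) fr.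
- move=> f0; suff -> : - h = k by [].
  apply/eqP; rewrite eq_sym -subr_eq0 opprK.
  have -> : k + h = 2%:C *: f by rewrite scalerA -rmorphM divff // rmorph1 scale1r.
  by rewrite f0 scaler0.
Qed.

(** * C*-norms on the algebraic tensor product *)

Section TensorNorms.
Context {R : realType} {A B T : cstarType R} (tens : A -> B -> T).
Hypothesis tensP : cstar_tensor tens.

Lemma tensDl a a' b : tens (a + a') b = tens a b + tens a' b.
Proof. by rewrite -[a in LHS]scale1r (tens_linl tensP) scale1r. Qed.

Lemma tensDr a b b' : tens a (b + b') = tens a b + tens a b'.
Proof. by rewrite -[b in LHS]scale1r (tens_linr tensP) scale1r. Qed.

Lemma tens0l b : tens 0 b = 0.
Proof. by apply: (addrI (tens 0 b)); rewrite -tensDl !addr0. Qed.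

Lemma tens0r a : tens a 0 = 0.
Proof. by apply: (addrI (tens a 0)); rewrite -tensDr !addr0. Qed.

Lemma tensZl (c : R[i]) a b : tens (c *: a) b = c *: tens a b.
Proof. by rewrite -[c *: a]addr0 (tens_linl tensP) tens0l addr0. Qed.

Lemma tensZr (c : R[i]) a b : tens a (c *: b) = c *: tens a b.
Proof. by rewrite -[c *: b]addr0 (tens_linr tensP) tens0r addr0. Qed.

Lemma tensNl a b : tens (- a) b = - tens a b.
Proof. by rewrite -scaleN1r tensZl scaleN1r. Qed.

Lemma tensNr a b : tens a (- b) = - tens a b.
Proof. by rewrite -scaleN1r tensZr scaleN1r. Qed.

Lemma tens_suml (I : Type) (r : seq I) (F : I -> A) b :
  tens (\sum_(i <- r) F i) b = \sum_(i <- r) tens (F i) b.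
Proof. exact: (big_morph (tens^~ b) (fun a a' => tensDl a a' b) (tens0l b)). Qed.

Lemma tens_sumr (I : Type) (r : seq I) (F : I -> B) a :
  tens a (\sum_(i <- r) F i) = \sum_(i <- r) tens a (F i).
Proof. exact: (big_morph (tens a) (tensDr a) (tens0r a)). Qed.

Lemma tens_eq0 a b : tens a b = 0 -> b != 0 -> a = 0.
Proof.
move=> ab b0; apply: (tens_inj tensP (k := 1) (a := fun=> a) (b := fun=> b) _ _ ord0).
- move=> c; rewrite big_ord1 => cb0 i; rewrite ord1.
  by apply/eqP; move/eqP: cb0; rewrite scaler_eq0 (negbTE b0) orbF.
- by rewrite big_ord1.
Qed.

Lemma tens_cpos p q : cpos p -> cpos q -> cpos (tens p q).
Proof.
move=> /cpos_sqrt[c [cc <- _]] /cpos_sqrt[d [dd <- _]].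
rewrite -(tens_mul tensP); apply: cpos_sqr.
by rewrite (tens_star tensP) (cpos_sa cc) (cpos_sa dd).
Qed.

(** The C*-identity reduces this to positive factors, which are then replaced one at a time by their
    norms, using that the norm is monotone. *)
Lemma tens_norm_le a b : cnorm (tens a b) <= cnorm a * cnorm b.
Proof.
rewrite -(@ler_pXn2r _ 2) ?nnegrE ?mulr_ge0 ?cnorm_ge0 // exprMn -!cnorm_starM.
rewrite (tens_star tensP) (tens_mul tensP).
have pa := cpos_starM a; have pb := cpos_starM b.
set p := star a * a in pa *; set q := star b * b in pb *.
apply: le_trans (_ : cnorm (tens (cnorm p)%:C%:A q) <= _).
  apply: cpos_mono; first exact: tens_cpos.
  rewrite -tensNl -tensDl.
  by apply: tens_cpos => //; apply: cpos_subr => //; apply: cpos_sa.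
rewrite tensZl cnormZr ger0_norm ?cnorm_ge0 // ler_wpM2l ?cnorm_ge0 //.
apply: le_trans (_ : cnorm (tens 1 (cnorm q)%:C%:A) <= _).
  apply: cpos_mono; first by apply: tens_cpos => //; rewrite -[1](mul1r 1) -{1}(star1 A); exact: cpos_starM.
  rewrite -tensNr -tensDr; apply: tens_cpos; last by apply: cpos_subr => //; apply: cpos_sa.
  by rewrite -[1](mul1r 1) -{1}(star1 A); exact: cpos_starM.
by rewrite tensZr (tens_one tensP) cnorm_real ?cnorm_ge0.
Qed.

(** [f] is the positive part of p - l: a nonzero element living where p >= l, in place of a spectral
    projection. *)
Lemma pos_part_above (D : cstarType R) (p : D) (l : R) : cpos p -> 0 <= l -> l < cnorm p ->
  exists f : D, [/\ star f = f, f ^+ 2 != 0, cpos (f ^+ 3) &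
    p * f ^+ 2 = f ^+ 3 + l%:C *: f ^+ 2].
Proof.
move=> pp l0 lp.
have sh : star (p - l%:C%:A) = p - l%:C%:A by rewrite starB star_real (cpos_sa pp).
have [f [sf hf f3 f0]] := positive_part sh.
exists f; split=> //.
- apply: contraTneq lp => f20; rewrite -leNgt -[l](@cnorm_real R D) //.
  apply: cpos_mono => //; rewrite -opprB; apply: f0.
  apply: cnorm_eq0; apply/eqP; rewrite -sqrf_eq0 -cnorm_sa_sqr // f20.
  by rewrite cnorm0.
- have -> : f ^+ 3 = (p - l%:C%:A) * f * f by rewrite hf; ncring.
  by ncring.
Qed.

(** Localize p near its norm by f and q near its norm by g. Then p (x) q is at least t^2 |p| |q| on
    f^2 (x) g^2, which is nonzero by injectivity of the algebraic tensor product. *)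
Lemma tens_cross_pos p q : cpos p -> cpos q ->
  cnorm p * cnorm q <= cnorm (tens p q).
Proof.
move=> pp qq; rewrite leNgt; apply/negP; set c := cnorm (tens p q) => cpq.
have c0 : 0 <= c := cnorm_ge0 _.
have p0 : 0 < cnorm p.
  by rewrite lt_def cnorm_ge0 andbT; apply: contraTneq cpq => ->; rewrite mul0r -leNgt.
have q0 : 0 < cnorm q.
  by rewrite lt_def cnorm_ge0 andbT; apply: contraTneq cpq => ->; rewrite mulr0 -leNgt.
set P := cnorm p in cpq p0; set Q := cnorm q in cpq q0.
pose r := c / (P * Q); have r0 : 0 <= r by rewrite divr_ge0 // mulr_ge0 // ltW.
have r1 : r < 1 by rewrite ltr_pdivrMr ?mulr_gt0 // mul1r.
(* Then t < 1 and t^2 - r = (1 - r)^2 / 4 > 0. *)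
pose t := (1 + r) / 2; have t0 : 0 <= t by rewrite /t; lra.
have t1 : t < 1 by rewrite /t; lra.
have tr : r < t * t by rewrite /t; nra.
have [| |f [sf f2 f3 pf]] := @pos_part_above A p (P * t) pp.
- by rewrite mulr_ge0 // ltW.
- by rewrite gtr_pMr.
have [| |g [sg g2 g3 qg]] := @pos_part_above B q (Q * t) qq.
- by rewrite mulr_ge0 // ltW.
- by rewrite gtr_pMr.
have F2 : cpos (f ^+ 2) by rewrite expr2; apply: cpos_sqr.
have G2 : cpos (g ^+ 2) by rewrite expr2; apply: cpos_sqr.
have fg0 : 0 < cnorm (tens (f ^+ 2) (g ^+ 2)).
  rewrite cnorm_gt0; apply: contraNneq f2 => fg.
  by apply/eqP; apply: (tens_eq0 fg).
have : (P * t * (Q * t)) * cnorm (tens (f ^+ 2) (g ^+ 2)) <=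
    c * cnorm (tens (f ^+ 2) (g ^+ 2)).
  apply: le_trans (cnormM _ _); rewrite (tens_mul tensP) pf qg.
  have Pt : 0 <= P * t by rewrite mulr_ge0 // ltW.
  have Qt : 0 <= Q * t by rewrite mulr_ge0 // ltW.
  rewrite -[X in X * _](ger0_norm (mulr_ge0 Pt Qt)) -cnormZr.
  have tp := tens_cpos F2 G2.
  apply: cpos_mono; first by apply: cposZ => //; apply: mulr_ge0.
  rewrite tensDl !tensDr !tensZl !tensZr scalerA -rmorphM addrA addrK.
  apply: cposD; first apply: cposD.
  - exact: tens_cpos.
  - by apply: cposZ => //; apply: tens_cpos.
  - by apply: cposZ => //; apply: tens_cpos.
rewrite ler_pM2r // => h; move: tr; rewrite ltNge => /negP; apply.
rewrite ler_pdivlMr ?mulr_gt0 //; apply: le_trans h.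
by rewrite le_eqVlt; apply/orP; left; apply/eqP; ring.
Qed.

(** Elements of the algebraic tensor product are handled as lists of pairs; independence of the list
    will follow from norm estimates. *)
Definition tsum (r : seq (A * B)) : T := \sum_(p <- r) tens p.1 p.2.

(* For k_p = a_p - chi a_p and s = \sum_p k_p k_p^*, the positive part f of
   l - s is nonzero because chi s = 0, and f ^+ 2 almost annihilates all k_p:
   after multiplication by f ^+ 2, a tensor t is close to f ^+ 2 (x) slice t. *)
Lemma slice_bound (chi : A -> R[i]) : character chi -> forall r : seq (A * B),
  cnorm (\sum_(p <- r) chi p.1 *: p.2) <= cnorm (tsum r).
Proof.
move=> [chiD chiM chi1 chis] r; set b := \sum_(p <- r) _; set t := tsum r.
have chi0 : chi 0 = 0.
  by have := chiD (-1) 0 0; rewrite scaleN1r oppr0 addr0 mulN1r addNr.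
have chiB a a' : chi (a - a') = chi a - chi a'.
  by rewrite addrC -scaleN1r chiD mulN1r addrC.
have chiDD a a' : chi (a + a') = chi a + chi a' by rewrite -[a]scale1r chiD mul1r scale1r.
have chi_alg (c : R[i]) : chi c%:A = c.
  by rewrite -[c%:A]addr0 chiD chi1 chi0 mulr1 addr0.
pose k (p : A * B) := p.1 - (chi p.1)%:A.
have chik p : chi (k p) = 0 by rewrite chiB chi_alg subrr.
pose s := \sum_(p <- r) k p * star (k p).
have chis0 : chi s = 0.
  by rewrite (big_morph chi chiDD chi0) big1 // => p _; rewrite chiM chik mul0r.
have ss : cpos s.
  by apply: big_ind => //; [exact: cpos0|exact: cposD|move=> p _; exact: cpos_Mstar].
have key (l : R) : 0 < l -> cnorm b <= cnorm t + l * \sum_(p <- r) cnorm p.2.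
  move=> l0; pose h := (l ^+ 2)%:C%:A - s.
  have sh : star h = h by rewrite starB star_real (cpos_sa ss).
  have [f [sf hf f3 f0]] := positive_part sh.
  (* If f = 0, then s - l^2 = c c with c self-adjoint, and chi c would be a real number with square
     - l^2. *)
  have fn0 : f != 0.
    apply: contraTneq l0 => /f0/cpos_sqrt[c [cc c2 _]].
    have := chiM c c; rewrite c2 opprB chiB chis0 chi_alg sub0r => h1.
    have cr : Num.conj (chi c) = chi c by rewrite -chis (cpos_sa cc).
    have : 0 <= chi c * chi c by rewrite -{2}cr mul_conjC_ge0.
    rewrite -h1 oppr_ge0 (_ : 0 = (0 : R)%:C) // lecR -leNgt => l20.
    by rewrite leNgt; apply/negP => l0; move: l20; rewrite leNgt exprn_gt0.
  pose F := f ^+ 2.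
  have sF : star F = F by rewrite starX sf.
  have F0 : 0 < cnorm F by rewrite cnorm_sa_sqr // exprn_gt0 // cnorm_gt0.
  have FsF : cnorm (F * s * F) <= l ^+ 2 * cnorm F ^+ 2.
    rewrite -cnorm_sa_sqr // -[l ^+ 2]ger0_norm ?sqr_ge0 // -cnormZr.
    apply: cpos_mono; first by rewrite -{1}sF; apply: cpos_conj.
    have -> : (l ^+ 2)%:C *: F ^+ 2 - F * s * F = F * h * F by rewrite /h; ncring.
    have -> : F * h * F = star f * f ^+ 3 * f.
      by rewrite sf /F -mulrA exprS mulrA mulrA -(mulrA _ h) hf; ncring.
    exact: cpos_conj.
  have Fk p : p \in r -> cnorm (F * k p) <= l * cnorm F.
    move=> pr; rewrite -(@ler_pXn2r _ 2) ?nnegrE ?mulr_ge0 ?cnorm_ge0 ?(ltW l0) //.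
    rewrite exprMn; apply: le_trans FsF; rewrite -cnorm_starMr starM sF.
    apply: cpos_mono.
      by have := cpos_Mstar (F * k p); rewrite starM sF.
    rewrite /s (big_rem p) //=.
    set z := \sum_(q <- _) _.
    have -> : F * (k p * star (k p) + z) * F - F * k p * (star (k p) * F) =
        star F * z * F by rewrite sF; ncring.
    apply: cpos_conj.
    by apply: big_ind => //; [exact: cpos0|exact: cposD|move=> q _; exact: cpos_Mstar].
  have tE : tens F 1 * t = tens F b + \sum_(p <- r) tens (F * k p) p.2.
    rewrite /t /tsum mulr_sumr /b tens_sumr -big_split; apply: eq_bigr => p _ /=.
    rewrite (tens_mul tensP) mul1r tensZr -tensZl -tensDl; congr tens.
    by rewrite /k mulrBr mulr_algr addrC subrK.
  have Fb : cnorm F * cnorm b <= cnorm (tens F b).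
    rewrite -(@ler_pXn2r _ 2) ?nnegrE ?mulr_ge0 ?cnorm_ge0 // exprMn.
    rewrite -!cnorm_starM (tens_star tensP) (tens_mul tensP).
    by apply: tens_cross_pos; apply: cpos_starM.
  rewrite -(ler_pM2l F0); apply: le_trans Fb _.
  have -> : tens F b = tens F 1 * t - \sum_(p <- r) tens (F * k p) p.2.
    by rewrite tE addrK.
  apply: le_trans (cnormB _ _) _; rewrite mulrDr lerD //.
    apply: le_trans (cnormM _ _) _; rewrite ler_wpM2r ?cnorm_ge0 //.
    by have := tens_norm_le F 1; rewrite cnorm1 mulr1.
  apply: le_trans (cnorm_sum _ _ _) _; rewrite !mulr_sumr.
  rewrite !big_seq; apply: ler_sum => p pr.
  apply: le_trans (tens_norm_le _ _) _; rewrite mulrA (mulrC _ l) ler_wpM2r ?cnorm_ge0 //.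
  by rewrite Fk.
apply/ler_addgt0Pr => e e0.
have S0 : 0 <= \sum_(p <- r) cnorm p.2 by apply: sumr_ge0 => p _; apply: cnorm_ge0.
set S := \sum_(p <- r) _ in key S0.
have S1 : 0 < S + 1 by rewrite ltr_wpDl.
apply: le_trans (key (e / (S + 1)) _) _; first by rewrite divr_gt0.
rewrite lerD2l -mulrA ler_piMr ?(ltW e0) // ler_pdivrMl // mulr1 lerDl //.
Qed.


Definition tseq (D : set A) (r : seq (A * B)) := forall p, p \in r -> D p.1.

Lemma tseq_cat D r r' : tseq D r -> tseq D r' -> tseq D (r ++ r').
Proof. by move=> h h' p; rewrite mem_cat => /orP[/h|/h']. Qed.

Definition tscale (c : R[i]) (r : seq (A * B)) := [seq (c *: p.1, p.2) | p <- r].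

Lemma tseq_scale D (c : R[i]) r : Defs.subspace D -> tseq D r -> tseq D (tscale c r).
Proof. by move=> Ds h q /mapP[p /h pD ->] /=; apply: subspaceZ. Qed.

Lemma tsum_cat r r' : tsum (r ++ r') = tsum r + tsum r'.
Proof. exact: big_cat. Qed.

Lemma tsum_scale (c : R[i]) r : tsum (tscale c r) = c *: tsum r.
Proof. by rewrite /tsum big_map scaler_sumr; apply: eq_bigr => p _; rewrite tensZl. Qed.

Lemma tens_subE D : Defs.subspace D ->
  tens_sub tens D = adherent [set t | exists2 r, tseq D r & t = tsum r].
Proof.
move=> Ds; rewrite /tens_sub closed_spanE; congr adherent; apply/seteqP; split.
  apply: lspan_sub; first split.
  - by exists [::] => //; rewrite /tsum big_nil.
  - move=> c _ _ [r hr ->] [r' hr' ->]; exists (tscale c r ++ r').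
      by apply: tseq_cat => //; apply: tseq_scale.
    by rewrite tsum_cat tsum_scale.
  - move=> _ [a Da [b _ <-]]; exists [:: (a, b)].
      by move=> p; rewrite inE => /eqP->.
    by rewrite /tsum big_seq1.
move=> _ [r hr ->]; apply: subspace_sum; first exact: lspan_subspace.
by move=> p /hr Dp; apply: sub_lspan; exists p.1 => //; exists p.2.
Qed.

(** The bound over all lists makes the value depend on the tensor alone. The clause on [W] will
    locate the image of theta (x) id. *)
Lemma tensor_extension (Y : cstarType R) (D : set A) (beta : A -> B -> Y) (C : R) :
  Defs.subspace D ->
  (forall (c : R[i]) a a' b, D a -> D a' ->
     beta (c *: a + a') b = c *: beta a b + beta a' b) ->
  0 < C ->
  (forall r, tseq D r ->
     cnorm (\sum_(p <- r) beta p.1 p.2) <= C * cnorm (tsum r)) ->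
  exists F : T -> Y, [/\ cont_linear_on (tens_sub tens D) F,
    forall r, tseq D r -> F (tsum r) = \sum_(p <- r) beta p.1 p.2 &
    forall W : set Y, norm_closed W ->
      (forall r, tseq D r -> W (\sum_(p <- r) beta p.1 p.2)) ->
      forall t, tens_sub tens D t -> W (F t)].
Proof.
move=> Ds bl C0 bC.
pose G t c := exists r, [/\ tseq D r, t = tsum r & c = \sum_(p <- r) beta p.1 p.2].
have bZ (c : R[i]) a b : D a -> beta (c *: a) b = c *: beta a b.
  move=> Da; have b0 : beta 0 b = 0.
    by have := bl (-1) a a b Da Da; rewrite !scaleN1r !addNr.
  by have := bl c a 0 b Da (proj1 Ds); rewrite b0 !addr0.
have GD (c : R[i]) t z t' z' : G t z -> G t' z' -> G (c *: t + t') (c *: z + z').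
  move=> [r [hr -> ->]] [r' [hr' -> ->]]; exists (tscale c r ++ r'); split.
  - by apply: tseq_cat => //; apply: tseq_scale.
  - by rewrite tsum_cat tsum_scale.
  - rewrite big_cat big_map scaler_sumr /=; congr (_ + _).
    by rewrite !big_seq; apply: eq_bigr => p /hr Dp; rewrite bZ.
have GC t z : G t z -> cnorm z <= C * cnorm t by move=> [r [hr -> ->]]; apply: bC.
have [F [Fc FG Fcl]] := continuous_extension GD C0 GC.
have DE : tens_sub tens D = adherent [set t | exists z, G t z].
  rewrite tens_subE //; congr adherent; apply/seteqP; split=> t.
    by move=> [r hr ->]; exists (\sum_(p <- r) beta p.1 p.2), r.
  by move=> [z [r [hr -> _]]]; exists r.
exists F; split; first by rewrite DE.
  by move=> r hr; apply: FG; exists r.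
move=> W /norm_closedP Wc hW t; rewrite DE => /Fcl h; apply: Wc => e e0.
by have [t' [z [[r [hr _ ->]] _ ?]]] := h e e0; exists (\sum_(p <- r) beta p.1 p.2); auto.
Qed.

Lemma slice_exists (chi : A -> R[i]) :
  closed_span [set tens a b | a in setT & b in setT] = setT ->
  character chi -> exists S, is_slice tens chi S.
Proof.
move=> dense chiP; have [chiD _ _ _] := chiP.
have sT : Defs.subspace (setT : set A) by [].
have [||S [Sc SE _]] :=
  @tensor_extension B setT (fun a b => chi a *: b) 1 sT _ ltr01.
- by move=> c a a' b _ _; rewrite chiD scalerDl scalerA.
- by move=> r _; rewrite mul1r; apply: slice_bound.
exists S; split; first by rewrite -dense.
move=> a b; have := SE [:: (a, b)]; rewrite /tsum !big_seq1; exact.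
Qed.

Lemma slice_tsum (chi : A -> R[i]) S r : is_slice tens chi S ->
  S (tsum r) = \sum_(p <- r) chi p.1 *: p.2.
Proof.
move=> [[Sl _] SE]; have S0 : S 0 = 0.
  by have := Sl (-1) 0 0 I I; rewrite !scaleN1r !addNr.
have SD t t' : S (t + t') = S t + S t' by have := Sl 1 t t' I I; rewrite !scale1r.
by rewrite /tsum (big_morph S SD S0); apply: eq_bigr => p _; rewrite SE.
Qed.

End TensorNorms.

Lemma min_tensor_le (R : realType) (A B T T' : cstarType R)
    (tens : A -> B -> T) (tens' : A -> B -> T') r :
  min_tensor tens -> cstar_tensor tens' ->
  cnorm (tsum tens r) <= cnorm (tsum tens' r).
Proof.
move=> [_ _ /(_ T' tens') h] /h le.
have sumE (D : cstarType R) (f : A -> B -> D) :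
    \sum_(i < size r) f (tnth (in_tuple r) i).1 (tnth (in_tuple r) i).2 =
    \sum_(p <- r) f p.1 p.2.
  by rewrite [RHS](big_tnth _ _ _ _ (fun p => f p.1 p.2)).
have := le (size r) (fun i => (tnth (in_tuple r) i).1)
  (fun i => (tnth (in_tuple r) i).2).
by rewrite (sumE T tens) (sumE T' tens').
Qed.

(** * The algebra C(SU_{-1}(2)) *)

Section Words.
Context {R : realType} {A : cstarType R}.

Inductive word_in (E : set A) : A -> Prop :=
  | word_one : word_in E 1
  | word_cons e w : E e -> word_in E w -> word_in E (e * w).

Lemma word_mul E w w' : word_in E w -> word_in E w' -> word_in E (w * w').
Proof.
move=> hw hw'; elim: hw => [|e w1 Ee _ IH]; first by rewrite mul1r.
by rewrite -mulrA; apply: word_cons.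
Qed.

Lemma word_gen (E : set A) e : E e -> word_in E e.
Proof. by move=> Ee; rewrite -[e]mulr1; apply: word_cons => //; apply: word_one. Qed.

Definition polys (E : set A) : set A := lspan (word_in E).

Lemma lspan_mul (E E' V : set A) : Defs.subspace V ->
  (forall e e', E e -> E' e' -> V (e * e')) ->
  forall a b, lspan E a -> lspan E' b -> V (a * b).
Proof.
move=> Vs EV a b ha hb; have [V0 VD] := Vs.
suff : lspan E `<=` [set a | forall b, lspan E' b -> V (a * b)] by move/(_ a ha b hb).
apply: lspan_sub => [|e Ee].
  split=> [b' _|c a1 a2 h1 h2 b' hb']; first by rewrite mul0r.
  by rewrite mulrDl -scalerAl; apply: VD; [apply: h1|apply: h2].
suff : lspan E' `<=` [set b | V (e * b)] by move=> h b' /h.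
apply: lspan_sub => [|e' Ee' /=]; last exact: EV.
split=> [|c b1 b2 h1 h2] /=; first by rewrite mulr0.
by rewrite mulrDr -scalerAr; apply: VD.
Qed.

Lemma polys_mul E a b : polys E a -> polys E b -> polys E (a * b).
Proof.
apply: lspan_mul; first exact: lspan_subspace.
by move=> w w' hw hw'; apply: sub_lspan; apply: word_mul.
Qed.

Lemma polys1 E : polys E 1. Proof. by apply: sub_lspan; apply: word_one. Qed.

Lemma polys_gen (E : set A) e : E e -> polys E e.
Proof. by move=> Ee; apply: sub_lspan; apply: word_gen. Qed.

Lemma adherent_mul (V : set A) : (forall a b, V a -> V b -> V (a * b)) ->
  forall a b, adherent V a -> adherent V b -> adherent V (a * b).
Proof.
move=> VM a b Va Vb; apply: adherent_adherent.
have lip d e : cnorm_lip (fun a : A => d * a * e) := cnorm_lip_mul2 d e.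
have := @adherent_map _ _ _ _ _ (adherent V) b (lip a 1) _ Vb; rewrite mulr1; apply.
move=> c Vc; rewrite mulr1.
have := @adherent_map _ _ _ _ _ V a (lip 1 c) _ Va; rewrite mul1r; apply.
by move=> d Vd; rewrite mul1r; apply: VM.
Qed.

Lemma adherent_polys_cstar E : (forall e, E e -> polys E (star e)) ->
  cstar_subalg (adherent (polys E)).
Proof.
move=> Es; have Ps : forall a, polys E a -> polys E (star a).
  suff h : polys E `<=` [set a | polys E (star a)] by move=> a /h.
  apply: lspan_sub.
    split=> [|c a b ha hb] /=; first by rewrite star0; case: (@lspan_subspace _ _ (word_in E)).
    rewrite starD starZ; case: (@lspan_subspace _ _ (word_in E)) => _; exact.
  move=> w; elim=> [|e w' Ee _ IH] /=; first by rewrite star1; apply: polys1.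
  by rewrite starM; apply: polys_mul => //; apply: Es.
split.
- exact/adherent_subspace/lspan_subspace.
- by apply: adherent_mem; apply: polys1.
- by apply: adherent_mul => a b; apply: polys_mul.
- by move=> a; apply: adherent_map; [exact: cnorm_lip_star|exact: Ps].
- by apply/norm_closedP => a; apply: adherent_adherent.
Qed.

Lemma gen_cstar_subalg (E : set A) : cstar_subalg (gen_cstar E).
Proof.
split.
- split=> [B [[[B0 _] _ _ _ _] _]//|c a b ha hb B hB].
  by have [[[_ BD] _ _ _ _] _] := hB; apply: BD; [apply: ha|apply: hb].
- by move=> B [[_ B1 _ _ _] _].
- move=> a b ha hb B hB; have [[_ _ BM _ _] _] := hB.
  by apply: BM; [apply: ha|apply: hb].
- by move=> a ha B hB; have [[_ _ _ Bs _] _] := hB; apply: Bs; apply: ha.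
- move=> s a sG sa B hB; have [[_ _ _ _ Bc] _] := hB.
  by apply: Bc sa => k; apply: sG.
Qed.

Lemma sub_gen_cstar (E : set A) : E `<=` gen_cstar E.
Proof. exact: sub_smallest. Qed.

Lemma gen_cstar_sub (E B : set A) : cstar_subalg B -> E `<=` B ->
  gen_cstar E `<=` B.
Proof. by move=> hB EB; apply: smallest_sub. Qed.

End Words.

Section TwoByTwo.
Context {R : realType} {A : cstarType R}.

Definition mk2 (a b c d : A) : cmx A 1 :=
  \matrix_(i, j) if i == 0 then (if j == 0 then a else b)
                 else (if j == 0 then c else d).

Lemma ord2E (i : 'I_2) : i = 0 \/ i = 1.
Proof. by case: i => -[|[|//]] hi; [left|right]; apply: val_inj. Qed.

Lemma cmx2P (M N : cmx A 1) : M 0 0 = N 0 0 -> M 0 1 = N 0 1 ->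
  M 1 0 = N 1 0 -> M 1 1 = N 1 1 -> M = N.
Proof.
by move=> h1 h2 h3 h4; apply/matrixP => i j; case: (ord2E i) => ->; case: (ord2E j) => ->.
Qed.

Lemma cmxM2 (M N : cmx A 1) i j : (M * N) i j = M i 0 * N 0 j + M i 1 * N 1 j.
Proof.
rewrite cmxM !big_ord_recl big_ord0 addr0.
by congr (_ + M i _ * N _ j); apply: val_inj.
Qed.

Lemma mk2_00 a b c d : mk2 a b c d 0 0 = a. Proof. by rewrite mxE. Qed.
Lemma mk2_01 a b c d : mk2 a b c d 0 1 = b. Proof. by rewrite mxE. Qed.
Lemma mk2_10 a b c d : mk2 a b c d 1 0 = c. Proof. by rewrite mxE. Qed.
Lemma mk2_11 a b c d : mk2 a b c d 1 1 = d. Proof. by rewrite mxE. Qed.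
Definition mk2E := (mk2_00, mk2_01, mk2_10, mk2_11).

Lemma mk2M a b c d a' b' c' d' : mk2 a b c d * mk2 a' b' c' d' =
  mk2 (a * a' + b * c') (a * b' + b * d') (c * a' + d * c') (c * b' + d * d').
Proof. by apply: cmx2P; rewrite cmxM2 !mk2E. Qed.

Lemma mk2D a b c d a' b' c' d' : mk2 a b c d + mk2 a' b' c' d' =
  mk2 (a + a') (b + b') (c + c') (d + d').
Proof. by apply: cmx2P; rewrite cmxD !mk2E. Qed.

Lemma mk2N a b c d : - mk2 a b c d = mk2 (- a) (- b) (- c) (- d).
Proof. by apply: cmx2P; rewrite cmxN !mk2E. Qed.

Lemma mk2Z (k : R[i]) a b c d :
  k *: mk2 a b c d = mk2 (k *: a) (k *: b) (k *: c) (k *: d).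
Proof. by apply: cmx2P; rewrite cmxZ !mk2E. Qed.

Lemma mk2_star a b c d :
  star (mk2 a b c d) = mk2 (star a) (star c) (star b) (star d).
Proof. by apply: cmx2P; rewrite cmx_starE !mk2E. Qed.

Lemma mk2_1 : 1 = mk2 1 0 0 1. Proof. by apply: cmx2P; rewrite cmx1 !mk2E. Qed.

Lemma mk2_eq a b c d a' b' c' d' : a = a' -> b = b' -> c = c' -> d = d' ->
  mk2 a b c d = mk2 a' b' c' d'.
Proof. by move=> -> -> -> ->. Qed.

End TwoByTwo.

(** * Homomorphisms given by the universal property *)

Section QuantumGroup.
Context {R : realType} {A : cstarType R} {x u v y : A}.
Hypothesis univ : su_universal x u v y.

Let rel : su_rel x u v y. Proof. by case: univ. Qed.
Let ux : u * x = - (x * u). Proof. exact: su_ux rel. Qed.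
Let vx : v * x = - (x * v). Proof. exact: su_vx rel. Qed.
Let uy : u * y = - (y * u). Proof. exact: su_uy rel. Qed.
Let vy : v * y = - (y * v). Proof. exact: su_vy rel. Qed.
Let uv : u * v = v * u. Proof. exact: su_uv rel. Qed.
Let xy : x * y = 1 - u * v. Proof. by rewrite -(su_xy rel) addrK. Qed.
Let yx : y * x = 1 - u * v. Proof. by rewrite -(su_yx rel) addrK. Qed.
Let sx : star x = y. Proof. exact: su_starx rel. Qed.
Let su : star u = v. Proof. exact: su_staru rel. Qed.
Let sy : star y = x. Proof. by rewrite -sx starK. Qed.
Let sv : star v = u. Proof. by rewrite -su starK. Qed.

Definition gens : set A := [set x; u; v; y].

Lemma gens_ind (P : A -> Prop) : P x -> P u -> P v -> P y -> forall e, gens e -> P e.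
Proof. by move=> ? ? ? ? e [[[->|->]|->]|->]. Qed.

Lemma gens_x : gens x. Proof. by left; left; left. Qed.
Lemma gens_u : gens u. Proof. by left; left; right. Qed.
Lemma gens_v : gens v. Proof. by left; right. Qed.
Lemma gens_y : gens y. Proof. by right. Qed.

Lemma su_hom (B : cstarType R) (x' u' v' y' : B) : su_rel x' u' v' y' ->
  exists phi : {lrmorphism A -> B}, star_preserving phi /\
    [/\ phi x = x', phi u = u', phi v = v' & phi y = y'].
Proof. by case: univ => _ h /h[phi hphi _]; exists phi. Qed.

Lemma su_rel_map (B : cstarType R) (g : {lrmorphism A -> B}) :
  star_preserving g -> su_rel (g x) (g u) (g v) (g y).
Proof.
move=> gs; split.
- by rewrite -rmorphM ux rmorphN rmorphM.
- by rewrite -rmorphM vx rmorphN rmorphM.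
- by rewrite -rmorphM uy rmorphN rmorphM.
- by rewrite -rmorphM vy rmorphN rmorphM.
- by rewrite -rmorphM uv rmorphM.
- by rewrite -!rmorphM -rmorphD (su_xy rel) rmorph1.
- by rewrite -!rmorphM -rmorphD (su_yx rel) rmorph1.
- by rewrite -gs sx.
- by rewrite -gs su.
Qed.

Lemma su_hom_eq (B : cstarType R) (f g : {lrmorphism A -> B}) :
  star_preserving f -> star_preserving g ->
  f x = g x -> f u = g u -> f v = g v -> f y = g y -> f =1 g.
Proof.
move=> fs gs hx hu hv hy; have [_ h] := univ.
have [|phi _ uniq] := h B (g x) (g u) (g v) (g y); first exact: su_rel_map.
by move=> a; rewrite (uniq f) // (uniq g).
Qed.

(** The universal property gives a homomorphism from A to the closure of the polynomials; followed
    by the inclusion it fixes the generators, so it is the identity. *)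
Lemma polys_dense a : adherent (polys gens) a.
Proof.
have hB : cstar_subalg (adherent (polys gens)).
  apply: adherent_polys_cstar; apply: gens_ind.
  - by rewrite sx; apply: polys_gen gens_y.
  - by rewrite su; apply: polys_gen gens_v.
  - by rewrite sv; apply: polys_gen gens_u.
  - by rewrite sy; apply: polys_gen gens_x.
have mem e : gens e -> e \in subcstar_pred hB.
  by move=> ge; apply/subcstar_predP; apply: adherent_mem; apply: polys_gen.
pose S e ge : subcstar hB := SubCstar (mem e ge).
have [|phi [phis [px pu pv py]]] :=
  @su_hom (subcstar hB) (S _ gens_x) (S _ gens_u) (S _ gens_v) (S _ gens_y).
  by split; apply: val_inj => //=; case: rel.
have <- : @subcstar_incl _ _ _ hB (phi a) = a.
  apply: (su_hom_eq (f := @subcstar_incl _ _ _ hB \o phi) (g := idfun)) => //=.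
  - by move=> b; rewrite /= phis.
  - by rewrite px.
  - by rewrite pu.
  - by rewrite pv.
  - by rewrite py.
by apply/(@subcstar_predP _ _ _ hB); apply: (valP (phi a)).
Qed.

Lemma closed_ind (V : set A) : norm_closed V -> Defs.subspace V ->
  V 1 -> (forall e a, gens e -> V a -> V (e * a)) -> forall a, V a.
Proof.
move=> /norm_closedP Vc Vs V1 VM a; apply: Vc.
have PV : polys gens `<=` V.
  by apply: lspan_sub => // w; elim=> // e w' Ee _; apply: VM.
by move=> e e0; have [b /PV Vb ab] := polys_dense a e0; exists b.
Qed.


Definition norm_rels := (ux, vx, uy, vy, uv, xy, yx, sx, su, sy, sv).

(** This is the translation by the diagonal character with parameter z; the flip below is the
    translation by the off-diagonal character with parameter 1. *)
Lemma rot_exists (z : R[i]) : z * Num.conj z = 1 ->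
  exists phi : {lrmorphism A -> A}, star_preserving phi /\
    [/\ phi x = z *: x, phi u = z *: u, phi v = Num.conj z *: v &
        phi y = Num.conj z *: y].
Proof.
move=> zz; apply: su_hom; set w := Num.conj z.
have ww : w * z = 1 by rewrite mulrC.
split; rewrite -?scalerAl -?scalerAr ?scalerA ?zz ?ww ?scale1r //.
- by rewrite ux scalerN.
- by rewrite vy scalerN.
- exact: su_xy rel.
- exact: su_yx rel.
- by rewrite starZ sx.
- by rewrite starZ su.
Qed.

Lemma flip_exists : exists phi : {lrmorphism A -> A}, star_preserving phi /\
  [/\ phi x = v, phi u = y, phi v = x & phi y = u].
Proof.
apply: su_hom; split; rewrite ?norm_rels ?opprK //.
- by rewrite subrKC.
- by rewrite -uv subrKC.
Qed.

Lemma rot_character_exists (z : R[i]) : z * Num.conj z = 1 ->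
  exists chi : A -> R[i], character chi /\
    [/\ chi x = z, chi u = 0, chi v = 0 & chi y = Num.conj z].
Proof.
move=> zz; have [|phi [phis pE]] := @su_hom (R[i]^o) z 0 0 (Num.conj z).
  split; rewrite ?mulr0 ?mul0r ?oppr0 ?addr0 //; first by rewrite mulrC.
  exact: rmorph0.
exists phi; split=> //; split=> //.
- by move=> c a b; rewrite linearP.
- exact: rmorphM.
- exact: rmorph1.
Qed.

Lemma flip_character_exists (z : R[i]) : z * Num.conj z = 1 ->
  exists chi : A -> R[i], character chi /\
    [/\ chi x = 0, chi u = Num.conj z, chi v = z & chi y = 0].
Proof.
move=> zz; have [|phi [phis pE]] := @su_hom (R[i]^o) 0 (Num.conj z) z 0.
  split; rewrite ?mulr0 ?mul0r ?oppr0 ?add0r //; try by rewrite mulrC.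
    exact: rmorph0.
  exact: conjCK.
exists phi; split=> //; split=> //.
- by move=> c a b; rewrite linearP.
- exact: rmorphM.
- exact: rmorph1.
Qed.

(* With S = mk2 1 0 0 (-1), S' = mk2 0 1 1 0, s1 = (S + S') / sqrt 2 and
   s2 = (S - S') / sqrt 2, the image of x is (s1 x + s2 v) / sqrt 2: this is
   (rho (x) id) delta for the irreducible representation rho of dimension 2
   with rho x = s1 / sqrt 2 and rho u = s2 / sqrt 2. *)
Definition psi_mx (p q : A) : cmx A 1 := 2^-1 *: mk2 (p + q) (p - q) (p - q) (- (p + q)).

Lemma psi_mxM (a b c d : A) : psi_mx a b * psi_mx c d =
  2^-1 *: mk2 (a * c + b * d) (b * c - a * d) (a * d - b * c) (a * c + b * d).
Proof.
rewrite /psi_mx -scalerAl -scalerAr scalerA mk2M !mk2Z.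
by apply: mk2_eq; ncring.
Qed.

Lemma psi_exists : exists psi : {lrmorphism A -> cmx A 1}, star_preserving psi /\
  [/\ psi x = psi_mx x v, psi u = psi_mx u y, psi v = psi_mx v x & psi y = psi_mx y u].
Proof.
have conj2 : Num.conj (2^-1) = 2^-1 :> R[i] by rewrite rmorphV ?unitfE // rmorph_nat.
have psi_star a b : star (psi_mx a b) = psi_mx (star a) (star b).
  by rewrite starZ conj2 mk2_star starN starB !starD.
apply: su_hom; split; rewrite ?psi_star ?norm_rels //;
  rewrite ?psi_mxM ?norm_rels.
- by rewrite -scalerN mk2N; congr (_ *: _); apply: mk2_eq; ncring.
- by rewrite -scalerN mk2N; congr (_ *: _); apply: mk2_eq; ncring.
- by rewrite -scalerN mk2N; congr (_ *: _); apply: mk2_eq; ncring.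
- by rewrite -scalerN mk2N; congr (_ *: _); apply: mk2_eq; ncring.
- by congr (_ *: _); apply: mk2_eq; ncring.
- by rewrite -scalerDr mk2D mk2Z mk2_1; apply: mk2_eq; ncring.
- by rewrite -scalerDr mk2D mk2Z mk2_1; apply: mk2_eq; ncring.
Qed.

End QuantumGroup.

(** * The coefficient theta *)

Section AlgebraMaps.
Context {R : realType} {A : cstarType R} {x u v y : A}.
Hypothesis univ : su_universal x u v y.

(** The star is left out on purpose: maps such as a |-> S (f a) S' can then be compared on
    generators without checking that they preserve it. *)
Definition alg_map (B : cstarType R) (f : A -> B) : Prop :=
  [/\ forall (c : R[i]) a b, f (c *: a + b) = c *: f a + f b,
      forall a b, f (a * b) = f a * f b, f 1 = 1 & cnorm_lip f].

Lemma alg_map_hom (B : cstarType R) (f : {lrmorphism A -> B}) :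
  star_preserving f -> alg_map f.
Proof.
move=> fs; split; [exact: linearP|exact: rmorphM|exact: rmorph1|].
exact: star_hom_lip.
Qed.

Lemma alg_map_conj (B : cstarType R) (f : A -> B) (S S' : B) :
  alg_map f -> S' * S = 1 -> S * S' = 1 -> alg_map (fun a => S * f a * S').
Proof.
move=> [fD fM f1 fl] S'S SS'; split.
- by move=> c a b; rewrite fD mulrDr mulrDl -scalerAr -scalerAl.
- move=> a b; rewrite fM -!mulrA; congr (_ * (_ * _)).
  by rewrite !mulrA S'S mul1r.
- by rewrite f1 mulr1.
- exact: (cnorm_lip_comp fl (cnorm_lip_mul2 S S')).
Qed.

Lemma alg_map_comp (B : cstarType R) (f : A -> B) (g : A -> A) :
  alg_map f -> alg_map g -> alg_map (f \o g).
Proof.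
move=> [fD fM f1 fl] [gD gM g1 gl]; split=> /=.
- by move=> c a b; rewrite gD fD.
- by move=> a b; rewrite gM fM.
- by rewrite g1.
- exact: cnorm_lip_comp.
Qed.

Lemma cnorm_cmx_le (B : cstarType R) k (M : cmx B k) :
  cnorm M <= \sum_i \sum_j cnorm (M i j).
Proof. exact: cmx_norm_le (cmx_bounded_sum M). Qed.

Definition cmx_map (f : A -> A) k (M : cmx A k) : cmx A k := map_mx f M.

Lemma cmx_map_lip (f : A -> A) k : cnorm_lip f -> cnorm_lip (@cmx_map f k).
Proof.
move=> [C C0 fC]; exists (\sum_(i < k.+1) \sum_(j < k.+1) C).
  by rewrite !sumr_const card_ord pmulrn_rgt0 // pmulrn_rgt0.
move=> M N; apply: le_trans (cnorm_cmx_le _) _; rewrite mulr_suml.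
apply: ler_sum => i _; rewrite mulr_suml; apply: ler_sum => j _.
rewrite !mxE; apply: le_trans (fC _ _) _; rewrite ler_pM2l //.
by have := cnorm_cmx_entry (M - N) i j; rewrite !mxE.
Qed.

Lemma alg_map_cmx_map (f : {lrmorphism A -> A}) k (g : A -> cmx A k) :
  star_preserving f -> alg_map g -> alg_map (fun a => cmx_map f (g a)).
Proof.
move=> fs [gD gM g1 gl]; split.
- move=> c a b; rewrite gD; apply/matrixP => i j; rewrite !mxE.
  by rewrite linearP.
- move=> a b; rewrite gM; apply/matrixP => i j; rewrite !mxE raddf_sum.
  by apply: eq_bigr => l _; rewrite /= rmorphM ![in RHS]mxE.
- rewrite g1; apply/matrixP => i j; rewrite !mxE.
  by case: (i == j); rewrite ?rmorph1 ?raddf0.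
- exact: (cnorm_lip_comp gl (cmx_map_lip k (star_hom_lip fs))).
Qed.

Lemma alg_map_eq (B : cstarType R) (f g : A -> B) : alg_map f -> alg_map g ->
  f x = g x -> f u = g u -> f v = g v -> f y = g y -> f =1 g.
Proof.
move=> [fD fM f1 fl] [gD gM g1 gl] hx hu hv hy.
apply: (closed_ind univ (V := [set a | f a = g a])).
- by apply/norm_closedP => a; apply: adherent_eq => //.
- split=> [|c a b /= ha hb] /=; last by rewrite fD gD ha hb.
  by have := fD (-1) 1 1; have := gD (-1) 1 1; rewrite !scaleN1r !addNr => -> ->.
- by rewrite /= f1.
- move=> e a ge /= ha; rewrite fM gM ha; congr (_ * _).
  by move: e ge; apply: gens_ind.
Qed.

Lemma alg_map0 (B : cstarType R) (f : A -> B) : alg_map f -> f 0 = 0.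
Proof. by move=> [fD _ _ _]; have := fD (-1) 1 1; rewrite !scaleN1r !addNr. Qed.

Lemma cnorm_lip_entry (B : cstarType R) k i j :
  cnorm_lip (fun M : cmx B k => M i j).
Proof.
exists 1 => // M N; rewrite mul1r; have := cnorm_cmx_entry (M - N) i j.
by rewrite !mxE.
Qed.

Lemma cnorm_lipD (B D : cstarType R) (f g : B -> D) :
  cnorm_lip f -> cnorm_lip g -> cnorm_lip (fun b => f b + g b).
Proof.
move=> [C C0 hf] [C' C'0 hg]; exists (C + C'); first exact: addr_gt0.
move=> a b; rewrite opprD addrACA mulrDl.
by apply: le_trans (cnormD _ _) _; apply: lerD.
Qed.

Lemma cnorm_lip_cst (B D : cstarType R) (d : D) : cnorm_lip (fun _ : B => d).
Proof. by exists 1 => // a b; rewrite subrr cnorm0 mul1r cnorm_ge0. Qed.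

Lemma cnorm_lip_id (B : cstarType R) : cnorm_lip (@id B).
Proof. by exists 1 => // a b; rewrite mul1r. Qed.

End AlgebraMaps.

Section Theta.
Context {R : realType} {A : cstarType R} {x u v y : A}.
Hypothesis univ : su_universal x u v y.
Variable psi : {lrmorphism A -> cmx A 1}.
Hypotheses (psis : star_preserving psi) (psix : psi x = psi_mx x v)
  (psiu : psi u = psi_mx u y) (psiv : psi v = psi_mx v x)
  (psiy : psi y = psi_mx y u).

(* The representation rho of psi_exists is its own conjugate: its tensor
   square contains the counit, through the vector with coordinates
   (j == l)%:R. *)
Lemma psi_psi a i k :
  psi (psi a i 0) k 0 + psi (psi a i 1) k 1 = if i == k then a else 0.
Proof.
move: a i k.
suff : forall a, [set a | forall i k,
    psi (psi a i 0) k 0 + psi (psi a i 1) k 1 = if i == k then a else 0] a by [].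
have psil := star_hom_lip psis.
have entry i j : cnorm_lip (fun a => psi a i j).
  by move: (cnorm_lip_comp psil (@cnorm_lip_entry R A 1 i j)).
apply: (closed_ind univ).
- apply/norm_closedP => a ha i k.
  apply: (@adherent_eq R A A (fun a => psi (psi a i 0) k 0 + psi (psi a i 1) k 1)
    (fun a => if i == k then a else 0) _ a _ _ _ ha).
  + by apply: cnorm_lipD; apply: (cnorm_lip_comp (entry _ _) (entry _ _)).
  + by case: (i == k); [exact: cnorm_lip_id|exact: cnorm_lip_cst].
  + by move=> b; apply.
- split=> [|c a b ha hb] i k /=.
    by rewrite !linear0 !mxE !linear0 !mxE addr0 if_same.
  have e j : psi (psi (c *: a + b) i j) k j =
      c *: psi (psi a i j) k j + psi (psi b i j) k j.
    by rewrite linearP cmxD cmxZ linearP cmxD cmxZ.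
  rewrite !e addrACA -scalerDr ha hb; case: (i == k) => //.
  by rewrite scaler0 addr0.
- move=> i k /=; rewrite rmorph1 !cmx1.
  case: (ord2E i) => ->; case: (ord2E k) => -> /=;
    by rewrite ?rmorph1 ?linear0 ?cmx1 ?mxE ?addr0 ?add0r.
- move=> e a ge ha.
  suff he : forall i k, psi (psi e i 0) k 0 + psi (psi e i 1) k 1 =
      if i == k then e else 0.
    move=> i k /=.
    have E j : psi (psi (e * a) i j) k j =
      psi (psi e i 0) k 0 * psi (psi a 0 j) 0 j
      + psi (psi e i 0) k 1 * psi (psi a 0 j) 1 j
      + (psi (psi e i 1) k 0 * psi (psi a 1 j) 0 j
      + psi (psi e i 1) k 1 * psi (psi a 1 j) 1 j).
      by rewrite rmorphM cmxM2 rmorphD cmxD !rmorphM !cmxM2.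
    rewrite !E addrACA [X in X + _]addrACA [X in _ + X]addrACA -!mulrDr.
    have /= h00 := ha 0 0; have /= h01 := ha 0 1.
    have /= h10 := ha 1 0; have /= h11 := ha 1 1.
    rewrite h00 h01 h10 h11 !mulr0 addr0 add0r -mulrDl he.
    by case: (i == k); rewrite ?mul0r.
  move: e ge {ha}; apply: gens_ind => i k;
    rewrite ?psix ?psiu ?psiv ?psiy /psi_mx mk2Z;
    case: (ord2E i) => ->; rewrite !mk2E !linearZ /= ?(linearN, linearD, linearB) /=
      ?psix ?psiu ?psiv ?psiy /psi_mx ?mk2Z ?mk2N ?mk2D ?mk2Z;
    case: (ord2E k) => -> /=; rewrite !mk2E; ncring.
Qed.

Lemma psi_inj a : psi a = 0 -> a = 0.
Proof.
by move=> a0; have := psi_psi a 0 0; rewrite a0 !mxE !linear0 !mxE addr0 => ->.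
Qed.

Definition sgn2 : cmx A 1 := mk2 1 0 0 (-1).
Definition rot2 : cmx A 1 := mk2 0 1 (-1) 0.

Lemma sgn2_sqr : sgn2 * sgn2 = 1.
Proof. by rewrite mk2M mk2_1; apply: mk2_eq; ncring. Qed.

Lemma rot2_inv : rot2 * - rot2 = 1 /\ - rot2 * rot2 = 1.
Proof.
by rewrite /rot2 mk2N !mk2M mk2_1; split; apply: mk2_eq; ncring.
Qed.

Variables (s par : {lrmorphism A -> A}).
Hypotheses (ss : star_preserving s) (sE : [/\ s x = v, s u = y, s v = x & s y = u]).
Hypotheses (pars : star_preserving par)
  (parE : [/\ par x = - x, par u = - u, par v = - v & par y = - y]).

Lemma flipK a : s (s a) = a.
Proof.
have [sx su sv sy] := sE.
move: a; apply: (alg_map_eq univ (f := s \o s) (g := @id A));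
  rewrite /= ?sx ?su ?sv ?sy //.
- by apply: alg_map_comp; apply: alg_map_hom.
- by split=> //; apply: cnorm_lip_id.
Qed.

(** Exchanging p and q in [psi_mx p q] changes the sign of the off-diagonal entries, which is
    conjugation by [sgn2]. Hence psi is diagonal on elements fixed by s. *)
Lemma psi_flip a : psi (s a) = sgn2 * psi a * sgn2.
Proof.
have [sx su sv sy] := sE.
move: a; apply: (alg_map_eq univ (f := psi \o s)).
- by apply: alg_map_comp; apply: alg_map_hom.
- by apply: alg_map_conj; rewrite ?sgn2_sqr //; apply: alg_map_hom.
all: rewrite /= ?sx ?su ?sv ?sy ?psix ?psiu ?psiv ?psiy.
all: by rewrite /psi_mx -scalerAr -scalerAl /sgn2 !mk2M; congr (_ *: _); apply: mk2_eq; ncring.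
Qed.

(** Conjugation by [rot2] changes the sign of a symmetric 2 x 2 matrix of trace 0, and psi maps each
    generator to such a matrix. *)
Lemma psi_par a : psi (par a) = rot2 * psi a * - rot2.
Proof.
have [px pu pv py] := parE.
move: a; apply: (alg_map_eq univ (f := psi \o par)).
- by apply: alg_map_comp; apply: alg_map_hom.
- by apply: alg_map_conj; rewrite ?rot2_inv //; [apply: alg_map_hom|case: rot2_inv..].
all: rewrite /= ?px ?pu ?pv ?py linearN /= ?psix ?psiu ?psiv ?psiy.
all: by rewrite /psi_mx -scalerAr -scalerAl /rot2 mk2N !mk2M -scalerN mk2N; congr (_ *: _); apply: mk2_eq; ncring.
Qed.

Lemma psi_par_entry a i j : psi (par a) i j = par (psi a i j).
Proof.
have [px pu pv py] := parE.
suff h : forall a, psi (par a) = cmx_map par (psi a) :> cmx A 1 by rewrite h mxE.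
move=> {a i j}; apply: (alg_map_eq univ (B := cmx A 1) (f := psi \o par)
  (g := fun a => cmx_map par (psi a))).
- by apply: alg_map_comp; apply: alg_map_hom.
- by apply: alg_map_cmx_map => //; apply: alg_map_hom.
all: rewrite /= ?px ?pu ?pv ?py linearN /= ?psix ?psiu ?psiv ?psiy /psi_mx mk2Z mk2N.
all: apply: cmx2P; rewrite !mk2E mxE !mk2E !linearZ /= ?(linearN, linearD, linearB) /= ?px ?pu ?pv ?py; ncring.
Qed.

Definition theta a : A := psi a 0 0.

Lemma thetaD (c : R[i]) a b : theta (c *: a + b) = c *: theta a + theta b.
Proof. by rewrite /theta linearP cmxD cmxZ. Qed.

Lemma theta_lip : cnorm_lip theta.
Proof. exact: (cnorm_lip_comp (star_hom_lip psis) (@cnorm_lip_entry R A 1 0 0)). Qed.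

Lemma psi_diag b : s b = b -> psi b = mk2 (theta b) 0 0 (psi b 1 1).
Proof.
move=> sb; have := psi_flip b; rewrite sb => h.
have two a : a = - a -> a = 0 :> A.
  move=> /eqP; rewrite -subr_eq0 opprK -mulr2n -scaler_nat scaler_eq0 => /orP[|/eqP//].
  by rewrite pnatr_eq0.
apply: cmx2P; rewrite !mk2E //; apply: two; rewrite {1}h cmxM2 !cmxM2 !mk2E; ncring.
Qed.

Lemma thetaM a b : s a = a -> s b = b -> theta (a * b) = theta a * theta b.
Proof.
move=> sa sb; rewrite /theta rmorphM /= (psi_diag sa) (psi_diag sb) mk2M !mk2E.
by rewrite mul0r addr0.
Qed.

Lemma theta1 : theta 1 = 1. Proof. by rewrite /theta rmorph1 cmx1. Qed.

Lemma theta_star a : theta (star a) = star (theta a).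
Proof. by rewrite /theta psis cmx_starE. Qed.

(** As psi b is diagonal, [psi_psi] gives the first column and the star gives the first row. The
    last entry is the first one conjugated by [rot2], which is where [par] comes from. *)
Lemma psi_theta b : s b = b -> psi (theta b) = mk2 b 0 0 (par b).
Proof.
move=> sb.
have col k c : s c = c -> psi (theta c) k 0 = if 0 == k then c else 0.
  move=> sc; have := psi_psi c 0 k; rewrite {2}(psi_diag sc) mk2E linear0 mxE addr0.
  exact.
have e00 : psi (theta b) 0 0 = b by rewrite col.
apply: cmx2P; rewrite !mk2E.
- by rewrite e00.
- have -> : psi (theta b) 0 1 = star (psi (theta (star b)) 1 0).
    by rewrite theta_star psis cmx_starE starK.
  by rewrite col ?star0 // ss sb.
- by rewrite col.
- have := psi_par_entry (theta b) 0 0; rewrite e00 => <-.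
  rewrite psi_par !cmxM2 /rot2 mk2N !mk2E; ncring.
Qed.

Lemma thetaK b : s b = b -> theta (theta b) = b.
Proof. by move=> sb; rewrite /theta -/(theta b) psi_theta // mk2E. Qed.

Variables (T : cstarType R) (tens : A -> A -> T).
Hypothesis tensP : min_tensor tens.

Let tensC : cstar_tensor tens. Proof. by case: tensP. Qed.

Definition psi_tens (a b : A) : cmx T 1 := \matrix_(i, j) tens (psi a i j) b.

(** The injectivity clause is inherited from [tens] entrywise, because psi is injective. *)
Lemma psi_tens_cstar : cstar_tensor psi_tens.
Proof.
split.
- move=> c a a' b; apply/matrixP => i j; rewrite !mxE.
  by rewrite linearP cmxD cmxZ (tens_linl tensC).
- by move=> c a b b'; apply/matrixP => i j; rewrite !mxE (tens_linr tensC).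
- move=> a a' b b'; apply/matrixP => i j; rewrite !mxE rmorphM cmxM (tens_suml tensC).
  by apply: eq_bigr => l _; rewrite !mxE (tens_mul tensC).
- apply/matrixP => i j; rewrite !mxE rmorph1 cmx1.
  by case: (i == j); rewrite ?(tens_one tensC) ?(tens0l tensC).
- move=> a b; apply/matrixP => i j; rewrite !mxE (tens_star tensC) psis.
  by rewrite cmx_starE.
- move=> k a b bi h i; apply: psi_inj; apply/matrixP => p q; rewrite mxE.
  apply: (tens_inj tensC (a := fun i => psi (a i) p q) bi).
  have : (\sum_i psi_tens (a i) (b i)) p q = 0 by rewrite h mxE.
  by rewrite summxE; under eq_bigr do rewrite mxE.
Qed.

Lemma par_par a : par (par a) = a.
Proof.
have [px pu pv py] := parE.
move: a; apply: (alg_map_eq univ (f := par \o par) (g := @id A));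
  rewrite /= ?px ?pu ?pv ?py ?linearN /= ?px ?pu ?pv ?py ?opprK //.
- by apply: alg_map_comp; apply: alg_map_hom.
- by split=> //; apply: cnorm_lip_id.
Qed.

Lemma par_tens_cstar : cstar_tensor (fun a b => tens (par a) b).
Proof.
split.
- by move=> c a a' b; rewrite linearP (tens_linl tensC).
- by move=> c a b b'; rewrite (tens_linr tensC).
- by move=> a a' b b'; rewrite rmorphM (tens_mul tensC).
- by rewrite rmorph1 (tens_one tensC).
- by move=> a b; rewrite (tens_star tensC) pars.
- move=> k a b bi h i; rewrite -[a i]par_par.
  by rewrite (tens_inj tensC (a := fun i => par (a i)) bi h) raddf0.
Qed.

(** Minimality is compared with the norm twisted by [par], and [par] is an involution. *)
Lemma par_tens_bound r : cnorm (\sum_(p <- r) tens (par p.1) p.2) <= cnorm (tsum tens r).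
Proof.
have := min_tensor_le [seq (par p.1, p.2) | p <- r] tensP par_tens_cstar.
rewrite /tsum !big_map /=.
by under [X in _ <= cnorm X -> _]eq_bigr do rewrite par_par.
Qed.

(** Minimality bounds the left side by the norm of the diagonal matrix with entries a (x) b and par
    a (x) b, summed over the list. The constant 2 comes from estimating this norm by the sum of
    those of the two entries. *)
Lemma theta_tens_bound r : (forall p, p \in r -> s p.1 = p.1) ->
  cnorm (\sum_(p <- r) tens (theta p.1) p.2) <= 2 * cnorm (tsum tens r).
Proof.
move=> sr; have := min_tensor_le [seq (theta p.1, p.2) | p <- r] tensP psi_tens_cstar.
rewrite /tsum !big_map /= => /le_trans; apply.
have -> : \sum_(p <- r) psi_tens (theta p.1) p.2 =
    mk2 (tsum tens r) 0 0 (\sum_(p <- r) tens (par p.1) p.2).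
  have E i j : (\sum_(p <- r) psi_tens (theta p.1) p.2) i j =
      \sum_(p <- r) tens (mk2 p.1 0 0 (par p.1) i j) p.2.
    rewrite summxE big_seq [RHS]big_seq; apply: eq_bigr => p /sr sp.
    by rewrite mxE psi_theta.
  apply: cmx2P; rewrite E !mk2E; under eq_bigr do rewrite mk2E //.
  - by [].
  - by rewrite big1 // => p _; rewrite (tens0l tensC).
  - by rewrite big1 // => p _; rewrite (tens0l tensC).
  - by [].
apply: le_trans (cnorm_cmx_le _) _.
rewrite !big_ord_recl !big_ord0 !addr0.
have -> : lift ord0 ord0 = 1 :> 'I_2 by apply: val_inj.
rewrite !mk2E !cnorm0 addr0 add0r mulr2n mulrDl mul1r.
by rewrite lerD2l par_tens_bound.
Qed.

End Theta.

Lemma cont_adherent_eq (R : realType) (A B D : cstarType R) (h : A -> D) (W : set D)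
    (S : D -> B) (g : A -> B) (V : set A) a :
  cont_linear_on W S -> cnorm_lip h -> cnorm_lip g ->
  (forall b, V b -> W (h b)) -> W (h a) ->
  (forall b, V b -> S (h b) = g b) -> adherent V a -> S (h a) = g a.
Proof.
move=> [Sl Sc] hl gl VW Wa VE /adherent_seq[z zV za].
have zlim (B' : cstarType R) (f : A -> B') : cnorm_lip f -> cvg_cnorm (f \o z) (f a).
  move=> [C C0 fC]; apply/cvg_cnormP => e e0.
  have [|N hN] := @inv_nat_small R (C^-1 * e); first by rewrite mulr_gt0 ?invr_gt0.
  exists N => k Nk; apply: le_lt_trans (fC _ _) _; rewrite -ltr_pdivlMl // cnormBC.
  exact: lt_trans (za k) (hN k Nk).
have /cvg_cnormP c1 := Sc _ _ (fun k => VW _ (zV k)) Wa (zlim _ h hl).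
have /cvg_cnormP c2 := zlim _ g gl.
apply/eqP; rewrite -subr_eq0; apply/eqP; apply: cnorm_small => e e0.
have e20 : 0 < e / 2 by rewrite divr_gt0.
have [N1 h1] := c1 _ e20; have [N2 h2] := c2 _ e20.
pose N := maxn N1 N2.
rewrite [e]splitr; apply: le_trans (cnorm_triangle _ (S (h (z N))) _) _.
apply: lerD; first by rewrite cnormBC ltW // h1 ?leq_maxl.
by rewrite VE //; apply/ltW/h2; rewrite leq_maxr.
Qed.

(** * Coproduct and invariants of D_n *)

Section RootsOfUnity.
Context {R : realType}.

Lemma primitive_root_exists N : (0 < N)%N -> exists z : R[i], N.-primitive_root z.
Proof.
move=> N0; pose p : {poly R[i]} := 'X^N - 1.
have [r Dp] := closed_field_poly_normal p.
rewrite (monicP _) ?monicXnsubC // scale1r in Dp.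
have rn1 : all N.-unity_root r by apply/allP => z; rewrite -root_prod_XsubC -Dp.
have sz_r : (N < (size r).+1)%N by rewrite -(size_prod_XsubC r id) -Dp size_XnsubC.
have [|z] := hasP (has_prim_root N0 rn1 _ sz_r); last by exists z.
by rewrite -separable_prod_XsubC -Dp separable_Xn_sub_1 // pnatr_eq0 -lt0n.
Qed.

Lemma unity_conj N (z : R[i]) : (0 < N)%N -> z ^+ N = 1 -> z * Num.conj z = 1.
Proof.
move=> N0 zn; have : `|z| ^+ N = 1 by rewrite -normrX zn normr1.
move/eqP; rewrite pexpr_eq1 ?normr_ge0 // => /eqP h.
by rewrite -normCK h expr1n.
Qed.

Lemma sum_unity_powers N (z : R[i]) : z ^+ N = 1 ->
  \sum_(j < N) z ^+ j = if z == 1 then N%:R else 0.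
Proof.
move=> zN; case: eqVneq => [->|z1].
  by under eq_bigr do rewrite expr1n; rewrite sumr_const card_ord.
apply: (mulfI (_ : z - 1 != 0)); first by rewrite subr_eq0.
by rewrite mulr0 -subrX1 zN subrr.
Qed.

Lemma prim_root_conj_eq1 N (z : R[i]) k l : N.-primitive_root z ->
  (z ^+ k * Num.conj z ^+ l == 1) = (k == l %[mod N]).
Proof.
move=> zP; have N0 := prim_order_gt0 zP.
have zz : z * Num.conj z = 1 := unity_conj N0 (prim_expr_order zP).
rewrite -(eq_prim_root_expr zP).
have zl : z ^+ l * Num.conj z ^+ l = 1 by rewrite -exprMn zz expr1n.
apply/eqP/eqP => [h|->//].
by rewrite -[LHS]mulr1 -zl mulrCA h mulr1.
Qed.

End RootsOfUnity.

(** * Coproducts of polynomials, covariant maps and translations *)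

Section Coproduct.
Context {R : realType} {A T : cstarType R} {x u v y : A} {tens : A -> A -> T}
  {delta : {lrmorphism A -> T}}.
Hypotheses (univ : su_universal x u v y) (tensP : min_tensor tens)
  (deltaP : su_coproduct tens x u v y delta).

Let tensC : cstar_tensor tens. Proof. by case: tensP. Qed.
Let dx : delta x = tens x x + tens u v. Proof. by case: deltaP => _ []. Qed.
Let du : delta u = tens x u + tens u y. Proof. by case: deltaP => _ []. Qed.
Let dv : delta v = tens v x + tens y v. Proof. by case: deltaP => _ []. Qed.
Let dy : delta y = tens v u + tens y y. Proof. by case: deltaP => _ []. Qed.
Let deltas : star_preserving delta. Proof. by case: deltaP. Qed.

(* (delta (x) id) phi = (phi (x) id) delta, stated on the generators. *)
Definition covariant_map (phi : A -> cmx A 1) : Prop := alg_map phi /\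
  forall i j, [/\ delta (phi x i j) = tens (phi x i j) x + tens (phi u i j) v,
    delta (phi u i j) = tens (phi x i j) u + tens (phi u i j) y,
    delta (phi v i j) = tens (phi v i j) x + tens (phi y i j) v &
    delta (phi y i j) = tens (phi v i j) u + tens (phi y i j) y].

(** g = (chi (x) id) delta, stated on the generators. *)
Definition translation (chi : A -> R[i]) (g : A -> A) : Prop := alg_map g /\
  [/\ g x = chi x *: x + chi u *: v, g u = chi x *: u + chi u *: y,
      g v = chi v *: x + chi y *: v & g y = chi v *: u + chi y *: y].

(** A single list computes delta a and, at the same time, its images under all covariant maps and
    all characters. This is what a comparison of two covariant maps requires, and what
    coassociativity would otherwise provide. *)
Definition coproduct_sum (a : A) (r : seq (A * A)) : Prop :=
  [/\ tseq (polys (gens (x := x) (u := u) (v := v) (y := y))) r,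
      delta a = tsum tens r,
      forall phi, covariant_map phi -> forall i j,
        delta (phi a i j) = \sum_(p <- r) tens (phi p.1 i j) p.2 &
      forall chi g, character chi -> translation chi g ->
        g a = \sum_(p <- r) chi p.1 *: p.2].

Let G := gens (x := x) (u := u) (v := v) (y := y).

Lemma coproduct_sum_gen e : G e -> exists r, coproduct_sum e r.
Proof.
have two (a b c d : A) : G a -> G c -> tseq (polys G) [:: (a, b); (c, d)].
  by move=> Ga Gc p; rewrite !inE => /orP[]/eqP->; apply: polys_gen.
move: e; apply: gens_ind.
- exists [:: (x, x); (u, v)]; split.
  + by apply: two; [exact: gens_x|exact: gens_u].
  + by rewrite /tsum big_cons big_seq1.
  + by move=> phi [_ h] i j; rewrite big_cons big_seq1; case: (h i j).
  + by move=> chi g _ [_ []]; rewrite big_cons big_seq1.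
- exists [:: (x, u); (u, y)]; split.
  + by apply: two; [exact: gens_x|exact: gens_u].
  + by rewrite /tsum big_cons big_seq1.
  + by move=> phi [_ h] i j; rewrite big_cons big_seq1; case: (h i j).
  + by move=> chi g _ [_ []]; rewrite big_cons big_seq1.
- exists [:: (v, x); (y, v)]; split.
  + by apply: two; [exact: gens_v|exact: gens_y].
  + by rewrite /tsum big_cons big_seq1.
  + by move=> phi [_ h] i j; rewrite big_cons big_seq1; case: (h i j).
  + by move=> chi g _ [_ []]; rewrite big_cons big_seq1.
- exists [:: (v, u); (y, y)]; split.
  + by apply: two; [exact: gens_v|exact: gens_y].
  + by rewrite /tsum big_cons big_seq1.
  + by move=> phi [_ h] i j; rewrite big_cons big_seq1; case: (h i j).
  + by move=> chi g _ [_ []]; rewrite big_cons big_seq1.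
Qed.

Definition tprod (r r' : seq (A * A)) :=
  [seq (p.1 * q.1, p.2 * q.2) | p <- r, q <- r'].

Lemma sum_tprod (B : cstarType R) (f : A -> A -> B) r r' :
  \sum_(p <- tprod r r') f p.1 p.2 =
  \sum_(p <- r) \sum_(q <- r') f (p.1 * q.1) (p.2 * q.2).
Proof. by rewrite big_allpairs_dep. Qed.

Lemma coproduct_sum_mul a b r r' : coproduct_sum a r -> coproduct_sum b r' ->
  coproduct_sum (a * b) (tprod r r').
Proof.
move=> [Pr da cova tra] [Pr' db covb trb]; split.
- move=> p /allpairsP[[p1 p2] /= [/Pr h1 /Pr' h2 ->]] /=; exact: polys_mul.
- rewrite rmorphM /= da db /tsum sum_tprod mulr_suml; apply: eq_bigr => p _.
  by rewrite mulr_sumr; apply: eq_bigr => q _; rewrite (tens_mul tensC).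
- move=> phi cov i j; have [[_ phiM _ _] _] := cov.
  rewrite (sum_tprod (fun a b => tens (phi a i j) b)) phiM cmxM2 rmorphD !rmorphM /=.
  have E l : delta (phi a i l) * delta (phi b l j) = \sum_(p <- r) \sum_(q <- r')
      tens (phi p.1 i l * phi q.1 l j) (p.2 * q.2).
    rewrite cova // covb // mulr_suml; apply: eq_bigr => p _.
    by rewrite mulr_sumr; apply: eq_bigr => q _; rewrite (tens_mul tensC).
  rewrite !E -big_split; apply: eq_bigr => p _; rewrite -big_split.
  by apply: eq_bigr => q _; rewrite phiM cmxM2 (tensDl tensC).
- move=> chi g chiP trg; have [[_ gM _ _] _] := trg; have [_ chiM _ _] := chiP.
  rewrite gM (tra chi g) // (trb chi g) //.
  rewrite (sum_tprod (fun a b => chi a *: b)) mulr_suml.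
  apply: eq_bigr => p _; rewrite mulr_sumr; apply: eq_bigr => q _.
  by rewrite chiM -scalerAl -scalerAr scalerA.
Qed.

Lemma coproduct_sum_exists a : polys G a -> exists r, coproduct_sum a r.
Proof.
suff h : polys G `<=` [set a | exists r, coproduct_sum a r] by move=> /h.
move=> {a}; have Ps : Defs.subspace (polys G) := @lspan_subspace R A _.
apply: lspan_sub; first split.
- exists [::]; split=> //=.
  + by rewrite raddf0 /tsum big_nil.
  + move=> phi [phiA _] i j; rewrite big_nil alg_map0 // mxE.
    exact: raddf0.
  + by move=> chi g _ [gA _]; rewrite big_nil alg_map0.
- move=> c a b [r [Pr da cova tra]] [r' [Pr' db covb trb]].
  exists (tscale c r ++ r'); split.
  + by apply: tseq_cat => //; apply: tseq_scale.
  + by rewrite linearP /= da db tsum_cat (tsum_scale tensC).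
  + move=> phi cov i j; have [[phiD _ _ _] _] := cov.
    rewrite phiD cmxD cmxZ linearP /= cova // covb // big_cat big_map /=; congr (_ + _).
    rewrite scaler_sumr; apply: eq_bigr => p _.
    have -> : phi (c *: p.1) = c *: phi p.1.
      by rewrite -[c *: p.1]addr0 phiD (alg_map0 (proj1 cov)) addr0.
    by rewrite cmxZ (tensZl tensC).
  + move=> chi g chiP trg; have [[gD _ _ _] _] := trg; have [chiD _ _ _] := chiP.
    rewrite gD (tra chi g) // (trb chi g) // big_cat big_map /=; congr (_ + _).
    rewrite scaler_sumr; apply: eq_bigr => p _.
    have chi0 : chi 0 = 0.
      by have := chiD (-1) 0 0; rewrite scaleN1r oppr0 addr0 mulN1r addNr.
    by rewrite -[c *: p.1]addr0 chiD chi0 addr0 scalerA.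
- move=> w; elim=> [|e w' Ge _ [r hr]] /=.
  + exists [:: (1, 1)]; split.
    * by move=> p; rewrite inE => /eqP->; apply: polys1.
    * by rewrite rmorph1 /tsum big_seq1 (tens_one tensC).
    * move=> phi [[_ _ phi1 _] _] i j; rewrite big_seq1 /= phi1 cmx1.
      by case: (i == j); rewrite ?rmorph1 ?(tens_one tensC) // raddf0 (tens0l tensC).
    * by move=> chi g [_ _ chi1 _] [[_ _ g1 _] _]; rewrite big_seq1 /= chi1 g1 scale1r.
  + by have [r' hr'] := coproduct_sum_gen Ge; exists (tprod r' r); apply: coproduct_sum_mul.
Qed.

Lemma slice_coproduct chi g S a : character chi -> translation chi g ->
  is_slice tens chi S -> S (delta a) = g a.
Proof.
move=> chiP trg sl; have [Sc _] := sl; have [[_ _ _ gl] _] := trg.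
apply: (cont_adherent_eq Sc (star_hom_lip deltas) gl _ _ _ (polys_dense univ a)) => //.
move=> b /coproduct_sum_exists[r [_ db _ trb]].
by rewrite db (slice_tsum _ sl) (trb chi g).
Qed.

(** Scalar matrices turn maps into A into matrix-valued ones, so that the identity and psi fall
    under one notion. *)
Lemma covariant_scalar (g : A -> A) : alg_map g ->
  [/\ delta (g x) = tens (g x) x + tens (g u) v,
    delta (g u) = tens (g x) u + tens (g u) y,
    delta (g v) = tens (g v) x + tens (g y) v &
    delta (g y) = tens (g v) u + tens (g y) y] ->
  covariant_map (fun a => mk2 (g a) 0 0 (g a)).
Proof.
move=> [gD gM g1 gl] [hx hu hv hy]; split.
  split.
  - move=> c a b; rewrite gD mk2Z mk2D; apply: mk2_eq; ncring.
  - by move=> a b; rewrite gM mk2M; apply: mk2_eq; ncring.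
  - by rewrite g1 mk2_1.
  - have [C C0 hC] := gl; exists (C + C); first exact: addr_gt0.
    move=> a b; apply: le_trans (cnorm_cmx_le _) _.
    rewrite !big_ord_recl !big_ord0 !addr0.
    have -> : lift ord0 ord0 = 1 :> 'I_2 by apply: val_inj.
    rewrite !cmxD !cmxN !mk2E subrr !cnorm0 addr0 add0r mulrDl.
    by apply: lerD.
by move=> i j; case: (ord2E i) => ->; case: (ord2E j) => ->; rewrite !mk2E;
  split; rewrite ?raddf0 ?(tens0l tensC) ?addr0.
Qed.

Lemma covariant_psi (psi : {lrmorphism A -> cmx A 1}) : star_preserving psi ->
  psi x = psi_mx x v -> psi u = psi_mx u y -> psi v = psi_mx v x ->
  psi y = psi_mx y u -> covariant_map psi.
Proof.
move=> psis px pu pv py; split; first exact: alg_map_hom.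
move=> i j; rewrite px pu pv py /psi_mx !mk2Z.
case: (ord2E i) => ->; case: (ord2E j) => ->; rewrite !mk2E; split.
all: rewrite linearZ /= ?(linearN, linearD) /= ?linearN /= ?dx ?du ?dv ?dy.
all: rewrite ?(tensZl tensC, tensDl tensC, tensNl tensC, tensDl tensC, tensNl tensC); ncring.
Qed.

Lemma covariant_comp phi (g : A -> A) (z w : R[i]) : covariant_map phi -> alg_map g ->
  [/\ g x = z *: x, g u = z *: u, g v = w *: v & g y = w *: y] ->
  covariant_map (phi \o g).
Proof.
move=> [phiA cov] gA [gx gu gv gy]; split; first exact: alg_map_comp.
have phiZ c a : phi (c *: a) = c *: phi a.
  have [phiD _ _ _] := phiA.
  by rewrite -[c *: a]addr0 phiD (alg_map0 phiA) addr0.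
move=> i j /=; have [hx hu hv hy] := cov i j.
rewrite gx gu gv gy !phiZ !cmxZ !linearZ /= hx hu hv hy.
by split; rewrite !(tensZl tensC) scalerDr.
Qed.

Lemma covariant_flip phi (g : A -> A) : covariant_map phi -> alg_map g ->
  [/\ g x = v, g u = y, g v = x & g y = u] -> covariant_map (phi \o g).
Proof.
move=> [phiA cov] gA [gx gu gv gy]; split; first exact: alg_map_comp.
move=> i j /=; have [hx hu hv hy] := cov i j; rewrite gx gu gv gy hx hu hv hy.
by split; rewrite // addrC.
Qed.

Variables (s : {lrmorphism A -> A}) (rot : R[i] -> {lrmorphism A -> A}) (n : nat).
Hypotheses (ss : star_preserving s) (sE : [/\ s x = v, s u = y, s v = x & s y = u]).
Hypothesis rotP : forall z, z * Num.conj z = 1 -> star_preserving (rot z) /\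
  [/\ rot z x = z *: x, rot z u = z *: u, rot z v = Num.conj z *: v &
      rot z y = Num.conj z *: y].
Hypothesis n0 : (0 < n)%N.

Definition fixed_by_Dn : set A :=
  [set b | s b = b /\ forall z, z ^+ n = 1 -> rot z b = b].

Lemma conj_unity (z : R[i]) : z ^+ n = 1 -> Num.conj z ^+ n = 1.
Proof. by move=> zn; rewrite -rmorphXn zn rmorph1. Qed.

Lemma translation_rot chi z : z * Num.conj z = 1 ->
  [/\ chi x = z, chi u = 0, chi v = 0 & chi y = Num.conj z] ->
  translation chi (rot z).
Proof.
move=> zz [cx cu cv cy]; have [rs [rx ru rv ry]] := rotP zz.
split; first exact: alg_map_hom.
by rewrite cx cu cv cy rx ru rv ry !scale0r !addr0 !add0r.
Qed.

Lemma translation_flip chi z : z * Num.conj z = 1 ->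
  [/\ chi x = 0, chi u = Num.conj z, chi v = z & chi y = 0] ->
  translation chi (s \o rot (Num.conj z)).
Proof.
move=> zz [cx cu cv cy]; have [|rs [rx ru rv ry]] := @rotP (Num.conj z).
  by rewrite conjCK mulrC.
have [sx su sv sy] := sE; split.
  by apply: alg_map_comp; apply: alg_map_hom.
by rewrite /= cx cu cv cy rx ru rv ry !linearZ /= sx su sv sy conjCK !scale0r !addr0 !add0r.
Qed.

Lemma mx22_inj (a b c d a' b' c' d' : R[i]) :
  mx22 a b c d = mx22 a' b' c' d' -> [/\ a = a', b = b', c = c' & d = d'].
Proof.
move=> /matrixP h; have := h 0 0; have := h 0 1; have := h 1 0; have := h 1 1.
by rewrite !mxE.
Qed.

Lemma Dn_quotientE : Dn_quotient tens x u v y delta n = fixed_by_Dn.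
Proof.
apply/seteqP; split=> b.
- move=> hb; split.
  + have one1 : 1 * Num.conj 1 = 1 :> R[i] by rewrite rmorph1 mulr1.
    have [chi [chiP chiE]] := flip_character_exists univ one1.
    have [|S sl Sb] := hb chi chiP.
      by case: chiE => -> -> -> ->; exists 1; rewrite ?expr1n //; right.
    have rot1 a : rot 1 a = a.
      have [rs [rx ru rv ry]] := rotP one1; move: a.
      apply: (alg_map_eq univ (f := rot 1) (g := id)); rewrite ?rx ?ru ?rv ?ry ?rmorph1 ?scale1r //.
      * exact: alg_map_hom.
      * by split=> //; apply: cnorm_lip_id.
    rewrite -{2}Sb (slice_coproduct _ chiP (translation_flip one1 chiE) sl) /=.
    by rewrite rmorph1 rot1.
  + move=> z zn; have zz := unity_conj n0 zn.
    have [chi [chiP chiE]] := rot_character_exists univ zz.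
    have [|S sl {2}<-] := hb chi chiP.
      by case: chiE => -> -> -> ->; exists z => //; left.
    by rewrite (slice_coproduct _ chiP (translation_rot zz chiE) sl).
- move=> [sb rb] chi chiP [z zn chiE]; have zz := unity_conj n0 zn.
  (* Membership demands that a slice map exist, so in this direction it has to be constructed. *)
  have [_ dense _] := tensP; have [S sl] := slice_exists tensC dense chiP.
  exists S => //; case: chiE => /mx22_inj chiE.
  + by rewrite (slice_coproduct _ chiP (translation_rot zz chiE) sl) rb.
  + by rewrite (slice_coproduct _ chiP (translation_flip zz chiE) sl) /= rb ?sb // conj_unity.
Qed.

End Coproduct.

(** * Generators of the invariants *)

Section WordLength.
Context {R : realType} {A : cstarType R}.
Implicit Types a b w : A.

Inductive wlen (a b : A) : nat -> A -> Prop :=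
  | wlen0 : wlen a b 0 1
  | wlen_l k w : wlen a b k w -> wlen a b k.+1 (a * w)
  | wlen_r k w : wlen a b k w -> wlen a b k.+1 (b * w).

Lemma wlen1l a b : wlen a b 1 a.
Proof. by rewrite -[X in wlen _ _ _ X]mulr1; apply/wlen_l/wlen0. Qed.

Lemma wlen1r a b : wlen a b 1 b.
Proof. by rewrite -[X in wlen _ _ _ X]mulr1; apply/wlen_r/wlen0. Qed.

Lemma wlen_mul a b k l w w' :
  wlen a b k w -> wlen a b l w' -> wlen a b (k + l) (w * w').
Proof.
move=> hw hw'; elim: hw => [|k' w1 _ IH|k' w1 _ IH]; first by rewrite mul1r.
  by rewrite addSn -mulrA; apply: wlen_l.
by rewrite addSn -mulrA; apply: wlen_r.
Qed.

Lemma wlen_split a b k l w : wlen a b (k + l) w ->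
  exists w1 w2, [/\ wlen a b k w1, wlen a b l w2 & w = w1 * w2].
Proof.
elim: k w => [|k IH] w; first by exists 1, w; split; [exact: wlen0| |rewrite mul1r].
rewrite addSn => h; inversion h as [|k' w' hw|k' w' hw]; subst.
  by have [w1 [w2 [h1 h2 ->]]] := IH _ hw; exists (a * w1), w2; split; [exact: wlen_l| |rewrite mulrA].
by have [w1 [w2 [h1 h2 ->]]] := IH _ hw; exists (b * w1), w2; split; [exact: wlen_r| |rewrite mulrA].
Qed.

Lemma wlen_snoc a b k w : wlen a b k.+1 w ->
  exists2 w', wlen a b k w' & w = w' * a \/ w = w' * b.
Proof.
rewrite -addn1 => /wlen_split[w1 [w2 [h1 h2 ->]]]; exists w1 => //.
inversion h2 as [|k' w' hw|k' w' hw]; subst; inversion hw; subst; rewrite mulr1.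
  by left.
by right.
Qed.

Lemma wlen_hom (f : {lrmorphism A -> A}) a b k w :
  wlen a b k w -> wlen (f a) (f b) k (f w).
Proof.
elim=> [|k' w' _ IH|k' w' _ IH]; first by rewrite rmorph1; apply: wlen0.
  by rewrite rmorphM; apply: wlen_l.
by rewrite rmorphM; apply: wlen_r.
Qed.

Lemma wlen_hom_scale (f : {lrmorphism A -> A}) (z : R[i]) a b k w :
  f a = z *: a -> f b = z *: b -> wlen a b k w -> f w = z ^+ k *: w.
Proof.
move=> fa fb; elim=> [|k' w' _ IH|k' w' _ IH].
- by rewrite rmorph1 expr0 scale1r.
- by rewrite rmorphM /= fa IH -scalerAr -scalerAl scalerA -exprSr.
- by rewrite rmorphM /= fb IH -scalerAr -scalerAl scalerA -exprSr.
Qed.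

Definition qcomm a b := exists c : R[i], a * b = c *: (b * a).

Lemma qcommMl a b d : qcomm a d -> qcomm b d -> qcomm (a * b) d.
Proof.
move=> [c ad] [c' bd]; exists (c * c').
by rewrite -mulrA bd -scalerAr [a * (d * b)]mulrA ad -scalerAl scalerA mulrA [c' * c]mulrC.
Qed.

Lemma qcommMr a b d : qcomm d a -> qcomm d b -> qcomm d (a * b).
Proof.
move=> [c da] [c' db]; exists (c * c').
by rewrite [d * (a * b)]mulrA da -scalerAl -[a * d * b]mulrA db -scalerAr scalerA mulrA.
Qed.

Lemma qcomm1l a : qcomm 1 a.
Proof. by exists 1; rewrite mulr1 mul1r scale1r. Qed.

Lemma qcomm1r a : qcomm a 1.
Proof. by exists 1; rewrite mulr1 mul1r scale1r. Qed.

Lemma wlen_qcomm a b c d k l w w' : qcomm a c -> qcomm a d -> qcomm b c ->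
  qcomm b d -> wlen a b k w -> wlen c d l w' -> qcomm w w'.
Proof.
move=> ac ad bc bd hw hw'.
have letter e : qcomm e c -> qcomm e d -> qcomm e w'.
  move=> ec ed; elim: hw' => [|k' w1 _ IH|k' w1 _ IH]; first exact: qcomm1r.
    exact: qcommMr.
  exact: qcommMr.
elim: hw => [|k' w1 _ IH|k' w1 _ IH]; first exact: qcomm1l.
  by apply: qcommMl => //; apply: letter.
by apply: qcommMl => //; apply: letter.
Qed.

Lemma wlen_normal a b k w : qcomm b a -> wlen a b k w ->
  exists2 l, (l <= k)%N & exists c : R[i], w = c *: (a ^+ (k - l) * b ^+ l).
Proof.
move=> ba; elim=> [|k' w' _ [l lk [c ->]]|k' w' _ [l lk [c ->]]].
- by exists 0%N => //; exists 1; rewrite !expr0 mulr1 scale1r.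
- exists l; first exact: leqW.
  by exists c; rewrite -scalerAr mulrA -exprS subSn.
- exists l.+1 => //; rewrite subSS.
  have [d hd] : qcomm b (a ^+ (k' - l)).
    by elim: (k' - l)%N => [|m IH]; [exact: qcomm1r|rewrite exprS; apply: qcommMr].
  by exists (c * d); rewrite -scalerAr mulrA hd -scalerAl -mulrA -exprS scalerA.
Qed.

End WordLength.

(** * Shortening words by products of invariants *)

Section Generation.
Context {R : realType} {A : cstarType R} {x u v y : A}.
Hypothesis univ : su_universal x u v y.
Variables (s : {lrmorphism A -> A}).
Hypotheses (ss : star_preserving s) (sE : [/\ s x = v, s u = y, s v = x & s y = u]).

Let rel := proj1 univ.
Let ux : u * x = - (x * u). Proof. exact: su_ux rel. Qed.
Let vx : v * x = - (x * v). Proof. exact: su_vx rel. Qed.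
Let uy : u * y = - (y * u). Proof. exact: su_uy rel. Qed.
Let vy : v * y = - (y * v). Proof. exact: su_vy rel. Qed.
Let uv : u * v = v * u. Proof. exact: su_uv rel. Qed.
Let xyuv : x * y + u * v = 1. Proof. exact: su_xy rel. Qed.
Let yxuv : y * x + u * v = 1. Proof. exact: su_yx rel. Qed.
Let xyC : x * y = y * x. Proof. by apply: (addIr (u * v)); rewrite xyuv yxuv. Qed.
Let sx : s x = v. Proof. by case: sE. Qed.
Let su : s u = y. Proof. by case: sE. Qed.
Let sv : s v = x. Proof. by case: sE. Qed.
Let sy : s y = u. Proof. by case: sE. Qed.
Let sK : forall a, s (s a) = a := flipK univ ss sE.

Let qneg (a b : A) : a * b = - (b * a) -> qcomm a b.
Proof. by move=> h; exists (-1); rewrite scaleN1r. Qed.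
Let qpos (a b : A) : a * b = b * a -> qcomm a b.
Proof. by move=> h; exists 1; rewrite scale1r. Qed.
Let qxv : qcomm x v. Proof. by apply: qneg; rewrite vx opprK. Qed.
Let qxy : qcomm x y. Proof. exact: qpos. Qed.
Let quv : qcomm u v. Proof. exact: qpos. Qed.
Let quy : qcomm u y. Proof. exact: qneg. Qed.
Let qvx : qcomm v x. Proof. exact: qneg. Qed.
Let qyx : qcomm y x. Proof. by apply: qpos; rewrite xyC. Qed.
Let qvu : qcomm v u. Proof. by apply: qpos; rewrite uv. Qed.
Let qyu : qcomm y u. Proof. by apply: qneg; rewrite uy opprK. Qed.

Local Notation L := (wlen x u).
Local Notation L' := (wlen v y).

Lemma wlen_flip k w : L k w -> L' k (s w).
Proof. by move=> /(wlen_hom s); rewrite sx su. Qed.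

Lemma wlen_flip' k w : L' k w -> L k (s w).
Proof. by move=> /(wlen_hom s); rewrite sv sy. Qed.

(** Words of bidegree (k, l). Letters of the two kinds commute up to sign, so every word can be
    sorted in this way; rotation by z multiplies such a word by z^k times the l-th power of the
    conjugate of z. *)
Definition wset k l : set A := [set w | exists q q', [/\ L k q, L' l q' & w = q * q']].
Definition wspan k l : set A := lspan (wset k l).

Lemma wspan_subspace k l : Defs.subspace (wspan k l).
Proof. exact: lspan_subspace. Qed.

Lemma wspan_flip k l w : wspan k l w -> wspan l k (s w).
Proof.
move: w; suff : wspan k l `<=` [set w | wspan l k (s w)] by [].
have [W0 WD] := wspan_subspace l k.
apply: lspan_sub.
  by split=> [|c a b ha hb] /=; rewrite ?raddf0 // linearP; apply: WD.
move=> _ [q [q' [hq hq' ->]]] /=; rewrite rmorphM /=.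
have [c ->] : qcomm (s q) (s q').
  exact: (wlen_qcomm qvx qvu qyx qyu (wlen_flip hq) (wlen_flip' hq')).
apply: (subspaceZ _ (wspan_subspace _ _)).
by apply: sub_lspan; exists (s q'), (s q); split; [exact: wlen_flip'|exact: wlen_flip|].
Qed.

Lemma wspan_mul k l k' l' w w' : wspan k l w -> wspan k' l' w' ->
  wspan (k + k') (l + l') (w * w').
Proof.
apply: lspan_mul; first exact: wspan_subspace.
move=> _ _ [q [q' [hq hq' ->]]] [p [p' [hp hp' ->]]].
have [c hc] : qcomm q' p by apply: wlen_qcomm hq' hp.
rewrite mulrA -[q * q' * p]mulrA hc -scalerAr -scalerAl.
apply: (subspaceZ _ (wspan_subspace _ _)).
apply: sub_lspan; exists (q * p), (q' * p'); split; try exact: wlen_mul.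
by rewrite !mulrA.
Qed.

(** Insert 1 = x y + u v between the two halves of the word. *)
Lemma wspanS k l w : wspan k l w -> wspan k.+1 l.+1 w.
Proof.
move: w; apply: lspan_sub; first exact: wspan_subspace.
move=> _ [q [q' [hq hq' ->]]].
have -> : q * q' = (q * x) * (y * q') + (q * u) * (v * q').
  by rewrite -[q in LHS]mulr1 -xyuv; ncring.
have h e e' : L 1 e -> L' 1 e' -> wspan k.+1 l.+1 ((q * e) * (e' * q')).
  move=> he he'; apply: sub_lspan; exists (q * e), (e' * q'); split=> //.
    by rewrite -addn1; apply: wlen_mul.
  by rewrite -add1n; apply: wlen_mul.
apply: (subspaceD (wspan_subspace _ _)).
  by apply: h; [exact: wlen1l|exact: wlen1r].
by apply: h; [exact: wlen1r|exact: wlen1l].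
Qed.

Lemma wspan_le k l m w : wspan k l w -> wspan (m + k) (m + l) w.
Proof. by move=> h; elim: m => [|m IH] //; rewrite !addSn; apply: wspanS. Qed.

Definition sym a : A := a + s a.

Lemma symM a b : sym a * sym b = sym (a * b) + sym (a * s b).
Proof. by rewrite /sym !rmorphM /= sK; ncring. Qed.

Lemma sym_flip a : sym (s a) = sym a.
Proof. by rewrite /sym sK addrC. Qed.

Lemma symD (c : R[i]) a b : sym (c *: a + b) = c *: sym a + sym b.
Proof. by rewrite /sym linearP scalerDr addrACA. Qed.

(** Since x y + u v = 1, the elements 1, [h0], [h1], [h2] span the words of bidegree (1, 1); the
    flip changes the sign of the last three. *)
Definition h0 : A := x * y - u * v.
Definition h1 : A := x * v.
Definition h2 : A := u * y.
Definition hset : set A := [set h0; h1; h2].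

Lemma hset_ind (P : A -> Prop) : P h0 -> P h1 -> P h2 -> forall h, hset h -> P h.
Proof. by move=> ? ? ? h [[->|->]|->]. Qed.

Lemma hset0 : hset h0. Proof. by left; left. Qed.
Lemma hset1 : hset h1. Proof. by left; right. Qed.
Lemma hset2 : hset h2. Proof. by right. Qed.

Lemma hset_flip h : hset h -> s h = - h.
Proof.
move: h; apply: hset_ind; rewrite /h0 /h1 /h2 ?raddfB /= !rmorphM /= ?sx ?su ?sv ?sy.
- by rewrite -uv -xyC opprK addrC.
- exact: vx.
- by rewrite uy opprK.
Qed.

Lemma hset_wspan h : hset h -> wspan 1 1 h.
Proof.
have w e e' : L 1 e -> L' 1 e' -> wspan 1 1 (e * e').
  by move=> he he'; apply: sub_lspan; exists e, e'.
move: h; apply: hset_ind.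
- rewrite /h0 addrC -scaleN1r; case: (wspan_subspace 1 1) => _; apply.
    by apply: w; [exact: wlen1r|exact: wlen1l].
  by apply: w; [exact: wlen1l|exact: wlen1r].
- by apply: w; [exact: wlen1l|exact: wlen1l].
- by apply: w; [exact: wlen1r|exact: wlen1r].
Qed.

(** Polynomials in h0, h1, h2 with an even, and below with an odd, number of factors: the flip is
    the identity on [evens] and the sign change on [odds]. *)
Definition evens : set A := polys [set h | exists k l, [/\ hset k, hset l & h = k * l]].
Definition odds : set A := lspan [set w | exists h e, [/\ hset h, evens e & w = h * e]].

Lemma evens_subspace : Defs.subspace evens. Proof. exact: lspan_subspace. Qed.
Lemma odds_subspace : Defs.subspace odds. Proof. exact: lspan_subspace. Qed.

Lemma evens_flip e : evens e -> s e = e.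
Proof.
suff : evens `<=` [set e | s e = e] by move=> /[apply].
apply: lspan_sub.
  by split=> [|c a b ha hb] /=; rewrite ?raddf0 // linearP /= ha hb.
move=> w; elim=> [|_ w' [k [l [hk hl ->]]] _ /= IH] /=; first exact: rmorph1.
by rewrite !rmorphM /= (hset_flip hk) (hset_flip hl) IH mulrNN.
Qed.

Lemma evens_hh k l e : hset k -> hset l -> evens e -> evens (k * (l * e)).
Proof.
move=> hk hl he; rewrite mulrA; apply: polys_mul => //.
by apply: polys_gen; exists k, l.
Qed.

Lemma odds_flip w : odds w -> s w = - w.
Proof.
suff : odds `<=` [set w | s w = - w] by move=> /[apply].
apply: lspan_sub.
  split=> [|c a b ha hb] /=; first by rewrite raddf0 oppr0.
  by rewrite linearP /= ha hb scalerN opprD.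
move=> _ [h [e [hh he ->]]] /=.
by rewrite rmorphM /= hset_flip // evens_flip // mulNr.
Qed.

Definition eo_sum : set A := [set w | exists e d, [/\ evens e, odds d & w = e + d]].

Lemma eo_subspace : Defs.subspace eo_sum.
Proof.
have [E0 ED] := evens_subspace; have [D0 DD] := odds_subspace.
split; first by exists 0, 0; rewrite addr0.
move=> c _ _ [e [d [he hd ->]]] [e' [d' [he' hd' ->]]].
exists (c *: e + e'), (c *: d + d'); split; [exact: ED|exact: DD|].
by rewrite scalerDr addrACA.
Qed.

Lemma eo_hmul h w : hset h -> eo_sum w -> eo_sum (h * w).
Proof.
move=> hh [e [d [he hd ->]]]; exists (h * d), (h * e); split.
- move: d hd; suff : odds `<=` [set d | evens (h * d)] by [].
  apply: lspan_sub.
    have [E0 ED] := evens_subspace.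
    by split=> [|c a b ha hb] /=; rewrite ?mulr0 // mulrDr -scalerAr; apply: ED.
  by move=> _ [k [e' [hk he' ->]]] /=; apply: evens_hh.
- by apply: sub_lspan; exists h, e.
- by rewrite mulrDr addrC.
Qed.

Lemma eo_letters e e' w : L 1 e -> L' 1 e' -> eo_sum w -> eo_sum (e * e' * w).
Proof.
have letter a b e1 : wlen a b 1 e1 -> e1 = a \/ e1 = b.
  by move=> h; inversion h as [|k' w' hw|k' w' hw]; subst; inversion hw; subst;
    rewrite mulr1; [left|right].
move=> /letter he /letter he' hw; have es := eo_subspace.
have eh h : hset h -> eo_sum (h * w) by move=> hh; apply: eo_hmul.
have wE : w = (x * y + u * v) * w by rewrite xyuv mul1r.
case: he he' => -> [] ->.
- exact: eh hset1.
- have -> : x * y * w = 2^-1 *: (w + h0 * w).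
    by rewrite /h0 [X in 2^-1 *: (X + _)]wE; ncring.
  by apply: (subspaceZ _ es); apply: (subspaceD es) => //; apply: eh hset0.
- have -> : u * v * w = 2^-1 *: (w + (-1) *: (h0 * w)).
    by rewrite /h0 [X in 2^-1 *: (X + _)]wE; ncring.
  apply: (subspaceZ _ es); apply: (subspaceD es) => //; apply: (subspaceZ _ es).
  exact: eh hset0.
- exact: eh hset2.
Qed.

(** Sorting a word of bidegree (b, b) into pairs of letters, one of each kind, writes it as a
    product of b elements of the span of 1 and the h's. *)
Lemma wspan_eo b w : wspan b b w -> eo_sum w.
Proof.
move: w; apply: lspan_sub; first exact: eo_subspace.
move=> _ [q [q' [hq hq' ->]]].
elim: b q q' hq hq' => [|b IH] q q' hq hq'.
  inversion hq; inversion hq'; subst; rewrite mulr1; exists 1, 0; rewrite addr0.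
  split=> //; first exact: polys1.
  by case: odds_subspace.
move: hq hq'; rewrite -add1n => /wlen_split[e [q1 [he hq1 ->]]].
move=> /wlen_split[e' [q1' [he' hq1' ->]]].
have [c hc] : qcomm q1 e' by apply: (wlen_qcomm qxv qxy quv quy hq1 he').
have -> : e * q1 * (e' * q1') = c *: (e * e' * (q1 * q1')).
  by rewrite mulrA -[e * q1 * e']mulrA hc -scalerAr -scalerAl !mulrA.
apply: (subspaceZ _ eo_subspace).
by apply: eo_letters => //; apply: IH.
Qed.

Variables (n : nat) (C : set A).
Hypotheses (n3 : (3 <= n)%N) (CA : cstar_subalg C).
Hypothesis Csym : forall p, L n p -> C (sym p).

Let Csub : Defs.subspace C. Proof. by case: CA. Qed.
Let C1 : C 1. Proof. by case: CA. Qed.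
Let CM : forall a b, C a -> C b -> C (a * b). Proof. by case: CA. Qed.

Lemma gen_sub a b : C a -> C b -> C (a - b).
Proof. by move=> Ca Cb; rewrite addrC -scaleN1r; case: Csub => _; apply. Qed.

Lemma sym_lspan (E : set A) : (forall e, E e -> C (sym e)) ->
  forall w, lspan E w -> C (sym w).
Proof.
move=> h w hw; have [C0 CD] := Csub.
move: w hw; suff : lspan E `<=` [set w | C (sym w)] by [].
apply: lspan_sub => //; split=> [|c a b ha hb] /=.
  by rewrite /sym raddf0 addr0.
by rewrite symD; apply: CD.
Qed.

(* x u + u x = 0 and x s(u) + u s(x) = x y + u v = 1, so that the products of
   the sym (q e) with the sym (e' q'') give the sym (q s(q'')). *)
Lemma sym_pred w : wspan n.-1 n.-1 w -> C (sym w).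
Proof.
move: w; apply: sym_lspan => _ [q [q' [hq hq' ->]]].
have nS : n = (n.-1 + 1)%N by rewrite addn1 prednK // (leq_trans _ n3).
have Cq e : L 1 e -> C (sym (q * e)).
  by move=> he; apply: Csym; rewrite nS; apply: wlen_mul.
have Cq' e : L 1 e -> C (sym (e * s q')).
  move=> he; apply: Csym; rewrite nS addnC; apply: wlen_mul => //.
  exact: wlen_flip'.
have -> : sym (q * q') = sym (q * x) * sym (u * s q') + sym (q * u) * sym (x * s q').
  rewrite !symM !rmorphM /= sK sx su addrACA.
  have -> : sym (q * x * (u * s q')) + sym (q * u * (x * s q')) = 0.
    rewrite -[X in X + _]scale1r -symD scale1r.
    have -> : q * x * (u * s q') + q * u * (x * s q') = 0.
      have -> : q * u * (x * s q') = q * (u * x) * s q' by rewrite !mulrA.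
      by rewrite ux; ncring.
    by rewrite /sym raddf0 addr0.
  rewrite add0r -[X in X + _]scale1r -symD scale1r; congr sym.
  by rewrite -[q in LHS]mulr1 -xyuv; ncring.
by apply: (subspaceD Csub); apply: CM;
  [apply: Cq; exact: wlen1l|apply: Cq'; exact: wlen1r|apply: Cq; exact: wlen1r|apply: Cq'; exact: wlen1l].
Qed.

(** A product k l of two h's is fixed by the flip, hence half of its [sym], and has bidegree (2, 2).
    As n >= 3, it can be raised to (n - 1, n - 1), where [sym_pred] applies. *)
Lemma evens_gen e : evens e -> C e.
Proof.
have hh k l : hset k -> hset l -> C (k * l).
  move=> hk hl; have -> : k * l = 2^-1 *: sym (k * l).
    by rewrite /sym rmorphM /= !hset_flip //; ncring.
  apply: (subspaceZ _ Csub); apply: sym_pred.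
  have -> : n.-1 = (n - 3 + 2)%N by case: n n3 => [|[|[|m]]] //= _; rewrite !subSS subn0 addn2.
  apply: wspan_le; exact: wspan_mul (hset_wspan hk) (hset_wspan hl).
move: e; apply: lspan_sub => // w; elim=> [|_ w' [k [l [hk hl ->]]] _ IH] //.
by apply: CM => //; apply: hh.
Qed.

(** An odd factor cannot be pulled out of [sym]. The identities x = x h0 - 2 u h1 and u = - 2 x h2 -
    u h0 trade the last letter for a letter followed by one more h, which makes the factor even. *)
Lemma letter_odd q e : L n.-1 q -> e = x \/ e = u -> forall h a, hset h -> evens a ->
  C (sym (q * e * (h * a))).
Proof.
move=> hq he h a hh ha.
have nS : n = (n.-1 + 1)%N by rewrite addn1 prednK // (leq_trans _ n3).
have even p b : L n p -> evens b -> C (sym (p * b)).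
  move=> hp hb; have -> : sym (p * b) = sym p * b.
    by rewrite /sym rmorphM /= (evens_flip hb) mulrDl.
  by apply: CM; [exact: Csym|exact: evens_gen].
have two p p' b b' (c c' : R[i]) : L 1 p -> L 1 p' -> evens b -> evens b' ->
    C (sym (c *: (q * p * b) + c' *: (q * p' * b'))).
  move=> hp hp' hb hb'; rewrite symD -[c' *: _]addr0 symD.
  apply: (subspaceD Csub); first apply: (subspaceZ _ Csub).
    by apply: even => //; rewrite nS; apply: wlen_mul.
  have -> : sym 0 = 0 by rewrite /sym raddf0 addr0.
  rewrite addr0; apply: (subspaceZ _ Csub).
  by apply: even => //; rewrite nS; apply: wlen_mul.
case: he => ->.
- have -> : q * x * (h * a) =
      1 *: (q * x * (h0 * (h * a))) + (- 2) *: (q * u * (h1 * (h * a))).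
    have {1}-> : x = 1 *: (x * h0) + (- 2) *: (u * h1).
      have xE : x = x * (x * y + u * v) by rewrite xyuv mulr1.
      have uxv : u * (x * v) = - (x * (u * v)) by rewrite mulrA ux mulNr mulrA.
      by rewrite [LHS]xE /h0 /h1 uxv; ncring.
    by ncring.
  by apply: two; [exact: wlen1l|exact: wlen1r|exact: evens_hh hset0 hh ha|exact: evens_hh hset1 hh ha].
- have -> : q * u * (h * a) =
      (- 2) *: (q * x * (h2 * (h * a))) + (- 1) *: (q * u * (h0 * (h * a))).
    have {1}-> : u = (- 2) *: (x * h2) + (- 1) *: (u * h0).
      have uE : u = u * (x * y + u * v) by rewrite xyuv mulr1.
      have xuy : x * (u * y) = - (u * (x * y)).
        by rewrite mulrA -[x * u]opprK -ux mulNr mulrA.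
      by rewrite [LHS]uE /h0 /h2 xuy; ncring.
    by ncring.
  by apply: two; [exact: wlen1l|exact: wlen1r|exact: evens_hh hset2 hh ha|exact: evens_hh hset0 hh ha].
Qed.

Lemma sym_deg0 b w : wspan b b w -> C (sym w).
Proof.
move=> /wspan_eo[e [d [he hd ->]]]; rewrite /sym raddfD /= (evens_flip he) (odds_flip hd).
have -> : e + d + (e - d) = 2 *: e by ncring.
by apply: (subspaceZ _ Csub); apply: evens_gen.
Qed.

(** Cut off a prefix of length n; the rest has bidegree (b, b) and splits into an even part, which
    leaves [sym], and an odd part, treated by [letter_odd]. *)
Lemma sym_deg1 b w : wspan (n + b) b w -> C (sym w).
Proof.
move: w; apply: sym_lspan => _ [q [q' [hq hq' ->]]].
have [p [q1 [hp hq1 ->]]] := wlen_split hq.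
have [e [d [he hd eo]]] : eo_sum (q1 * q').
  by apply: (@wspan_eo b); apply: sub_lspan; exists q1, q'.
rewrite -mulrA eo mulrDr.
have -> : sym (p * e + p * d) = sym p * e + sym (p * d).
  by rewrite /sym raddfD /= !rmorphM /= (evens_flip he); ncring.
apply: (subspaceD Csub).
  by apply: CM; [exact: Csym|exact: evens_gen].
move: d hd {eo}; suff : odds `<=` [set d | C (sym (p * d))] by [].
have [C0 CD] := Csub.
apply: lspan_sub.
  split=> [|c a d ha hd] /=; first by rewrite mulr0 /sym raddf0 addr0.
  by rewrite mulrDr -scalerAr symD; apply: CD.
move=> _ [h [a [hh ha ->]]] /=.
move: hp; rewrite -{1}[n]prednK ?(leq_trans _ n3) // => /wlen_snoc[p' hp' pE].
have [e' [-> he']] : exists e', p = p' * e' /\ (e' = x \/ e' = u).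
  by case: pE => ->; [exists x|exists u]; split=> //; [left|right].
exact: letter_odd.
Qed.

(** A recursion of Chebyshev type: sym (p a) = sym p sym a - sym (p s(a)) for a prefix p of length
    n. The first product lowers k by 1; the flip of p s(a) is s(p) a, which lowers k by 2 while b
    grows by n. *)
Lemma sym_deg k b w : wspan (n * k + b) b w -> C (sym w).
Proof.
elim/ltn_ind: k b w => -[|[|k]] IH b w.
- by rewrite muln0; apply: sym_deg0.
- by rewrite muln1; apply: sym_deg1.
move: w; apply: sym_lspan => _ [q [q' [hq hq' ->]]].
move: hq; rewrite mulnS -addnA => /wlen_split[p [q1 [hp hq1 ->]]].
have -> : sym (p * q1 * q') = sym p * sym (q1 * q') - sym (p * s (q1 * q')).
  by rewrite symM mulrA addrK.
apply: gen_sub.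
  apply: CM; first exact: Csym.
  by apply: (IH k.+1 _ b) => //; apply: sub_lspan; exists q1, q'.
rewrite -sym_flip; apply: (IH k _ (n + b)%N) => //.
rewrite rmorphM /= sK.
have : wspan (n * k.+1 + b) b (q1 * q') by apply: sub_lspan; exists q1, q'.
have : wspan 0 n (s p).
  apply: sub_lspan; exists 1, (s p).
  by split; [exact: wlen0|exact: wlen_flip|rewrite mul1r].
by move=> /wspan_mul h /h; rewrite add0n mulnS -addnA addnCA.
Qed.

Lemma sym_mod k l w : k = l %[mod n] -> wspan k l w -> C (sym w).
Proof.
wlog le_lk : k l w / (l <= k)%N => [wl kl hw|].
  case/orP: (leq_total l k) => h; first exact: wl hw.
  by rewrite -sym_flip; apply: (wl l k) => //; exact: wspan_flip.
move=> /eqP; rewrite eqn_mod_dvd // => /dvdnP[m kl] hw.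
by apply: (@sym_deg m l); rewrite mulnC -kl subnK.
Qed.

Lemma word_wspan w : word_in (gens (x := x) (u := u) (v := v) (y := y)) w ->
  exists k l, wspan k l w.
Proof.
elim=> [|e w' ge _ [k [l hw]]].
  exists 0%N, 0%N; apply: sub_lspan; exists 1, 1.
  by split; [exact: wlen0|exact: wlen0|rewrite mulr1].
move: e ge; apply: gens_ind.
- exists k.+1, l; rewrite -add1n -[l]add0n; apply: wspan_mul hw; apply: sub_lspan; exists x, 1.
  by split; [exact: wlen1l|exact: wlen0|rewrite mulr1].
- exists k.+1, l; rewrite -add1n -[l]add0n; apply: wspan_mul hw; apply: sub_lspan; exists u, 1.
  by split; [exact: wlen1r|exact: wlen0|rewrite mulr1].
- exists k, l.+1; rewrite -[k]add0n -add1n; apply: wspan_mul hw; apply: sub_lspan; exists 1, v.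
  by split; [exact: wlen0|exact: wlen1l|rewrite mul1r].
- exists k, l.+1; rewrite -[k]add0n -add1n; apply: wspan_mul hw; apply: sub_lspan; exists 1, y.
  by split; [exact: wlen0|exact: wlen1r|rewrite mul1r].
Qed.

End Generation.

(** * Averaging over D_n *)

Section Average.
Context {R : realType} {A : cstarType R} {x u v y : A}.
Hypothesis univ : su_universal x u v y.
Variables (s : {lrmorphism A -> A}) (rot : R[i] -> {lrmorphism A -> A}).
Hypotheses (ss : star_preserving s) (sE : [/\ s x = v, s u = y, s v = x & s y = u]).
Hypothesis rotP : forall z, z * Num.conj z = 1 -> star_preserving (rot z) /\
  [/\ rot z x = z *: x, rot z u = z *: u, rot z v = Num.conj z *: v &
      rot z y = Num.conj z *: y].

Lemma rot_wspan z k l w : z * Num.conj z = 1 -> wspan (x := x) (u := u) (v := v) (y := y) k l w ->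
  rot z w = (z ^+ k * Num.conj z ^+ l) *: w.
Proof.
move=> /rotP[_ [rx ru rv ry]]; move: w.
suff : wspan (x := x) (u := u) (v := v) (y := y) k l `<=`
   [set w | rot z w = (z ^+ k * Num.conj z ^+ l) *: w] by [].
apply: lspan_sub.
  split=> [|c a b ha hb] /=; first by rewrite raddf0 scaler0.
  by rewrite linearP /= ha hb scalerDr !scalerA mulrC.
move=> _ [q [q' [hq hq' ->]]] /=.
rewrite rmorphM /= (wlen_hom_scale rx ru hq) (wlen_hom_scale rv ry hq').
by rewrite -scalerAr -scalerAl scalerA mulrC.
Qed.

Lemma sum_rot N z k l w : N.-primitive_root z ->
  wspan (x := x) (u := u) (v := v) (y := y) k l w ->
  \sum_(j < N) rot (z ^+ j) w = (if k == l %[mod N] then N%:R else 0) *: w.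
Proof.
move=> zP hw; have zN := prim_expr_order zP; have N0 := prim_order_gt0 zP.
have zjz j : z ^+ j * Num.conj (z ^+ j) = 1.
  by apply: (unity_conj N0); rewrite exprAC zN expr1n.
under eq_bigr => j _ do rewrite (rot_wspan (zjz j) hw).
rewrite -scaler_suml -(prim_root_conj_eq1 _ _ zP) -sum_unity_powers; last first.
  by rewrite exprMn -!exprM mulnC [(l * N)%N]mulnC !exprM -rmorphXn zN rmorph1 !expr1n mulr1.
congr (_ *: _); apply: eq_bigr => j _.
by rewrite rmorphXn -!exprM exprMn -!exprM mulnC [(j * l)%N]mulnC.
Qed.

Variable n : nat.
Hypothesis n3 : (3 <= n)%N.
Let n0 : (0 < n)%N. Proof. exact: leq_trans n3. Qed.

Variable w0 : R[i].
Hypothesis w0P : n.-primitive_root w0.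

(** The projection onto the invariants. Being Lipschitz, it turns density of the polynomials in A
    into density of averaged polynomials in the invariants. *)
Definition avg (a : A) : A := (2 * n%:R)^-1 *: \sum_(j < n) sym s (rot (w0 ^+ j) a).

Let w0n : w0 ^+ n = 1. Proof. exact: prim_expr_order. Qed.
Let w0j j : (w0 ^+ j) ^+ n = 1. Proof. by rewrite exprAC w0n expr1n. Qed.
Let w0jz j : w0 ^+ j * Num.conj (w0 ^+ j) = 1.
Proof. exact: (unity_conj n0). Qed.

Let nz : 2 * n%:R != 0 :> R[i].
Proof. by rewrite mulf_neq0 // pnatr_eq0 -lt0n. Qed.

Lemma avg_fixed b : fixed_by_Dn s rot n b -> avg b = b.
Proof.
move=> [sb rb]; rewrite /avg; under eq_bigr => j _ do rewrite /sym rb // sb.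
by rewrite sumr_const card_ord -mulr2n -mulrnA -[b *+ _]scaler_nat scalerA natrM mulVf // scale1r.
Qed.

Lemma avg_lip : cnorm_lip avg.
Proof.
have lip1 j : cnorm_lip (fun a => sym s (rot (w0 ^+ j) a)).
  have rl := star_hom_lip (proj1 (rotP (w0jz j))).
  by apply: cnorm_lipD; [exact: rl|exact: (cnorm_lip_comp rl (star_hom_lip ss))].
have lipZ (c : R[i]) (B : cstarType R) (f : A -> B) : cnorm_lip f -> cnorm_lip (fun a => c *: f a).
  move=> [C C0 fC]; exists ((Normc.normc c + 1) * C).
    by rewrite mulr_gt0 // ltr_wpDl ?normc_ge0.
  move=> a b; rewrite -scalerBr cnormZ -mulrA ler_pM ?normc_ge0 ?cnorm_ge0 //.
  by rewrite lerDl.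
apply: lipZ; move: (n) => m; elim: m => [|m IH].
  have [C C0 fC] := @cnorm_lip_cst R A A 0.
  by exists C => // a b; rewrite !big_ord0; apply: fC.
have [C C0 fC] := cnorm_lipD IH (lip1 m).
by exists C => // a b; rewrite !big_ord_recr; apply: fC.
Qed.

Lemma avgD (c : R[i]) a b : avg (c *: a + b) = c *: avg a + avg b.
Proof.
rewrite /avg scalerA [c * _]mulrC -scalerA -scalerDr; congr (_ *: _).
rewrite scaler_sumr -big_split; apply: eq_bigr => j _ /=.
by rewrite linearP /= symD.
Qed.

(** Averaging over rotations kills a word of bidegree (k, l) unless k = l modulo n, and in that case
    [sym_mod] applies. *)
Lemma avg_polys (C : set A) : cstar_subalg C ->
  (forall p, wlen x u n p -> C (sym s p)) ->
  forall a, polys (gens (x := x) (u := u) (v := v) (y := y)) a -> C (avg a).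
Proof.
move=> CA Cs; have [Csub _ _ _ _] := CA; have [C0 CD] := Csub.
suff : polys (gens (x := x) (u := u) (v := v) (y := y)) `<=` [set a | C (avg a)] by [].
have avg0 : avg 0 = 0 by have := avgD (-1) 0 0; rewrite !scaleN1r !addNr.
apply: lspan_sub; first split=> [|c a b ha hb] /=; first by rewrite avg0.
  by rewrite avgD; apply: CD.
move=> w /(word_wspan univ)[k [l hw]] /=; rewrite /avg.
apply: (subspaceZ _ Csub); rewrite /sym big_split -raddf_sum /= -/(sym s _).
rewrite (sum_rot w0P hw); case: ifP => [/eqP kl|_]; last first.
  by rewrite scale0r /sym raddf0 addr0.
rewrite -[_ *: w]addr0 symD; apply: CD; last by rewrite /sym raddf0 addr0.
exact: (sym_mod univ ss sE n3 CA Cs kl hw).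
Qed.

Lemma fixed_cstar : cstar_subalg (fixed_by_Dn s rot n).
Proof.
have rs z : z ^+ n = 1 -> star_preserving (rot z).
  by move=> zn; case: (rotP (unity_conj n0 zn)).
split.
- split=> [|c a b [sa ra] [sb rb]]; first by split=> *; rewrite raddf0.
  by split=> [|z zn]; rewrite linearP /= ?sa ?sb // ra ?rb.
- by split=> *; rewrite rmorph1.
- move=> a b [sa ra] [sb rb]; split=> [|z zn]; rewrite rmorphM /= ?sa ?sb // ra ?rb //.
- by move=> a [sa ra]; split=> [|z zn]; rewrite ?ss ?sa // rs // ra.
- apply/norm_closedP => a ha; split=> [|z zn].
    apply: (adherent_eq (star_hom_lip ss) (@cnorm_lip_id R A) _ ha).
    by move=> b [].
  apply: (adherent_eq (star_hom_lip (rs z zn)) (@cnorm_lip_id R A) _ ha).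
  by move=> b [_]; apply.
Qed.

Lemma sym_fixed p : wlen x u n p -> fixed_by_Dn s rot n (sym s p).
Proof.
move=> hp; split=> [|z zn].
  by rewrite /sym raddfD /= (flipK univ ss sE) addrC.
have zz := unity_conj n0 zn; rewrite /sym raddfD /=; congr (_ + _).
  rewrite (@rot_wspan z n 0) // ?zn ?expr0 ?mulr1 ?scale1r //.
  by apply: sub_lspan; exists p, 1; split; [|exact: wlen0|rewrite mulr1].
rewrite (@rot_wspan z 0 n) // ?expr0 ?mul1r.
  by rewrite -rmorphXn zn rmorph1 scale1r.
apply: sub_lspan; exists 1, (s p); split; [exact: wlen0| |by rewrite mul1r].
by have [sx su _ _] := sE; rewrite -sx -su; apply: wlen_hom.
Qed.

Lemma avg_fixed_polys a : polys (gens (x := x) (u := u) (v := v) (y := y)) a ->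
  fixed_by_Dn s rot n (avg a).
Proof. by apply: avg_polys; [exact: fixed_cstar|exact: sym_fixed]. Qed.

Lemma fixed_adherent b : fixed_by_Dn s rot n b ->
  adherent [set avg a | a in polys (gens (x := x) (u := u) (v := v) (y := y))] b.
Proof.
move=> hb; rewrite -(avg_fixed hb).
apply: adherent_map (polys_dense univ b); first exact: avg_lip.
by move=> a ha; exists a.
Qed.

Lemma fixed_generated (C : set A) : cstar_subalg C ->
  (forall p, wlen x u n p -> C (sym s p)) -> fixed_by_Dn s rot n `<=` C.
Proof.
move=> CA Cs b /fixed_adherent hb; have [_ _ _ _ /norm_closedP Cc] := CA.
apply: Cc => e /hb[_ [a ha <-] ab]; exists (avg a) => //.
exact: avg_polys.
Qed.

End Average.

(** * The eta vectors *)

Section HalfPowers.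
Context {R : realType} {B : cstarType R}.
Implicit Type t : B.

Lemma half_pow_even t k : t * t = 2^-1 *: 1 -> t ^+ k.*2 = (2^-1 : R[i]) ^+ k *: 1.
Proof.
move=> tt; elim: k => [|k IH]; first by rewrite !expr0 scale1r.
by rewrite doubleS !exprS mulrA tt IH -scalerAl mul1r scalerA.
Qed.

Lemma half_pow_odd t k : t * t = 2^-1 *: 1 -> t ^+ k.*2.+1 = (2^-1 : R[i]) ^+ k *: t.
Proof. by move=> tt; rewrite exprSr half_pow_even // -scalerAl mul1r. Qed.

(** As n is odd, exactly one of n - i and i is odd. Each product therefore collapses to a multiple
    of one of t1, t2, the two products giving different ones, with the same power of 1/2. *)
Lemma half_pow_sum t1 t2 (n i : nat) : t1 * t1 = 2^-1 *: 1 -> t2 * t2 = 2^-1 *: 1 ->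
  odd n -> (i <= n)%N ->
  t1 ^+ (n - i) * t2 ^+ i + t2 ^+ (n - i) * t1 ^+ i = (2^-1 : R[i]) ^+ n./2 *: (t1 + t2).
Proof.
move=> t11 t22 on le_in.
have [p [q [h nE]]] : exists p q : nat, n./2 = (p + q)%N /\
    ((n - i)%N = p.*2 /\ i = q.*2.+1 \/ (n - i)%N = p.*2.+1 /\ i = q.*2).
  have nE := odd_double_half n; have iE := odd_double_half i.
  exists (n - i)./2, i./2; have kE := odd_double_half (n - i).
  move: nE iE kE; rewrite oddB // on.
  by case: (odd i) => /= nE iE kE; split; lia.
rewrite h exprD scalerDr; case: nE => -[-> ->];
  rewrite !half_pow_odd // !half_pow_even //.
  by rewrite !mulr_algl !scalerA addrC.
by rewrite !mulr_algr !scalerA [(2^-1) ^+ q * _]mulrC.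
Qed.

End HalfPowers.

Section SquareRootOfHalf.
Context {R : realType} (B : cstarType R).

(** [psi_mx 1 0] and [psi_mx 0 1] are rho x and rho u: anticommuting square roots of 1/2 with sum
    [sgn2]. *)
Lemma psi_mx10 : psi_mx (1 : B) 0 * psi_mx 1 0 = 2^-1 *: 1.
Proof. by rewrite psi_mxM mk2_1; congr (_ *: _); apply: mk2_eq; ncring. Qed.

Lemma psi_mx01 : psi_mx (0 : B) 1 * psi_mx 0 1 = 2^-1 *: 1.
Proof. by rewrite psi_mxM mk2_1; congr (_ *: _); apply: mk2_eq; ncring. Qed.

Lemma psi_mx_anti : psi_mx (0 : B) 1 * psi_mx 1 0 = - (psi_mx 1 0 * psi_mx 0 1).
Proof.
by rewrite !psi_mxM -scalerN mk2N; congr (_ *: _); apply: mk2_eq; ncring.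
Qed.

Lemma psi_mx_sum : psi_mx (1 : B) 0 + psi_mx 0 1 = sgn2.
Proof. by rewrite /psi_mx !mk2Z mk2D; apply: mk2_eq; ncring. Qed.

Lemma psi_mx_pow_sum n i : odd n -> (i <= n)%N ->
  psi_mx (1 : B) 0 ^+ (n - i) * psi_mx 0 1 ^+ i +
  psi_mx (0 : B) 1 ^+ (n - i) * psi_mx 1 0 ^+ i = (2^-1 : R[i]) ^+ n./2 *: sgn2.
Proof.
by move=> on le_in; rewrite (half_pow_sum psi_mx10 psi_mx01) // psi_mx_sum.
Qed.

End SquareRootOfHalf.

Section EtaVectors.
Context {R : realType} {A : cstarType R} {x u v y : A}.
Hypothesis univ : su_universal x u v y.

Let rel := proj1 univ.
Let vx : v * x = - (x * v). Proof. exact: su_vx rel. Qed.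

(** In the representation of dimension 2, the image times the same word reversed is a nonzero
    multiple of 1. *)
Lemma xv_neq0 k l : x ^+ k * v ^+ l != 0.
Proof.
pose B : cstarType R := R[i]^o.
pose t1 : cmx B 1 := psi_mx 1 0; pose t2 : cmx B 1 := psi_mx 0 1.
have conj2 : Num.conj (2^-1) = 2^-1 :> R[i] by rewrite rmorphV ?unitfE // rmorph_nat.
have psi_star a b : star (psi_mx a b : cmx B 1) = psi_mx (star a) (star b).
  by rewrite starZ conj2 mk2_star starN starB !starD.
have t11 : t1 * t1 = 2^-1 *: 1 := psi_mx10 B.
have t22 : t2 * t2 = 2^-1 *: 1 := psi_mx01 B.
have t21 : t2 * t1 = - (t1 * t2) := psi_mx_anti B.
have half : 2^-1 *: 1 + 2^-1 *: 1 = 1 :> cmx B 1.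
  by rewrite -scalerDl -[X in X + _]div1r -[X in _ + X]div1r -splitr scale1r.
have [|phi [_ [px _ pv _]]] := @su_hom _ _ _ _ _ _ univ (cmx B 1) t1 t2 t2 t1.
  by split; rewrite ?t11 ?t22 ?t21 ?opprK // /t1 /t2 psi_star ?star1 ?star0.
apply/eqP => xv0; have : phi (x ^+ k * v ^+ l) = 0 by rewrite xv0 raddf0.
rewrite rmorphM !rmorphXn /= px pv => h.
have : t1 ^+ k * t2 ^+ l * (t2 ^+ l * t1 ^+ k) = 0 by rewrite h mul0r.
rewrite mulrA -[_ * t2 ^+ l * t2 ^+ l]mulrA -exprD addnn half_pow_even //.
rewrite -scalerAr mulr1 -scalerAl -exprD addnn (half_pow_even _ t11) scalerA.
move/eqP; rewrite scaler_eq0 oner_eq0 orbF mulf_eq0 !expf_eq0 invr_eq0.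
by rewrite pnatr_eq0 !andbF.
Qed.

Variable rot : R[i] -> {lrmorphism A -> A}.
Hypothesis rotP : forall z, z * Num.conj z = 1 -> star_preserving (rot z) /\
  [/\ rot z x = z *: x, rot z u = z *: u, rot z v = Num.conj z *: v &
      rot z y = Num.conj z *: y].

(** Rotation by z multiplies the j-th element by z^(n - 2 j). These weights differ, so averaging
    rotations against the inverse of the weight of [i0] isolates its coefficient. *)
Lemma lin_indep_xv n : lin_indep (fun j : 'I_n.+1 => x ^+ (n - j) * v ^+ j).
Proof.
(* A root of order 2 n + 1 suffices: the numbers 2 j with j <= n are distinct modulo N. *)
move=> c c0 i0; pose N := n.*2.+1.
have [z zP] := @primitive_root_exists R N isT.
have zN := prim_expr_order zP.
pose f j (a : A) := (Num.conj (z ^+ j) ^+ n * (z ^+ j) ^+ (i0.*2)) *: rot (z ^+ j) a.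
have zjz j : z ^+ j * Num.conj (z ^+ j) = 1.
  by apply: (@unity_conj _ N) => //; rewrite exprAC zN expr1n.
have fE (i : 'I_n.+1) : \sum_(j < N) f j (x ^+ (n - i) * v ^+ i) =
    (if i == i0 then N%:R else 0) *: (x ^+ (n - i) * v ^+ i).
  pose k := (n - i + i0.*2)%N; pose l := (i + n)%N.
  have kl : (k == l %[mod N]) = (i == i0).
    have le_in : (i <= n)%N by rewrite -ltnS.
    rewrite -(eqn_modDr i) /k /l addnAC subnK // addnAC addnn addnC eqn_modDr.
    have lt_dbl (j : 'I_n.+1) : (j.*2 < N)%N by rewrite ltnS leq_double -ltnS.
    by rewrite (modn_small (lt_dbl i)) (modn_small (lt_dbl i0)) (inj_eq double_inj) eq_sym.
  have e j : f j (x ^+ (n - i) * v ^+ i) =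
      (z ^+ k * Num.conj z ^+ l) ^+ j *: (x ^+ (n - i) * v ^+ i).
    have [_ [rx _ rv _]] := rotP (zjz j).
    rewrite /f rmorphM !rmorphXn /= rx rv !exprZn -scalerAl -scalerAr !scalerA.
    congr (_ *: _); rewrite rmorphXn /k /l !exprMn !exprD !exprMn -!exprM.
    rewrite ![(j * _)%N]mulnC; ring.
  under eq_bigr do rewrite e.
  rewrite -scaler_suml -kl -(prim_root_conj_eq1 _ _ zP) -sum_unity_powers //.
  by rewrite exprMn -!exprM mulnC [(l * N)%N]mulnC !exprM -rmorphXn zN rmorph1 !expr1n mulr1.
have : \sum_(j < N) f j (\sum_i c i *: (x ^+ (n - i) * v ^+ i)) = 0.
  by rewrite c0; apply: big1 => j _; rewrite /f raddf0 scaler0.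
have -> : \sum_(j < N) f j (\sum_i c i *: (x ^+ (n - i) * v ^+ i)) =
    \sum_i c i *: (\sum_(j < N) f j (x ^+ (n - i) * v ^+ i)).
  under eq_bigr => j _ do rewrite /f raddf_sum scaler_sumr /=.
  rewrite exchange_big /=; apply: eq_bigr => i _; rewrite scaler_sumr.
  by apply: eq_bigr => j _; rewrite linearZ /= !scalerA mulrC.
under eq_bigr do rewrite fE.
rewrite (bigD1 i0) //= big1 => [|i ii0]; last by rewrite (negbTE ii0) scale0r scaler0.
rewrite eqxx addr0 scalerA => /eqP; rewrite scaler_eq0 (negbTE (xv_neq0 _ _)) orbF.
by rewrite mulf_eq0 pnatr_eq0 orbF => /eqP.
Qed.

Variable psi : {lrmorphism A -> cmx A 1}.
Hypotheses (psix : psi x = psi_mx x v) (psiv : psi v = psi_mx v x).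

(** psi x = t1 x + t2 v and psi v = t2 x + t1 v. As t1, t2 anticommute and so do x, v, the two
    summands commute and the usual binomial theorem applies. The i-th terms combine by
    [psi_mx_pow_sum] into a multiple of [sgn2], whose first entry is 1. *)
Lemma theta_zeta0 n : odd n -> theta psi (x ^+ n + v ^+ n) =
  (2^-1 : R[i]) ^+ n./2 *: \sum_(i < n.+1) (x ^+ (n - i) * v ^+ i) *+ 'C(n, i).
Proof.
move=> on; pose sc (a : A) : cmx A 1 := mk2 a 0 0 a.
pose t1 : cmx A 1 := psi_mx 1 0; pose t2 : cmx A 1 := psi_mx 0 1.
have scM a b : sc a * sc b = sc (a * b).
  by rewrite /sc mk2M; apply: mk2_eq; ncring.
have scX a k : sc a ^+ k = sc (a ^+ k).
  elim: k => [|k IH]; first by rewrite !expr0 mk2_1.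
  by rewrite !exprS IH scM.
have tC a b c : psi_mx (a%:A) (b%:A) * sc c = sc c * psi_mx (a%:A) (b%:A).
  by rewrite /psi_mx -scalerAl -scalerAr !mk2M; congr (_ *: _); apply: mk2_eq; ncring.
have t1C c : sc c * t1 = t1 * sc c by have := tC 1 0 c; rewrite scale1r scale0r.
have t2C c : sc c * t2 = t2 * sc c by have := tC 0 1 c; rewrite scale1r scale0r.
have t21 : t2 * t1 = - (t1 * t2) := psi_mx_anti A.
have powE (t : cmx A 1) c k : sc c * t = t * sc c -> (t * sc c) ^+ k = t ^+ k * sc (c ^+ k).
  by move=> tc; rewrite exprMn_comm ?scX.
have binom (t t' : cmx A 1) : (forall c, sc c * t = t * sc c) ->
    (forall c, sc c * t' = t' * sc c) -> t' * t = - (t * t') ->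
    (t * sc x + t' * sc v) ^+ n =
    \sum_(i < n.+1) (t ^+ (n - i) * t' ^+ i * sc (x ^+ (n - i) * v ^+ i)) *+ 'C(n, i).
  move=> tc tc' tt'; rewrite exprDn_comm; last first.
    rewrite /GRing.comm -mulrA (mulrA (sc x)) tc' -(mulrA t') scM.
    rewrite -[t' * sc v * _]mulrA (mulrA (sc v)) tc -(mulrA t) scM.
    rewrite !mulrA tt' vx mulNr.
    by rewrite /sc -[mk2 (- _) _ _ _]opprK mk2N oppr0 opprK mulrN opprK.
  apply: eq_bigr => i _; rewrite !powE //; congr (_ *+ _).
  have tcX c k : sc c * t' ^+ k = t' ^+ k * sc c.
    by apply: commrX; apply: tc'.
  by rewrite -!mulrA; congr (_ * _); rewrite mulrA tcX -mulrA scM.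
have psixE : psi x = t1 * sc x + t2 * sc v.
  by rewrite psix /t1 /t2 /psi_mx -!scalerAl !mk2M -scalerDr mk2D; congr (_ *: _); apply: mk2_eq; ncring.
have psivE : psi v = t2 * sc x + t1 * sc v.
  by rewrite psiv /t1 /t2 /psi_mx -!scalerAl !mk2M -scalerDr mk2D; congr (_ *: _); apply: mk2_eq; ncring.
rewrite /theta rmorphD !rmorphXn /= psixE psivE binom // binom //; last by rewrite t21 opprK.
rewrite -big_split /= summxE scaler_sumr; apply: eq_bigr => i _.
have key : t1 ^+ (n - i) * t2 ^+ i + t2 ^+ (n - i) * t1 ^+ i =
    (2^-1 : R[i]) ^+ n./2 *: sgn2 by apply: psi_mx_pow_sum; rewrite // -ltnS.
have cmxMn (M : cmx A 1) m : (M *+ m) 0 0 = M 0 0 *+ m.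
  by elim: m => [|m IH]; rewrite ?mulr0n ?mxE // !mulrS cmxD IH.
rewrite -mulrnDl -mulrDl key cmxMn -scalerAl cmxZ scalerMnr; congr (_ *: (_ *+ _)).
by rewrite cmxM2 !mk2E mul1r mul0r addr0.
Qed.

End EtaVectors.

(** * Covariance of theta *)

Section Covariance.
Context {R : realType} {A T : cstarType R} {x u v y : A} {tens : A -> A -> T}
  {delta : {lrmorphism A -> T}}.
Hypotheses (univ : su_universal x u v y) (tensP : min_tensor tens)
  (deltaP : su_coproduct tens x u v y delta).
Variables (s par : {lrmorphism A -> A}) (rot : R[i] -> {lrmorphism A -> A}).
Hypotheses (ss : star_preserving s) (sE : [/\ s x = v, s u = y, s v = x & s y = u]).
Hypotheses (pars : star_preserving par)
  (parE : [/\ par x = - x, par u = - u, par v = - v & par y = - y]).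
Hypothesis rotP : forall z, z * Num.conj z = 1 -> star_preserving (rot z) /\
  [/\ rot z x = z *: x, rot z u = z *: u, rot z v = Num.conj z *: v &
      rot z y = Num.conj z *: y].
Variable psi : {lrmorphism A -> cmx A 1}.
Hypotheses (psis : star_preserving psi) (psix : psi x = psi_mx x v)
  (psiu : psi u = psi_mx u y) (psiv : psi v = psi_mx v x)
  (psiy : psi y = psi_mx y u).
Variables (n : nat) (w0 : R[i]).
Hypotheses (n3 : (3 <= n)%N) (w0P : n.-primitive_root w0).

Let tensC : cstar_tensor tens. Proof. by case: tensP. Qed.
Let deltas : star_preserving delta. Proof. by case: deltaP. Qed.
Local Notation avg := (avg s rot n w0).
Local Notation fixed := (fixed_by_Dn s rot n).
Local Notation theta := (theta psi).
Local Notation csum := (coproduct_sum (x := x) (u := u) (v := v) (y := y) (tens := tens) (delta := delta)).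
Local Notation covariant := (covariant_map (x := x) (u := u) (v := v) (y := y) (tens := tens) (delta := delta)).

Lemma linear_avg (V : lmodType R[i]) (h : A -> V) a :
  (forall c a b, h (c *: a + b) = c *: h a + h b) ->
  h (avg a) = (2 * n%:R)^-1 *:
    \sum_(j < n) (h (rot (w0 ^+ j) a) + h (s (rot (w0 ^+ j) a))).
Proof.
move=> hl; pose H : {linear A -> V} := HB.pack h (GRing.isLinear.Build _ _ _ _ h hl).
rewrite -[h]/(H : A -> V) /avg linearZ linear_sum /=; congr (_ *: _).
by apply: eq_bigr => j _; apply: (linearD H).
Qed.

(** The flip and the rotations act on the left leg, so their composites with [phi] are again
    covariant and the same list [r] serves them all. *)
Lemma delta_avg phi a r : covariant phi -> csum a r ->
  delta (phi (avg a) 0 0) = \sum_(p <- r) tens (phi (avg p.1) 0 0) p.2.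
Proof.
move=> cphi [_ _ ra _]; have [[phil _ _ _] _] := cphi.
have entry (c : R[i]) b b' : phi (c *: b + b') 0 0 = c *: phi b 0 0 + phi b' 0 0.
  by rewrite phil cmxD cmxZ.
have w0n := prim_expr_order w0P.
have rotE (j : nat) : star_preserving (rot (w0 ^+ j)) /\
    [/\ rot (w0 ^+ j) x = (w0 ^+ j) *: x, rot (w0 ^+ j) u = (w0 ^+ j) *: u,
        rot (w0 ^+ j) v = Num.conj (w0 ^+ j) *: v &
        rot (w0 ^+ j) y = Num.conj (w0 ^+ j) *: y].
  apply: rotP; apply: (@unity_conj _ n); first exact: leq_trans n3.
  by rewrite exprAC w0n expr1n.
have crot (j : nat) f : covariant f -> covariant (f \o rot (w0 ^+ j)).
  by move=> cf; have [rs rE] := rotE j; apply: (covariant_comp tensP cf (alg_map_hom rs) rE).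
have cs : covariant (phi \o s) by apply: (covariant_flip cphi (alg_map_hom ss) sE).
rewrite (linear_avg (h := fun b => phi b 0 0)) // linearZ linear_sum /=.
transitivity (\sum_(p <- r) (2 * n%:R)^-1 *: \sum_(j < n)
    (tens (phi (rot (w0 ^+ j) p.1) 0 0) p.2 + tens (phi (s (rot (w0 ^+ j) p.1)) 0 0) p.2)).
  rewrite -scaler_sumr exchange_big /=; congr (_ *: _); apply: eq_bigr => j _.
  rewrite linearD /= big_split /=; congr (_ + _).
    exact: (ra _ (crot j _ cphi)).
  exact: (ra _ (crot j _ cs)).
apply: eq_bigr => p _; rewrite (linear_avg (h := fun b => tens (phi b 0 0) p.2)) //.
by move=> c b b'; rewrite entry (tens_linl tensC).
Qed.

Lemma covariant_id : covariant (fun a => mk2 a 0 0 a).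
Proof.
apply: (covariant_scalar tensP (g := id)); last by case: deltaP.
by split=> //; apply: cnorm_lip_id.
Qed.

Let fixedC : cstar_subalg fixed := fixed_cstar ss rotP n3.
Let fixedS : Defs.subspace fixed. Proof. by case: fixedC. Qed.

Lemma fixed_avg_tseq (r : seq (A * A)) :
  tseq (polys (gens (x := x) (u := u) (v := v) (y := y))) r ->
  tseq fixed [seq (avg p.1, p.2) | p <- r].
Proof.
move=> rP q /mapP[p pr ->] /=.
exact: (avg_fixed_polys univ ss sE rotP n3 w0P (rP _ pr)).
Qed.

Lemma tsum_avg (r : seq (A * A)) :
  tsum tens [seq (avg p.1, p.2) | p <- r] = \sum_(p <- r) tens (avg p.1) p.2.
Proof. by rewrite /tsum big_map. Qed.

Lemma fixed_coinvariant : coinvariant tens delta fixed.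
Proof.
move=> b bf; rewrite (tens_subE tensC fixedS).
apply: (adherent_map (star_hom_lip deltas) _ (fixed_adherent univ ss rotP n3 w0P bf)).
move=> _ [a aP <-]; have [r ar] := coproduct_sum_exists tensP deltaP aP.
exists [seq (avg p.1, p.2) | p <- r]; first by apply: fixed_avg_tseq; case: ar.
by have := delta_avg covariant_id ar; rewrite !mk2E tsum_avg => ->; under eq_bigr do rewrite mk2E.
Qed.

(** On averaged polynomials, covariance follows by applying [delta_avg] to the identity and to psi
    with the same list; continuity does the rest. *)
Lemma theta_tens_exists : exists F : T -> T,
  [/\ cont_linear_on (tens_sub tens fixed) F,
      forall r, tseq fixed r -> F (tsum tens r) = \sum_(p <- r) tens (theta p.1) p.2,
      forall W, norm_closed W ->
        (forall r, tseq fixed r -> W (\sum_(p <- r) tens (theta p.1) p.2)) ->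
        forall t, tens_sub tens fixed t -> W (F t) &
      forall b, fixed b -> delta (theta b) = F (delta b)].
Proof.
have bound (r : seq (A * A)) : tseq fixed r ->
    cnorm (\sum_(p <- r) tens (theta p.1) p.2) <= 2 * cnorm (tsum tens r).
  move=> rf; apply: (theta_tens_bound univ psis psix psiu psiv psiy ss sE pars parE tensP).
  by move=> p pr; case: (rf p pr).
have tl (c : R[i]) a a' b : fixed a -> fixed a' ->
    tens (theta (c *: a + a')) b = c *: tens (theta a) b + tens (theta a') b.
  by move=> _ _; rewrite thetaD (tens_linl tensC).
have [F [Fc FE FW]] := tensor_extension tensC fixedS tl (ltr0Sn R 1) bound.
exists F; split=> // b bf; apply/esym.
have lipdt : cnorm_lip (delta \o theta).
  exact: (cnorm_lip_comp (theta_lip psis) (star_hom_lip deltas)).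
apply: (cont_adherent_eq Fc (star_hom_lip deltas) lipdt _ (fixed_coinvariant bf) _
  (fixed_adherent univ ss rotP n3 w0P bf)) => _ [a aP <-].
  by apply: fixed_coinvariant; apply: (avg_fixed_polys univ ss sE rotP n3 w0P aP).
have [r ar] := coproduct_sum_exists tensP deltaP aP.
have rP : tseq fixed [seq (avg p.1, p.2) | p <- r] by apply: fixed_avg_tseq; case: ar.
have := delta_avg covariant_id ar; rewrite mk2E => ->.
under eq_bigr do rewrite mk2E.
rewrite -tsum_avg FE // big_map.
by rewrite -(delta_avg (covariant_psi tensP deltaP psis psix psiu psiv psiy) ar).
Qed.

End Covariance.

(** * The image of theta and the eta vectors *)

Section EtaRelation.
Context {R : realType} {A T : cstarType R} {x u v y : A} {tens : A -> A -> T}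
  {delta : {lrmorphism A -> T}}.
Hypotheses (univ : su_universal x u v y) (tensP : min_tensor tens)
  (deltaP : su_coproduct tens x u v y delta).
Variables (s par : {lrmorphism A -> A}) (rot : R[i] -> {lrmorphism A -> A}).
Hypotheses (ss : star_preserving s) (sE : [/\ s x = v, s u = y, s v = x & s y = u]).
Hypotheses (pars : star_preserving par)
  (parE : [/\ par x = - x, par u = - u, par v = - v & par y = - y]).
Hypothesis rotP : forall z, z * Num.conj z = 1 -> star_preserving (rot z) /\
  [/\ rot z x = z *: x, rot z u = z *: u, rot z v = Num.conj z *: v &
      rot z y = Num.conj z *: y].
Variable psi : {lrmorphism A -> cmx A 1}.
Hypotheses (psis : star_preserving psi) (psix : psi x = psi_mx x v)
  (psiu : psi u = psi_mx u y) (psiv : psi v = psi_mx v x)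
  (psiy : psi y = psi_mx y u).
Variable n : nat.
Hypotheses (n3 : (3 <= n)%N) (nodd : odd n).
Variable w : 'M[A]_(n.+1).
Hypothesis wP : spin_rep tens x v delta w.

Let tensC : cstar_tensor tens. Proof. by case: tensP. Qed.
Local Notation fixed := (fixed_by_Dn s rot n).
Local Notation theta := (theta psi).
Let fixedC : cstar_subalg fixed := fixed_cstar ss rotP n3.

Definition zeta j : A := x ^+ (n - j) * u ^+ j + v ^+ (n - j) * y ^+ j.

Lemma tens_expr a b k : tens a b ^+ k = tens (a ^+ k) (b ^+ k).
Proof.
elim: k => [|k IH]; first by rewrite !expr0 (tens_one tensC).
by rewrite !exprS IH (tens_mul tensC).
Qed.

Lemma wlen_exprM (a b : A) k l : wlen a b (k + l) (a ^+ k * b ^+ l).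
Proof.
elim: k => [|k IH]; last by rewrite exprS -mulrA; apply: wlen_l.
rewrite mul1r; elim: l => [|l IH]; first exact: wlen0.
by rewrite exprS; apply: wlen_r.
Qed.

Lemma symX p q : sym s (x ^+ p * u ^+ q) = x ^+ p * u ^+ q + v ^+ p * y ^+ q.
Proof. by case: sE => sx su _ _; rewrite /sym rmorphM !rmorphXn /= sx su. Qed.

Lemma zeta_fixed (j : 'I_n.+1) : fixed (zeta j).
Proof.
rewrite /zeta -symX; apply: (sym_fixed univ ss sE rotP n3).
by have := wlen_exprM x u (n - j) j; rewrite subnK // -ltnS.
Qed.

(** The two summands of [delta x] commute, since signs arise in both legs, and likewise for
    [delta v]; the binomial theorem applies to both. *)
Lemma delta_zeta0 :
  delta (x ^+ n + v ^+ n) = \sum_(j < n.+1) tens ('C(n, j)%:R *: zeta j) (x ^+ (n - j) * v ^+ j).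
Proof.
have [_ [dx _ dv _]] := deltaP; have [ux vx _ vy _ _ _ _ _] := proj1 univ.
rewrite rmorphD !rmorphXn /= dx dv exprDn_comm; last first.
  by rewrite /GRing.comm !(tens_mul tensC) ux vx (tensNl tensC) (tensNr tensC) opprK.
rewrite exprDn_comm; last first.
  rewrite /GRing.comm !(tens_mul tensC) vx.
  have -> : y * v = - (v * y) by rewrite vy opprK.
  by rewrite (tensNl tensC) (tensNr tensC) opprK.
rewrite -big_split /=; apply: eq_bigr => j _.
rewrite !tens_expr !(tens_mul tensC) -mulrnDl -(tensDl tensC).
by rewrite (tensZl tensC) scaler_nat.
Qed.

Lemma sqrt_bin_sqr i : (i <= n)%N -> sqrt_bin n i * sqrt_bin n i = 'C(n, i)%:R :> R[i].
Proof.
move=> le_in; rewrite /sqrt_bin -rmorphM /= -expr2 sqr_sqrtr ?ler0n // bin_sub //.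
by rewrite rmorph_nat.
Qed.

Lemma sqrt_bin_neq0 i : (i <= n)%N -> sqrt_bin n i != 0 :> R[i].
Proof.
move=> le_in; apply/eqP => sb0; have := sqrt_bin_sqr le_in.
by move/esym/eqP; rewrite sb0 mul0r pnatr_eq0 -leqn0 leqNgt bin_gt0 le_in.
Qed.

Lemma theta_eta0 : theta (x ^+ n + v ^+ n) = (2^-1 : R[i]) ^+ n./2 *: eta_vec w ord0.
Proof.
rewrite (theta_zeta0 univ psix psiv nodd); congr (_ *: _); apply: eq_bigr => i _.
by rewrite (proj1 wP) scalerA sqrt_bin_sqr ?scaler_nat // -ltnS.
Qed.

Lemma delta_eta0 : delta (eta_vec w ord0) =
  \sum_(j < n.+1) tens (sqrt_bin n j *: eta_vec w j) (x ^+ (n - j) * v ^+ j).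
Proof.
rewrite /eta_vec linear_sum /=.
under eq_bigr => i _ do rewrite linearZ /= (proj2 wP) scaler_sumr.
rewrite exchange_big /=; apply: eq_bigr => j _.
rewrite (proj1 wP) (tensZl tensC) (tens_suml tensC) scaler_sumr; apply: eq_bigr => i _.
by rewrite (tensZr tensC) (tensZl tensC) !scalerA mulrC.
Qed.

Lemma eta_theta_zeta (j : 'I_n.+1) :
  exists2 c : R[i], c != 0 & eta_vec w j = c *: theta (zeta j).
Proof.
have [w0 w0P] := @primitive_root_exists R n (leq_trans (isT : 0 < 3)%N n3).
have [F [_ FE _ Fdelta]] := theta_tens_exists univ tensP deltaP ss sE pars parE rotP
  psis psix psiu psiv psiy n3 w0P.
pose k : R[i] := 2^-1 ^+ n./2.
have k0 : k != 0 by rewrite expf_neq0 // invr_eq0 pnatr_eq0.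
have zeta0E : x ^+ n + v ^+ n = zeta (ord0 : 'I_n.+1) by rewrite /zeta subn0 !expr0 !mulr1.
pose r := [seq ('C(n, j)%:R *: zeta j, x ^+ (n - j) * v ^+ j) | j : 'I_n.+1].
have rf : tseq fixed r.
  move=> _ /mapP[i _ ->] /=; case: fixedC => fS _ _ _ _.
  exact: (subspaceZ _ fS (zeta_fixed i)).
have := Fdelta _ (zeta_fixed ord0); rewrite -zeta0E theta_eta0 linearZ /= delta_eta0.
have -> : delta (x ^+ n + v ^+ n) = tsum tens r.
  by rewrite delta_zeta0 /tsum /r big_image /=; apply: eq_bigl.
rewrite FE // /r big_image /= scaler_sumr.
under [X in _ = X -> _]eq_bigl do rewrite inE.
move=> e.
(* Both expansions of delta (theta (x ^+ n + v ^+ n)) have the same right legs, which are linearly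
   independent, so the left legs agree one by one. *)
have d0 : \sum_(i < n.+1) tens (k *: (sqrt_bin n i *: eta_vec w i) -
    theta ('C(n, i)%:R *: zeta i)) (x ^+ (n - i) * v ^+ i) = 0.
  under eq_bigr => i _ do rewrite (tensDl tensC) (tensNl tensC) (tensZl tensC).
  by rewrite sumrB e subrr.
have := tens_inj tensC (lin_indep_xv univ rotP (n := n)) d0 j.
have le_jn : (j <= n)%N by rewrite -ltnS.
have C0 : 'C(n, j)%:R != 0 :> R[i] by rewrite pnatr_eq0 -lt0n bin_gt0.
have kb0 : k * sqrt_bin n j != 0 by rewrite mulf_neq0 ?sqrt_bin_neq0.
have thetaZ (c : R[i]) a : theta (c *: a) = c *: theta a.
  by rewrite /theta linearZ /= cmxZ.
move/subr0_eq; rewrite thetaZ scalerA => h.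
exists ((k * sqrt_bin n j)^-1 * 'C(n, j)%:R); first by rewrite mulf_neq0 ?invr_eq0.
by rewrite -scalerA -h scalerA mulVf // scale1r.
Qed.

Let thetaKs b : fixed b -> theta (theta b) = b.
Proof. by case=> sb _; apply: (thetaK univ psis psix psiu psiv psiy ss sE pars parE). Qed.

Let thetaMs a b : fixed a -> fixed b -> theta (a * b) = theta a * theta b.
Proof. by case=> sa _ [sb _]; apply: (thetaM univ psis psix psiu psiv psiy ss sE). Qed.

(** The image is closed because theta is continuous and involutive: a limit a of values of theta is
    theta (theta a), with theta a invariant. *)
Lemma theta_image_cstar : cstar_subalg (theta @` fixed).
Proof.
have [fS f1 fM fs fcl] := fixedC; split.
- split; first by exists 0; [exact: (proj1 fS) | rewrite /theta raddf0 mxE].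
  move=> c _ _ [a af <-] [b bf <-]; exists (c *: a + b); last exact: thetaD.
  exact: (proj2 fS).
- by exists 1; rewrite ?theta1.
- by move=> _ _ [a af <-] [b bf <-]; exists (a * b); [exact: fM | exact: thetaMs].
- by move=> _ [a af <-]; exists (star a); [exact: fs | exact: theta_star].
- apply/norm_closedP => a aP; exists (theta a).
    apply: (proj1 (norm_closedP _) fcl).
    by apply: (adherent_map (theta_lip psis) _ aP) => _ [b bf <-]; rewrite thetaKs.
  have lip2 := cnorm_lip_comp (theta_lip psis) (theta_lip psis).
  apply: (adherent_eq lip2 (cnorm_lip_id _) _ aP) => _ [b bf <-] /=.
  by rewrite (thetaKs bf).
Qed.

(** This lets [fixed_generated] be applied with the elements that theta sends into [G]. *)
Lemma theta_preimage_cstar (G : set A) : cstar_subalg G ->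
  cstar_subalg [set b | fixed b /\ G (theta b)].
Proof.
have [fS f1 fM fs fcl] := fixedC => -[GS G1 GM Gs Gcl]; split.
- split.
    by split; [exact: (proj1 fS) | rewrite /theta raddf0 mxE; exact: (proj1 GS)].
  move=> c a b [af aG] [bf bG]; split; first exact: (proj2 fS).
  by rewrite thetaD; apply: (proj2 GS).
- by split; rewrite ?theta1.
- by move=> a b [af aG] [bf bG]; split; [exact: fM | rewrite thetaMs //; exact: GM].
- by move=> a [af aG]; split; [exact: fs | rewrite theta_star //; exact: Gs].
- apply/norm_closedP => a aP; split.
    apply: (proj1 (norm_closedP _) fcl).
    by apply: (adherent_map (cnorm_lip_id _) _ aP) => b [].
  apply: (proj1 (norm_closedP _) Gcl).
  by apply: (adherent_map (theta_lip psis) _ aP) => b [].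
Qed.

Lemma gen_etaE : gen_cstar (range (eta_vec w)) = theta @` fixed.
Proof.
apply/seteqP; split.
  apply: gen_cstar_sub theta_image_cstar _ => _ [j _ <-].
  have [c _ ->] := eta_theta_zeta j.
  have [tS _ _ _ _] := theta_image_cstar.
  by apply: (subspaceZ _ tS); exists (zeta j); first exact: zeta_fixed.
move=> _ [b bf <-].
have gC := gen_cstar_subalg (range (eta_vec w)).
have [w0 w0P] := @primitive_root_exists R n (leq_trans (isT : 0 < 3)%N n3).
suff /(_ b bf)[] : fixed `<=` [set b | fixed b /\ gen_cstar (range (eta_vec w)) (theta b)] by [].
apply: (fixed_generated univ ss sE rotP n3 w0P (theta_preimage_cstar gC)) => p pP.
split; first exact: (sym_fixed univ ss sE rotP n3 pP).
have qux : qcomm u x.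
  by have [ux _ _ _ _ _ _ _ _] := proj1 univ; exists (-1); rewrite scaleN1r.
(* Since u and x anticommute, a word of length n in x, u is a multiple of some x ^+ (n - l) * u ^+
   l, whose [sym] is [zeta l]. *)
have [l le_ln [c ->]] := wlen_normal qux pP.
pose j : 'I_n.+1 := Ordinal (le_ln : (l < n.+1)%N).
have -> : sym s (c *: (x ^+ (n - l) * u ^+ l)) = c *: zeta j.
  by rewrite /sym linearZ /= -scalerDr -/(sym s _) symX.
have [d d0 etaE] := eta_theta_zeta j.
have -> : theta (c *: zeta j) = (c / d) *: eta_vec w j.
  by rewrite etaE scalerA divfK // /theta linearZ /= cmxZ.
have [gS _ _ _ _] := gC.
have jP : range (eta_vec w) (eta_vec w j) by exists j.
exact: (subspaceZ _ gS (sub_gen_cstar jP)).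
Qed.

Lemma fixed_covariant_iso :
  covariant_iso tens delta fixed (gen_cstar (range (eta_vec w))).
Proof.
have [w0 w0P] := @primitive_root_exists R n (leq_trans (isT : 0 < 3)%N n3).
have [F [Fc FE FW Fdelta]] := theta_tens_exists univ tensP deltaP ss sE pars parE rotP
  psis psix psiu psiv psiy n3 w0P.
have cf := fixed_coinvariant univ tensP deltaP ss sE rotP n3 w0P.
rewrite gen_etaE; split=> //.
  (* By covariance, delta (theta b) is the image of delta b under theta (x) id, and this map sends
     lists of invariants to lists in the image. *)
  move=> _ [b bf <-]; rewrite Fdelta //; apply: FW (cf _ bf); first exact: closed_span_closed.
  move=> r rf; rewrite (tens_subE tensC); last by case: theta_image_cstar.
  apply: adherent_mem; exists [seq (theta p.1, p.2) | p <- r]; last by rewrite /tsum big_map.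
  by move=> q /mapP[p pr ->] /=; exists p.1; first exact: rf.
exists theta.
  split=> [|c a b _ _|a b|a _]; last 3 first.
  - exact: thetaD.
  - exact: thetaMs.
  - exact: theta_star.
  split.
  - by move=> b bf; exists b.
  - by move=> a b /set_mem af /set_mem bf e; rewrite -(thetaKs af) e thetaKs.
  - by move=> _ [b bf <-]; exists b.
exists F => //; split=> // a b af.
have := FE [:: (a, b)]; rewrite /tsum !big_seq1; apply.
by move=> p; rewrite inE => /eqP->.
Qed.

End EtaRelation.

Theorem proposition8p11 (R : realType) (A T : cstarType R) (x u v y : A)
    (tens : A -> A -> T) (delta : {lrmorphism A -> T})
    (n : nat) (w : 'M[A]_(n.+1)) :
  su_universal x u v y ->
  min_tensor tens ->
  su_coproduct tens x u v y delta ->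
  (3 <= n)%N -> odd n ->
  spin_rep tens x v delta w ->
  covariant_iso tens delta
    (Dn_quotient tens x u v y delta n)
    (gen_cstar (range (eta_vec w))).
Proof.
move=> univ tensP deltaP n3 nodd wP.
have [s [ss sE]] := flip_exists univ.
have [par [pars parE]] : exists par : {lrmorphism A -> A}, star_preserving par /\
    [/\ par x = - x, par u = - u, par v = - v & par y = - y].
  have N1 : (-1) * Num.conj (-1) = 1 :> R[i] by rewrite rmorphN1 mulrNN mulr1.
  have [par [pars parE]] := rot_exists univ N1; exists par; split=> //.
  by move: parE; rewrite rmorphN1 !scaleN1r.
have /choice[rot rotP] : forall z : R[i], exists rot : {lrmorphism A -> A},
    z * Num.conj z = 1 -> star_preserving rot /\
    [/\ rot x = z *: x, rot u = z *: u, rot v = Num.conj z *: v &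
        rot y = Num.conj z *: y].
  (* Off the unit circle no rotation is required, and [s] is an arbitrary default. *)
  move=> z; have [z1|z1] := pselect (z * Num.conj z = 1); last by exists s.
  by have [rot rotE] := rot_exists univ z1; exists rot.
have [psi [psis [psix psiu psiv psiy]]] := psi_exists univ.
rewrite (Dn_quotientE univ tensP deltaP ss sE rotP (leq_trans (isT : 0 < 3)%N n3)).
exact: (fixed_covariant_iso univ tensP deltaP ss sE pars parE rotP
  psis psix psiu psiv psiy n3 nodd wP).
Qed.
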